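(* Let $n\ge1$ be a natural number (even or odd) and let $s\in\mathbb{R}$. Then, as functions of $x\in\mathbb{R}^{n+1}$, $$\Delta^{\frac{n-1}{2}}S^{-1}(s,x)=\gamma_n\,(s-\bar x)\,(s^2-2x_0s+|x|^2)^{-\frac{n+1}{2}},$$ where, for $n$ odd, the equality is pointwise for $x\neq s$, and, for $n$ even, $\Delta^{\frac{n-1}{2}}$ is the fractional power defined by Fourier multipliers and the equality holds in the sense of tempered distributions on $\mathbb{R}^{n+1}$.
   Context: $\mathbb{R}_n$ denotes the real Clifford algebra over $n$ imaginary units $e_1,\dots,e_n$ with $e_\ell e_m+e_me_\ell=0$ for $\ell\neq m$ and $e_\ell^2=-1$. A point $(x_0,\dots,x_n)\in\mathbb{R}^{n+1}$ is identified with the paravector $x=x_0+\underline{x}$, $\underline{x}=\sum_{\ell=1}^n x_\ell e_\ell$; $\bar x=x_0-\underline{x}$, $|x|^2=\sum_{\ell=0}^n x_\ell^2$. The symbol $i$ is the complex imaginary unit, commuting with all $e_\ell$; values are taken in the complexified Clifford algebra $\mathbb{C}\otimes\mathbb{R}_n$. For $s\in\mathbb{R}$, $x\neq s$: $S^{-1}(s,x):=(s-\bar x)(s^2-2x_0s+|x|^2)^{-1}$ (the left and right slice monogenic Cauchy kernels, which coincide for real $s$). Note that $s^2-2x_0s+|x|^2=(s-x_0)^2+|\underline{x}|^2>0$. Constants: $\gamma_n:=(-1)^{\frac{n-1}{2}}2^{n-1}\left[\Gamma\left(\frac{n+1}{2}\right)\right]^2$, where $(-1)^{\frac{n-1}{2}}=i^{\,n-1}$.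 $\Delta=\sum_{j=0}^n\partial_{x_j}^2$ is the Laplacian in the variable $x\in\mathbb{R}^{n+1}$. For $n$ even, $\Delta^{\frac{n-1}{2}}f:=\mathcal{R}\big[(i|\xi|)^{n-1}\,\mathrm{F}[f](\xi)\big]$, where $\mathrm{F}[f](\xi)=\int_{\mathbb{R}^{n+1}}f(x)e^{-i(x,\xi)}dx$, $(x,\xi)=\sum_{j=0}^n x_j\xi_j$, and $\mathcal{R}[g](x)=\frac{1}{(2\pi)^{n+1}}\int_{\mathbb{R}^{n+1}}g(\xi)e^{i(x,\xi)}d\xi$ are the Fourier and inverse Fourier transforms, extended to tempered distributions. This applies to $f=S^{-1}(s,\cdot)$, whose distributional Fourier transform is a locally integrable function for which the product with $(i|\xi|)^{n-1}$ is again a tempered, locally integrable function. *)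

(* Defs.v *)
From HB Require Import structures.
From mathcomp Require Import all_boot all_order all_algebra.
From mathcomp Require Import all_classical all_reals all_analysis.
From mathcomp Require Import complex.
From mathcomp Require Import ring.

Set Implicit Arguments.
Unset Strict Implicit.
Unset Printing Implicit Defensive.
Import Order.TTheory GRing.Theory Num.Theory.
Import numFieldNormedType.Exports.

Local Open Scope classical_set_scope.
Local Open Scope ring_scope.

(** * The Clifford algebra K_n over a commutative ring K, with e_l ^ 2 = -1 *)

(* An element is given by its coordinates in the basis of blades
   e_A = e_{a_1} ... e_{a_k}, for A = {a_1 < ... < a_k} a subset of 'I_n.
   For K = R[i] this is the complexification of the real Clifford algebra. *)
Definition clifford (K : Type) (n : nat) : Type := {ffun {set 'I_n} -> K}.

Section SymmetricDifference.
Variable T : finType.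
Implicit Types A B C : {set T}.

Definition symd A B := [set x | (x \in A) (+) (x \in B)]%SET.

Lemma symdC A B : symd A B = symd B A.
Proof. by apply/setP => x; rewrite !inE addbC. Qed.

Lemma symdA A B C : symd A (symd B C) = symd (symd A B) C.
Proof. by apply/setP => x; rewrite !inE addbA. Qed.

Lemma symd0 A : symd A finset.set0 = A.
Proof. by apply/setP => x; rewrite !inE addbF. Qed.

Lemma sym0d A : symd finset.set0 A = A.
Proof. by rewrite symdC symd0. Qed.

Lemma symdd A : symd A A = finset.set0.
Proof. by apply/setP => x; rewrite !inE addbb. Qed.

Lemma symdK A : involutive (symd A).
Proof. by move=> B; rewrite symdA symdd sym0d. Qed.

End SymmetricDifference.

Section CliffordAlgebra.
Variables (K : comNzRingType) (n : nat).
Implicit Types (A B C D : {set 'I_n}) (f g h : clifford K n).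

HB.instance Definition _ := GRing.Zmodule.copy (clifford K n)
  {ffun {set 'I_n} -> K}.

(* Number of pairs (a, b) in A x B with b <= a. In e_A e_B, bringing e_b to its
   place changes the sign once for every a > b, and e_b e_b = -1 accounts for
   a = b; hence e_A e_B = (-1) ^ (blade_inv A B) e_(A symd B). *)
Definition blade_inv A B : nat :=
  (\sum_(a in A) \sum_(b in B) (b <= a : nat))%N.

Definition blade_sgn A B : K := (-1) ^+ blade_inv A B.

Definition blade A : clifford K n := [ffun C => (C == A)%:R].

Definition clifford_one : clifford K n := blade finset.set0.

Definition clifford_mul f g : clifford K n :=
  [ffun C => \sum_A \sum_(B | symd A B == C) blade_sgn A B * (f A * g B)].

Definition clifford_scale (c : K) f : clifford K n := [ffun A => c * f A].

Lemma odd_sum_mem A (F : 'I_n -> nat) :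
  odd (\sum_(a in A) F a) = \big[addb/false]_a ((a \in A) && odd (F a)).
Proof.
rewrite big_mkcond (big_morph odd oddD (erefl _)).
by apply: eq_bigr => a _; case: (a \in A).
Qed.

Lemma odd_blade_inv A B : odd (blade_inv A B) =
  \big[addb/false]_a \big[addb/false]_b [&& a \in A, b \in B & (b <= a)%N].
Proof.
rewrite /blade_inv odd_sum_mem; apply: eq_bigr => a _.
rewrite odd_sum_mem; case: (a \in A) => /=; last by rewrite big1.
by apply: eq_bigr => b _; rewrite oddb.
Qed.

Lemma odd_blade_inv_symdl A B C :
  odd (blade_inv (symd A B) C) = odd (blade_inv A C) (+) odd (blade_inv B C).
Proof.
rewrite !odd_blade_inv -big_split; apply: eq_bigr => a _ /=.
rewrite -big_split; apply: eq_bigr => b _ /=; rewrite inE.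
by case: (a \in A); case: (a \in B) => //=; rewrite ?addbb ?addbF.
Qed.

Lemma odd_blade_inv_symdr A B C :
  odd (blade_inv A (symd B C)) = odd (blade_inv A B) (+) odd (blade_inv A C).
Proof.
rewrite !odd_blade_inv -big_split; apply: eq_bigr => a _ /=.
rewrite -big_split; apply: eq_bigr => b _ /=; rewrite inE.
by case: (a \in A); case: (b \in B); case: (b \in C) => //=;
  rewrite ?addbb ?addbF.
Qed.

Lemma blade_sgnA A B C : blade_sgn A B * blade_sgn (symd A B) C =
  blade_sgn B C * blade_sgn A (symd B C).
Proof.
rewrite /blade_sgn -!exprD -signr_odd -[RHS]signr_odd !oddD.
rewrite odd_blade_inv_symdl odd_blade_inv_symdr.
by case: (odd _); case: (odd _); case: (odd _).
Qed.

Lemma blade_sgn0l B : blade_sgn finset.set0 B = 1.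
Proof. by rewrite /blade_sgn /blade_inv big_set0. Qed.

Lemma blade_sgn0r A : blade_sgn A finset.set0 = 1.
Proof.
by rewrite /blade_sgn /blade_inv big1 // => a _; rewrite big_set0.
Qed.

Lemma clifford_mulE f g C :
  clifford_mul f g C =
  \sum_A blade_sgn A (symd A C) * (f A * g (symd A C)).
Proof.
rewrite ffunE; apply: eq_bigr => A _; rewrite (big_pred1 (symd A C)) // => B /=.
by apply/eqP/eqP => [<-|->]; rewrite symdK.
Qed.

Fact clifford_mulA : associative clifford_mul.
Proof.
move=> f g h; apply/ffunP => D; rewrite !clifford_mulE.
transitivity (\sum_A \sum_B blade_sgn A (symd A D) *
    (f A * (blade_sgn B (symd B (symd A D)) *
            (g B * h (symd B (symd A D)))))).
  by apply: eq_bigr => A _; rewrite clifford_mulE !mulr_sumr.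
transitivity (\sum_C \sum_A blade_sgn C (symd C D) *
    (blade_sgn A (symd A C) * (f A * g (symd A C)) * h (symd C D))); last first.
  by apply: eq_bigr => C _; rewrite clifford_mulE mulr_suml mulr_sumr.
rewrite [RHS]exchange_big; apply: eq_bigr => A _ /=.
rewrite [RHS](reindex_inj (inv_inj (symdK A))); apply: eq_bigr => B _ /=.
rewrite symdK; have -> : symd (symd A B) D = symd B (symd A D).
  by rewrite symdA (symdC A B).
have := blade_sgnA A B (symd B (symd A D)); rewrite (symdK B) => e.
ring: e.
Qed.

Fact clifford_mul1 : left_id clifford_one clifford_mul.
Proof.
move=> f; apply/ffunP => C; rewrite clifford_mulE (bigD1 finset.set0) //=.
rewrite big1 => [|A /negPf A0]; first by
  rewrite ffunE eqxx sym0d blade_sgn0l !mul1r addr0.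
by rewrite ffunE A0 mul0r mulr0.
Qed.

Fact clifford_1mul : right_id clifford_one clifford_mul.
Proof.
move=> f; apply/ffunP => C; rewrite clifford_mulE (bigD1 C) //=.
rewrite big1 => [|A /negPf AC]; first by
  rewrite symdd blade_sgn0r ffunE eqxx mulr1 mul1r addr0.
rewrite ffunE -(inj_eq (inv_inj (symdK A))) symdK symd0 eq_sym AC.
by rewrite !mulr0.
Qed.

Fact clifford_mulDl : left_distributive clifford_mul +%R.
Proof.
move=> f g h; apply/ffunP => C.
rewrite [RHS]ffunE !clifford_mulE -big_split.
by apply: eq_bigr => A _; rewrite ffunE mulrDl mulrDr.
Qed.

Fact clifford_mulDr : right_distributive clifford_mul +%R.
Proof.
move=> f g h; apply/ffunP => C.
rewrite [RHS]ffunE !clifford_mulE -big_split.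
by apply: eq_bigr => A _; rewrite ffunE !mulrDr.
Qed.

Fact clifford_one_neq0 : clifford_one != 0.
Proof.
apply/eqP => /ffunP /(_ finset.set0) /eqP.
by rewrite !ffunE eqxx oner_eq0.
Qed.

HB.instance Definition _ := GRing.Zmodule_isNzRing.Build (clifford K n)
  clifford_mulA clifford_mul1 clifford_1mul clifford_mulDl clifford_mulDr
  clifford_one_neq0.

Fact clifford_scaleA a b f :
  clifford_scale a (clifford_scale b f) = clifford_scale (a * b) f.
Proof. by apply/ffunP => A; rewrite !ffunE mulrA. Qed.

Fact clifford_scale1 : left_id 1 clifford_scale.
Proof. by move=> f; apply/ffunP => A; rewrite !ffunE mul1r. Qed.

Fact clifford_scaleDr : right_distributive clifford_scale +%R.
Proof. by move=> a f g; apply/ffunP => A; rewrite !ffunE mulrDr. Qed.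

Fact clifford_scaleDl f : {morph clifford_scale^~ f : a b / a + b}.
Proof. by move=> a b; apply/ffunP => A; rewrite !ffunE mulrDl. Qed.

HB.instance Definition _ := GRing.Zmodule_isLmodule.Build K (clifford K n)
  clifford_scaleA clifford_scale1 clifford_scaleDr clifford_scaleDl.

Fact clifford_scaleAl (a : K) f g : a *: (f * g) = a *: f * g.
Proof.
apply/ffunP => C; rewrite ffunE !clifford_mulE mulr_sumr.
by apply: eq_bigr => A _; rewrite ffunE mulrCA !mulrA.
Qed.

HB.instance Definition _ := GRing.Lmodule_isLalgebra.Build K (clifford K n)
  clifford_scaleAl.

Fact clifford_scaleAr (a : K) f g : a *: (f * g) = f * (a *: g).
Proof.
apply/ffunP => C; rewrite ffunE !clifford_mulE mulr_sumr.
by apply: eq_bigr => A _; rewrite ffunE mulrCA; congr (_ * _); rewrite mulrCA.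
Qed.

HB.instance Definition _ := GRing.Lalgebra_isAlgebra.Build K (clifford K n)
  clifford_scaleAr.

Lemma bladeM A B : blade A * blade B = blade_sgn A B *: blade (symd A B).
Proof.
apply/ffunP => C; rewrite clifford_mulE (bigD1 A) //= big1 => [|D /negPf DA].
  rewrite !ffunE eqxx mul1r addr0 -(inj_eq (inv_inj (symdK A)) _ B) symdK.
  by have [->|_] := eqVneq C (symd A B); rewrite ?symdK ?mulr0.
by rewrite ffunE DA mul0r mulr0.
Qed.

Definition cl_e (l : 'I_n) : clifford K n := blade [set l]%SET.

Lemma cl_eM_self l : cl_e l * cl_e l = -1.
Proof.
rewrite bladeM symdd /blade_sgn /blade_inv !big_set1 leqnn expr1.
by rewrite scaleN1r.
Qed.

Lemma cl_eM_anti l m : l != m -> cl_e l * cl_e m + cl_e m * cl_e l = 0.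
Proof.
move=> lm; rewrite !bladeM [symd [set m]%SET _]symdC -scalerDl.
rewrite /blade_sgn /blade_inv !big_set1.
have [lt_lm|lt_ml|e] := ltngtP m l; last by rewrite (ord_inj e) eqxx in lm.
- by rewrite expr1 expr0 addNr scale0r.
- by rewrite expr0 expr1 addrN scale0r.
Qed.

End CliffordAlgebra.

(** * Lebesgue measure on R^N *)

Section LebesgueMeasure.
Variable R : realType.
Local Notation Rm := (measurableTypeR R).

Definition cons_pair N (z : Rm * N.-tuple Rm) : N.+1.-tuple Rm :=
  [tuple of z.1 :: z.2].

Lemma measurable_cons_pair N :
  measurable_fun [set: Rm * N.-tuple Rm] (@cons_pair N).
Proof. exact: measurable_cons. Qed.

Section Step.
Local Open Scope ereal_scope.
Variables (N : nat) (mu : {sigma_finite_measure set (N.-tuple Rm) -> \bar R}).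

Definition lebesgue_cons : set (N.+1.-tuple Rm) -> \bar R :=
  pushforward (@lebesgue_measure R \x mu) (@cons_pair N).

Let lebesgue_cons0 : lebesgue_cons set0 = 0.
Proof. by rewrite /lebesgue_cons /pushforward preimage_set0 measure0. Qed.

Let lebesgue_cons_ge0 A : 0 <= lebesgue_cons A.
Proof. by rewrite /lebesgue_cons /pushforward; apply: measure_ge0. Qed.

Let lebesgue_cons_sigma_additive : semi_sigma_additive lebesgue_cons.
Proof.
move=> F mF tF mUF; rewrite /lebesgue_cons /pushforward preimage_bigcup.
apply: measure_semi_sigma_additive.
- by move=> k; rewrite -[X in measurable X]setTI; exact: measurable_cons_pair.
- apply/trivIsetP => /= i j _ _ ij; rewrite -preimage_setI.
  by move/trivIsetP : tF => /(_ _ _ _ _ ij) ->//; rewrite preimage_set0.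
- rewrite -preimage_bigcup -[X in measurable X]setTI.
  exact: measurable_cons_pair.
Qed.

HB.instance Definition _ := isMeasure.Build _ _ _ lebesgue_cons
  lebesgue_cons0 lebesgue_cons_ge0 lebesgue_cons_sigma_additive.

Let prod_sigma_finite : sigma_finite setT (@lebesgue_measure R \x mu).
Proof.
have /sigma_finiteP[F [TF ndF Foo]] := sigma_finiteT (@lebesgue_measure R).
have /sigma_finiteP[G [TG ndG Goo]] := sigma_finiteT mu.
exists (fun k => F k `*` G k).
  rewrite -setXTT TF TG predeqE => -[x y]; split.
    move=> [/= [k _ Fkx] [l _ Gly]]; exists (maxn k l) => //; split.
    - by move: x Fkx; exact/subsetPset/ndF/leq_maxl.
    - by move: y Gly; exact/subsetPset/ndG/leq_maxr.
  by move=> [k _ []/= ? ?]; split; exists k.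
move=> k; have [? ?] := Foo k; have [? ?] := Goo k.
split; first exact: measurableX.
by rewrite product_measure1E// lte_mul_pinfty// ge0_fin_numE.
Qed.

Let lebesgue_cons_sigma_finite : sigma_finite setT lebesgue_cons.
Proof.
have [F FT Foo] := prod_sigma_finite.
pose uncons (t : N.+1.-tuple Rm) : (Rm * N.-tuple Rm)%type :=
  (thead t, [tuple of behead t]).
have unconsK : cancel uncons (@cons_pair N).
  by move=> t; rewrite /uncons /cons_pair /= -tuple_eta.
have cons_pairK : cancel (@cons_pair N) uncons.
  move=> [x t]; rewrite /uncons /cons_pair /= theadE; congr (_, _).
  exact: val_inj.
exists (fun k => uncons @^-1` F k).
  by rewrite -preimage_bigcup -FT preimage_setT.
move=> k; have [mF Fk] := Foo k; split.
  rewrite -[X in measurable X]setTI.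
  apply: (_ : measurable_fun setT uncons) => //.
  apply/measurable_fun_pairP; split.
    exact: (measurable_tnth ord0).
  exact: measurable_behead.
rewrite /lebesgue_cons /pushforward -comp_preimage.
by rewrite (_ : uncons \o _ = idfun) //; apply/funext => z; exact: cons_pairK.
Qed.

HB.instance Definition _ := Measure_isSigmaFinite.Build _ _ _ lebesgue_cons
  lebesgue_cons_sigma_finite.

End Step.

Fixpoint lebesgue_tuple N : {sigma_finite_measure set (N.-tuple Rm) -> \bar R} :=
  if N is M.+1 then lebesgue_cons (lebesgue_tuple M)
  else dirac ([tuple] : 0.-tuple Rm).

End LebesgueMeasure.

(** * Integrals, partial derivatives and the Fourier transform on R^N *)

Section EuclideanSpace.
Variables (R : realType) (N : nat).
Local Notation V := 'rV[R]_N.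
Local Notation C := R[i].
Implicit Types (x xi : V) (D : set V) (j : 'I_N).

Definition dotv x xi : R := \sum_j x 0 j * xi 0 j.

(* The norm `|x| of the library on row vectors is the maximum norm. *)
Definition enorm x : R := Num.sqrt (\sum_j x 0 j ^+ 2).

Definition rV_of_tuple (t : N.-tuple (measurableTypeR R)) : V :=
  \row_j tnth t j.

Definition rV_integrable D (f : V -> R) : Prop :=
  (lebesgue_tuple R N).-integrable (rV_of_tuple @^-1` D)
    (fun t => (f (rV_of_tuple t))%:E).

Definition rV_integral (f : V -> R) : R :=
  \int[lebesgue_tuple R N]_t f (rV_of_tuple t).

Definition cintegrable D (f : V -> C) : Prop :=
  rV_integrable D (fun x => complex.Re (f x)) /\
  rV_integrable D (fun x => complex.Im (f x)).

Definition cintegral (f : V -> C) : C :=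
  (rV_integral (fun x => complex.Re (f x)) +i*
   rV_integral (fun x => complex.Im (f x)))%C.

Definition cpartial j (f : V -> C) : V -> C := fun x =>
  ('D_(delta_mx 0 j) (fun y => complex.Re (f y)) x +i*
   'D_(delta_mx 0 j) (fun y => complex.Im (f y)) x)%C.

Definition cpartials (js : seq 'I_N) (f : V -> C) : V -> C :=
  foldr cpartial f js.

Definition expi (t : R) : C := (cos t +i* sin t)%C.

Definition fourier (f : V -> C) : V -> C := fun xi =>
  cintegral (fun x => f x * expi (- dotv x xi)).

Definition inv_fourier (g : V -> C) : V -> C := fun x =>
  (((2 * pi) ^+ N)^-1)%:C%C * cintegral (fun xi => g xi * expi (dotv x xi)).

End EuclideanSpace.

(** * Schwartz functions and tempered distributions *)

Section Schwartz.
Variables (R : realType) (N : nat).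
Local Notation V := 'rV[R]_N.
Local Notation C := R[i].

Definition smooth (phi : V -> C) : Prop := forall (js : seq 'I_N) (x : V),
  differentiable (fun y => complex.Re (cpartials js phi y)) x /\
  differentiable (fun y => complex.Im (cpartials js phi y)) x.

Definition schwartz_values (k : nat) (phi : V -> C) : set R :=
  [set r | exists (js : seq 'I_N) (x : V), (size js <= k)%N /\
     r = (1 + enorm x) ^+ k * Normc.normc (cpartials js phi x)].

Definition schwartz (phi : V -> C) : Prop :=
  smooth phi /\ forall k, has_ubound (schwartz_values k phi).

Definition schwartz_norm (k : nat) (phi : V -> C) : R :=
  sup (schwartz_values k phi).

Variable n : nat.
Local Notation Cl := (clifford C n).

(* A distribution with values in the complexified Clifford algebra is given by
   its action on scalar test functions; only its values on Schwartz functions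
   are meaningful. *)
Definition cl_distribution := (V -> C) -> Cl.

Definition tempered (T : cl_distribution) : Prop :=
  (forall (c : C) (phi psi : V -> C), schwartz phi -> schwartz psi ->
     T (fun x => c * phi x + psi x) = c *: T phi + T psi) /\
  (exists (k : nat) (M : R), forall phi, schwartz phi ->
     forall A, Normc.normc (T phi A) <= M * schwartz_norm k phi).

Definition dist_eq (T U : cl_distribution) : Prop :=
  forall phi, schwartz phi -> T phi = U phi.

Definition cl_integrable (D : set V) (f : V -> Cl) : Prop :=
  forall A, cintegrable D (fun x => f x A).

Definition cl_integral (f : V -> Cl) : Cl :=
  [ffun A => cintegral (fun x => f x A)].

Definition locally_integrable_fun (f : V -> Cl) : Prop :=
  forall r : R, cl_integrable [set x | enorm x <= r] f.

Definition regular_dist (f : V -> Cl) : cl_distribution := fun phi =>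
  cl_integral (fun x => phi x *: f x).

Definition tempered_fun (f : V -> Cl) : Prop :=
  [/\ locally_integrable_fun f,
      forall phi, schwartz phi -> cl_integrable setT (fun x => phi x *: f x)
    & tempered (regular_dist f)].

Definition fourier_dist (T : cl_distribution) : cl_distribution := fun phi =>
  T (fourier phi).

Definition inv_fourier_dist (T : cl_distribution) : cl_distribution := fun phi =>
  T (inv_fourier phi).

(* U = Delta ^ (k / 2) T, the Fourier multiplier with symbol (i |xi|) ^ k. The
   product of the symbol with the Fourier transform of T is formed as a product
   of functions, so that transform has to be a locally integrable function, as
   has the product; g is then unique up to a null set. *)
Definition frac_laplacian (k : nat) (T U : cl_distribution) : Prop :=
  exists g : V -> Cl,
    let sg := fun xi : V => ('i%C * (enorm xi)%:C%C) ^+ k *: g xi in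
    [/\ tempered T /\ tempered U,
        tempered_fun g, dist_eq (fourier_dist T) (regular_dist g),
        tempered_fun sg & dist_eq U (inv_fourier_dist (regular_dist sg))].

Definition cl_partial (j : 'I_N) (f : V -> Cl) : V -> Cl := fun x =>
  [ffun A => cpartial j (fun y => f y A) x].

Definition laplacian (f : V -> Cl) : V -> Cl := fun x =>
  \sum_j cl_partial j (cl_partial j f) x.

End Schwartz.

(** * Paravectors and the slice monogenic Cauchy kernel *)

Section CauchyKernel.
Variables (R : realType) (n : nat).
Local Notation V := 'rV[R]_n.+1.
Local Notation C := R[i].
Local Notation Cl := (clifford C n).
Implicit Types (s : R) (x : V).

(* The imaginary units e_1, ..., e_n are indexed by 0, ..., n - 1 in 'I_n, so
   that the coordinate of [cl_e C l] has index lift ord0 l = l + 1. *)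
Definition vector_part x : Cl :=
  \sum_(l < n) (x 0 (lift ord0 l))%:C%C *: cl_e C l.

Definition cl_real (r : R) : Cl := r%:C%C%:A.

Definition paravector x : Cl := cl_real (x 0 0) + vector_part x.

Definition paravector_conj x : Cl := cl_real (x 0 0) - vector_part x.

Definition quad s x : R := s ^+ 2 - 2 * x 0 0 * s + enorm x ^+ 2.

Definition S_inv s x : Cl :=
  (cl_real s - paravector_conj x) * cl_real (quad s x)^-1.

Definition Gamma (a : R) : R :=
  \int[lebesgue_measure]_(t in `]0, +oo[) (t `^ (a - 1) * expR (- t)).

(* The factor (-1) ^ ((n - 1) / 2) is i ^ (n - 1). *)
Definition gamma_const : C :=
  'i%C ^+ n.-1 * (2 ^+ n.-1 * Gamma (n.+1%:R / 2) ^+ 2)%:C%C.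

Definition F_kernel s x : Cl :=
  gamma_const *: ((cl_real s - paravector_conj x) *
                  cl_real (quad s x `^ (- (n.+1%:R / 2)))).

End CauchyKernel.

(* Main.v *)
From HB Require Import structures.
Require Import Defs.
From mathcomp Require Import all_boot all_order all_algebra.
From mathcomp Require Import all_classical all_reals all_analysis.
From mathcomp Require Import measurable_realfun complex.
From mathcomp Require Import ring lra.

Set Implicit Arguments.
Unset Strict Implicit.
Unset Printing Implicit Defensive.
Import Order.TTheory GRing.Theory Num.Theory.
Import numFieldNormedType.Exports.

Local Open Scope classical_set_scope.
Local Open Scope ring_scope.

(** Write N = n + 1 and y = x - s. Multiplying out, s - conj x is a combination
    of the coordinates y_j with constant Clifford coefficients, and
    s^2 - 2 x_0 s + |x|^2 = |y|^2. So the left-hand kernel is a combination of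
    the functions y_j / |y|^2, the right-hand one is the same combination of
    gamma_n y_j / |y|^N, and the claim becomes a scalar one for every j.

    For n odd, the Laplacian of y_j |y|^(-2p) is 2p (2p - N) y_j |y|^(-2p-2)
    ([sum_ddpower]). With n = 2m + 1, applying this for p = 1, ..., m gives the
    power |y|^(-N) and the factor (-4)^m m!^2 ([lap_cst_odd]), which is gamma_n
    because Gamma (m + 1) = m! ([Gamma_nat]).

    For n even, everything follows from one identity ([fourier_riesz]): for a
    Schwartz function phi and eps = 1 or -1,

      int F(phi)(eps x) x_j / |x|^2 dx = i eps c int phi(x) x_j / |x|^N dx,
      F(phi)(eta) = int phi(x) exp (i (x, eta)) dx,
      c = (2 sqrt pi)^N Gamma (N / 2) / 2.

    To see it, write x_j / |x|^2 as the integral over all real v of the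
    Gaussians x_j exp (v - e^v |x|^2). The Fourier transform of a Gaussian of this kind is
    explicit ([cintegral_coord_gauss]): integration by parts turns the factor
    x_j into a multiple of eta_j and yields a differential equation along the
    rays through the origin. Moving the Fourier transform from phi to the
    Gaussian and integrating back over v gives a multiple of x_j / |x|^N.

    The identity is used twice. With eps = -1 it computes the Fourier transform
    of y_j / |y|^2, a multiple of xi_j / |xi|^N with a phase for the shift by s
    ([fourier_S_coord]). The symbol (i |xi|)^(n-1) turns xi_j / |xi|^N into
    i^(n-1) xi_j / |xi|^2, and the identity with eps = 1 then computes the inverse
    transform of this function, tested against phi, as a multiple of y_j / |y|^N
    ([inv_fourier_S_coord]). The constants combine to
    (2 pi)^(-N) i^(n-1) c^2 = gamma_n ([gamma_fourier_cst]).

    All integrals converge absolutely for the same reason. A Schwartz function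
    and its Fourier transform are at most a constant times
    prod_j 1 / (1 + x_j^2), called [weight], and the kernels are at most a
    constant times 1 + |x - s|^(-(N-1)), called [sing]. Since
    |x|^(-(N-1)) <= prod_j |x_j|^(-(N-1)/N), the product of the two is dominated
    by a product of integrable functions of one variable
    ([integral_weight_sing]). *)

(** * Complex numbers: modulus, real and imaginary parts *)

Notation cabs := Normc.normc.

Section ComplexModulus.
Variable R : realType.
Implicit Types z w : R[i].

Lemma cabs_ge0 z : 0 <= cabs z.
Proof. by case: z => a b; rewrite sqrtr_ge0. Qed.

Lemma normr_Re_le z : `|complex.Re z| <= cabs z.
Proof.
case: z => a b /=; rewrite -sqrtr_sqr ler_wsqrtr// lerDl sqr_ge0//.
Qed.

Lemma normr_Im_le z : `|complex.Im z| <= cabs z.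
Proof.
case: z => a b /=; rewrite -sqrtr_sqr ler_wsqrtr// lerDr sqr_ge0//.
Qed.

Lemma cabs_le_ReIm z : cabs z <= `|complex.Re z| + `|complex.Im z|.
Proof.
case: z => a b /=; rewrite -[leRHS]ger0_norm ?addr_ge0// -sqrtr_sqr ler_wsqrtr//.
rewrite sqrrD !real_normK ?num_real// -addrA lerD2l lerDr.
by rewrite mulrn_wge0// mulr_ge0.
Qed.

Lemma cabs_real (r : R) : cabs (r%:C)%C = `|r|.
Proof. by rewrite /= expr0n addr0 sqrtr_sqr. Qed.

Lemma cabsM z w : cabs (z * w) = cabs z * cabs w.
Proof. exact: Normc.normcM. Qed.

Lemma cabsD z w : cabs (z + w) <= cabs z + cabs w.
Proof. exact: le_normcD. Qed.

Lemma cabs_expi (t : R) : cabs (expi t) = 1.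
Proof. by rewrite /expi /= cos2Dsin2 sqrtr1. Qed.

Lemma expiD (s t : R) : expi (s + t) = expi s * expi t.
Proof. by rewrite /expi cosD sinD; congr (Complex _ _); rewrite addrC. Qed.

Lemma ReM z w : complex.Re (z * w) =
  complex.Re z * complex.Re w - complex.Im z * complex.Im w.
Proof. by case: z w => [? ?] [? ?]. Qed.

Lemma ImM z w : complex.Im (z * w) =
  complex.Re z * complex.Im w + complex.Im z * complex.Re w.
Proof. by case: z w => [? ?] [? ?]. Qed.

Lemma ReD z w : complex.Re (z + w) = complex.Re z + complex.Re w.
Proof. by case: z w => [? ?] [? ?]. Qed.

Lemma ImD z w : complex.Im (z + w) = complex.Im z + complex.Im w.
Proof. by case: z w => [? ?] [? ?]. Qed.

Lemma complexE_ReIm z w :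
  complex.Re z = complex.Re w -> complex.Im z = complex.Im w -> z = w.
Proof. by case: z w => [? ?] [? ?] /= -> ->. Qed.

End ComplexModulus.

(** * Integration of complex-valued functions *)

Section ComplexIntegral.
Context d (T : measurableType d) (R : realType).
Variable mu : {measure set T -> \bar R}.
Local Notation C := R[i].
Implicit Types f : T -> C.

Definition cmeas f := measurable_fun setT (fun x => complex.Re (f x)) /\
  measurable_fun setT (fun x => complex.Im (f x)).

Definition cint f : C := ((\int[mu]_x complex.Re (f x)) +i*
   (\int[mu]_x complex.Im (f x)))%C.

Definition cintble f := mu.-integrable setT (fun x => (complex.Re (f x))%:E) /\
  mu.-integrable setT (fun x => (complex.Im (f x))%:E).

Lemma cmeas_cst (c : C) : cmeas (fun=> c).
Proof. by split; exact: measurable_cst. Qed.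

Lemma cmeasM f g : cmeas f -> cmeas g -> cmeas (fun x => f x * g x).
Proof.
move=> [f1 f2] [g1 g2]; split.
  under eq_fun do rewrite ReM.
  by apply: measurable_funB; apply: measurable_funM.
under eq_fun do rewrite ImM.
by apply: measurable_funD; apply: measurable_funM.
Qed.

Lemma cmeasD f g : cmeas f -> cmeas g -> cmeas (fun x => f x + g x).
Proof.
move=> [f1 f2] [g1 g2]; split.
  by under eq_fun do rewrite ReD; apply: measurable_funD.
by under eq_fun do rewrite ImD; apply: measurable_funD.
Qed.

Lemma cmeas_sum (I : Type) (r : seq I) (F : I -> T -> C) :
  (forall i, cmeas (F i)) -> cmeas (fun x => \sum_(i <- r) F i x).
Proof.
move=> mF; elim: r => [|i r ih].
  by under eq_fun do rewrite big_nil; exact: cmeas_cst.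
by under eq_fun do rewrite big_cons; exact: cmeasD.
Qed.

Lemma cmeas_real (r : T -> R) : measurable_fun setT r ->
  cmeas (fun x => (r x)%:C%C).
Proof. by move=> mr; split => //=; exact: measurable_cst. Qed.

Lemma cmeas_expi (r : T -> R) : measurable_fun setT r ->
  cmeas (fun x => expi (r x)).
Proof.
move=> mr; split => /=.
  by apply: (measurableT_comp (f:=cos)) => //; apply: continuous_measurable_fun;
    exact: continuous_cos.
by apply: (measurableT_comp (f:=sin)) => //; apply: continuous_measurable_fun;
    exact: continuous_sin.
Qed.

Lemma eq_cint f g : f =1 g -> cint f = cint g.
Proof. by move=> /funext ->. Qed.

Lemma integrable_dominated (f : T -> R) (g : T -> \bar R) :
  measurable_fun setT f -> measurable_fun setT g ->
  (forall x, (`|f x|%:E <= g x)%E) -> (\int[mu]_x g x < +oo)%E ->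
  mu.-integrable setT (fun x => (f x)%:E).
Proof.
move=> mf mg fg g_fin; apply/integrableP; split; first exact/measurable_EFinP.
apply: le_lt_trans g_fin; apply: ge0_le_integral => //.
  by apply: measurableT_comp => //; exact/measurable_EFinP.
by move=> x _; exact: fg.
Qed.

Lemma cintble_dominated f (g : T -> \bar R) :
  cmeas f -> measurable_fun setT g ->
  (forall x, ((cabs (f x))%:E <= g x)%E) -> (\int[mu]_x g x < +oo)%E ->
  cintble f.
Proof.
move=> [f1 f2] mg fg g_fin; split; apply: (integrable_dominated _ mg) => // x.
- by apply: le_trans (fg x); rewrite lee_fin normr_Re_le.
- by apply: le_trans (fg x); rewrite lee_fin normr_Im_le.
Qed.

(** The factor 2, which comes from bounding the real and imaginary parts
    separately, is harmless: only finiteness and the linear dependence on the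
    majorant matter. *)
Lemma cabs_cint_le f (g : T -> \bar R) :
  cmeas f -> measurable_fun setT g ->
  (forall x, ((cabs (f x))%:E <= g x)%E) -> (\int[mu]_x g x < +oo)%E ->
  cabs (cint f) <= 2 * fine (\int[mu]_x g x).
Proof.
move=> mf mg fg g_fin; have [i1 i2] := cintble_dominated mf mg fg g_fin.
have g0 x : (0 <= g x)%E by apply: le_trans (fg x); rewrite lee_fin cabs_ge0.
have g_num : (\int[mu]_x g x)%E \is a fin_num.
  by rewrite ge0_fin_numE// integral_ge0.
have bnd (h : T -> R) : mu.-integrable setT (fun x => (h x)%:E) ->
    (forall x, `|h x| <= cabs (f x)) ->
    `|\int[mu]_x h x| <= fine (\int[mu]_x g x).
  move=> ih hf; rewrite -lee_fin EFin_normr_Rintegral// fineK//.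
  apply: le_trans (le_abse_integral _ _ _) _ => //;
    first exact: measurable_int ih.
  apply: ge0_le_integral => //.
    by apply: measurableT_comp => //; exact: measurable_int ih.
  by move=> x _; apply: le_trans (fg x); rewrite lee_fin.
rewrite mulr2n mulrDl mul1r; apply: le_trans (cabs_le_ReIm _) _.
by apply: lerD; apply: bnd => // x; [exact: normr_Re_le|exact: normr_Im_le].
Qed.

Lemma cintbleD f g : cintble f -> cintble g -> cintble (fun x => f x + g x).
Proof.
move=> [f1 f2] [g1 g2]; split.
  by under eq_fun do rewrite ReD EFinD; exact: integrableD.
by under eq_fun do rewrite ImD EFinD; exact: integrableD.
Qed.

Lemma cintbleZ (c : C) f : cintble f -> cintble (fun x => c * f x).
Proof.
move=> [f1 f2]; split.
  under eq_fun do rewrite ReM EFinB !EFinM.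
  by apply: integrableB => //; exact: integrableZl.
under eq_fun do rewrite ImM EFinD !EFinM.
by apply: integrableD => //; exact: integrableZl.
Qed.

Lemma cintD f g : cintble f -> cintble g ->
  cint (fun x => f x + g x) = cint f + cint g.
Proof.
move=> [f1 f2] [g1 g2]; apply: complexE_ReIm; rewrite ?ReD ?ImD /cint /=.
  by under eq_Rintegral do rewrite ReD; rewrite RintegralD.
by under eq_Rintegral do rewrite ImD; rewrite RintegralD.
Qed.

Lemma integrable_EFinZl (k : R) (h : T -> R) :
  mu.-integrable setT (fun x => (h x)%:E) ->
  mu.-integrable setT (fun x => (k * h x)%:E).
Proof. by move=> ih; under eq_fun do rewrite EFinM; exact: integrableZl. Qed.

Lemma cintZ (c : C) f : cintble f -> cint (fun x => c * f x) = c * cint f.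
Proof.
move=> [f1 f2]; apply: complexE_ReIm; rewrite ?ReM ?ImM /cint /=.
  under eq_Rintegral do rewrite ReM.
  by rewrite RintegralB// ?RintegralZl//; exact: integrable_EFinZl.
under eq_Rintegral do rewrite ImM.
by rewrite RintegralD// ?RintegralZl//; exact: integrable_EFinZl.
Qed.

Lemma cintble0 : cintble (fun=> 0).
Proof. by split; exact: integrable0. Qed.

Lemma cintble_sum (I : Type) (r : seq I) (F : I -> T -> C) :
  (forall i, cintble (F i)) -> cintble (fun x => \sum_(i <- r) F i x).
Proof.
move=> iF; elim: r => [|i r ih].
  by under eq_fun do rewrite big_nil; exact: cintble0.
by under eq_fun do rewrite big_cons; exact: cintbleD.
Qed.

Lemma cint0 : cint (fun=> 0) = 0.
Proof. by rewrite /cint /= Rintegral_cst// mul0r. Qed.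

Lemma cint_sum (I : Type) (r : seq I) (F : I -> T -> C) :
  (forall i, cintble (F i)) ->
  cint (fun x => \sum_(i <- r) F i x) = \sum_(i <- r) cint (F i).
Proof.
move=> iF; elim: r => [|i r ih].
  by under eq_cint do rewrite big_nil; rewrite big_nil cint0.
under eq_cint do rewrite big_cons.
by rewrite big_cons -ih cintD//; exact: cintble_sum.
Qed.

Lemma cint_real (r : T -> R) :
  cint (fun x => (r x)%:C%C) = (\int[mu]_x r x)%:C%C.
Proof. by rewrite /cint /= Rintegral_cst// mul0r. Qed.

Lemma cintble_real (r : T -> R) : mu.-integrable setT (fun x => (r x)%:E) ->
  cintble (fun x => (r x)%:C%C).
Proof. by move=> ir; split => //=; exact: integrable0. Qed.

Lemma Rintegral_sum (I : Type) (r : seq I) (F : I -> T -> R) :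
  (forall i, mu.-integrable setT (fun x => (F i x)%:E)) ->
  \int[mu]_x (\sum_(i <- r) F i x) = \sum_(i <- r) \int[mu]_x F i x.
Proof.
move=> iF; suff [] : mu.-integrable setT (fun x => (\sum_(i <- r) F i x)%:E) /\
  \int[mu]_x (\sum_(i <- r) F i x) = \sum_(i <- r) \int[mu]_x F i x by [].
elim: r => [|i r [ii ih]].
  split; first by under eq_fun do rewrite big_nil; exact: integrable0.
  under eq_Rintegral do rewrite big_nil.
  by rewrite Rintegral_cst// mul0r big_nil.
split.
  by under eq_fun do rewrite big_cons EFinD; exact: integrableD.
under eq_Rintegral do rewrite big_cons.
by rewrite big_cons -ih RintegralD//; exact: iF.
Qed.

End ComplexIntegral.

Section ParametricIntegral.
Context d1 d2 (X : measurableType d1) (Y : measurableType d2) (R : realType).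
Variables (m1 : {sigma_finite_measure set X -> \bar R})
          (m2 : {sigma_finite_measure set Y -> \bar R}).

(** The positive and negative parts of f have measurable parametric integrals
    by Tonelli's theorem, hence so does their difference. *)
Lemma measurable_parametric_Rintegral (f : X * Y -> R) :
  measurable_fun setT f ->
  measurable_fun setT (fun x => \int[m2]_y f (x, y)).
Proof.
move=> mf; rewrite /Rintegral; apply: measurableT_comp => //.
have mEf : measurable_fun setT (EFin \o f) by exact/measurable_EFinP.
rewrite [X in measurable_fun _ X](_ : _ = fun x =>
    (\int[m2]_y ((EFin \o f)^\+ (x, y)) - \int[m2]_y ((EFin \o f)^\- (x, y)))%E).
  apply: emeasurable_funB.
    apply: (measurable_fun_fubini_tonelli_F (EFin \o f)^\+%E) => //.
    exact: measurable_funepos.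
  apply: (measurable_fun_fubini_tonelli_F (EFin \o f)^\-%E) => //.
  exact: measurable_funeneg.
apply/funext => x; rewrite [LHS]integralE.
by congr (_ - _)%E; apply: eq_integral => y _;
  rewrite ?funeposE ?funenegE.
Qed.

Lemma cmeas_parametric (f : X * Y -> R[i]) : cmeas f ->
  cmeas (fun x => cint m2 (fun y => f (x, y))).
Proof.
move=> [f1 f2]; split; first exact: (measurable_parametric_Rintegral f1).
exact: (measurable_parametric_Rintegral f2).
Qed.

(** An integrable function is finite almost everywhere, so truncating its
    infinite values by [fine] does not affect the integral. *)
Lemma integral_fine d (T : measurableType d) (mu : {measure set T -> \bar R})
    (F : T -> \bar R) : mu.-integrable setT F ->
  (\int[mu]_x (fine (F x))%:E = \int[mu]_x F x)%E.
Proof.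
move=> iF; apply: ae_eq_integral => //.
- by apply/measurable_EFinP/measurableT_comp => //; exact: measurable_int iF.
- exact: measurable_int iF.
- have := integrable_ae measurableT iF.
  by apply: filterS => x /= /(_ I) Fx _; rewrite fineK.
Qed.

Lemma Rintegral_Fubini (f : X * Y -> R) :
  (m1 \x m2)%E.-integrable setT (EFin \o f) ->
  \int[m1]_x (\int[m2]_y f (x, y)) = \int[m2]_y (\int[m1]_x f (x, y)).
Proof.
move=> imf; rewrite /Rintegral; congr fine.
have := integrable_fubini_F imf; have iG := integral21_prod_meas1 imf.
move=> iF; rewrite (integral_fine iF).
have iG' : m2.-integrable setT (fun y => \int[m1]_x (f (x, y))%:E)%E.
  have mf := measurable_int _ imf.
  apply/integrableP; split; first exact: (measurable_fubini_G imf).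
  have /(integrable21ltyP m1 m2 mf) := imf.
  apply: le_lt_trans; apply: ge0_le_integral => //.
  - by apply: measurableT_comp => //; exact: (measurable_fubini_G imf).
  - apply: (measurable_fun_fubini_tonelli_G (abse \o (EFin \o f))) => [|y /=].
      exact: measurableT_comp.
    by rewrite lee_fin.
  - move=> y _; apply: le_abse_integral => //.
    exact: measurableT_comp mf _.
by rewrite (integral_fine iG'); exact: (Fubini imf).
Qed.

Lemma cint_Fubini (f : X * Y -> R[i]) (g : X * Y -> \bar R) :
  cmeas f -> measurable_fun setT g ->
  (forall z, ((cabs (f z))%:E <= g z)%E) ->
  (\int[m1]_x \int[m2]_y g (x, y) < +oo)%E ->
  cint m1 (fun x => cint m2 (fun y => f (x, y))) =
  cint m2 (fun y => cint m1 (fun x => f (x, y))).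
Proof.
move=> mf mg fg g_fin.
have g0 z : (0 <= g z)%E by apply: le_trans (fg z); rewrite lee_fin cabs_ge0.
have [] // : cintble (m1 \x m2)%E f.
  by apply: (cintble_dominated mf mg fg); rewrite fubini_tonelli1.
move=> f1 f2; apply: complexE_ReIm => /=; first exact: (Rintegral_Fubini f1).
exact: (Rintegral_Fubini f2).
Qed.

End ParametricIntegral.

(** * Lebesgue measure on R^N: Tonelli, translations, products *)

Section TupleMeasure.
Variable R : realType.
Local Notation Rm := (measurableTypeR R).
Local Notation leb := (@lebesgue_measure R).

Lemma integral_tuple_cons N (g : N.+1.-tuple Rm -> \bar R) :
  measurable_fun setT g -> (forall t, (0 <= g t)%E) ->
  (\int[lebesgue_tuple R N.+1]_t g t =
   \int[leb]_z \int[lebesgue_tuple R N]_t g (cons_pair (z, t)))%E.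
Proof.
move=> mg g0; rewrite /= /lebesgue_cons.
rewrite ge0_integral_pushforward//=; last exact: measurable_cons_pair.
rewrite preimage_setT fubini_tonelli1//.
by apply: measurableT_comp => //; exact: measurable_cons_pair.
Qed.

Definition shiftr (a : R) : Rm -> Rm := fun x => x + a.

Lemma measurable_shiftr a : measurable_fun setT (shiftr a).
Proof. by apply: measurable_funD => //; exact: measurable_cst. Qed.

HB.instance Definition _ a :=
  isMeasurableFun.Build _ _ _ _ (shiftr a) (measurable_shiftr a).

Lemma lebesgue_measure_shift (a : R) (A : set Rm) : measurable A ->
  pushforward leb (shiftr a) A = leb A.
Proof.
move=> mA; apply/esym; apply: lebesgue_measure_unique => //= _ [[x y]] _ <-.
rewrite /pushforward /= (_ : _ @^-1` _ = `]x - a, y - a]%classic); last first.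
  by apply/seteqP; split => z /=; rewrite !in_itv/= /shiftr ltrBlDr lerBrDr.
by rewrite !lebesgue_measure_itv/= !lte_fin ltrD2r -EFinD; case: ifP => // _;
  rewrite -!EFinB opprB addrA subrK.
Qed.

Lemma ge0_integral_shift (a : R) (f : Rm -> \bar R) : measurable_fun setT f ->
  (forall x, (0 <= f x)%E) ->
  (\int[leb]_x f (x + a)%R = \int[leb]_x f x)%E.
Proof.
move=> mf f0.
transitivity (\int[pushforward leb (shiftr a)]_x f x)%E.
  by rewrite ge0_integral_pushforward//= preimage_setT.
by apply: eq_measure_integral => A mA _; exact: lebesgue_measure_shift.
Qed.

Definition tuple_shift N (v : 'I_N -> R) (t : N.-tuple Rm) : N.-tuple Rm :=
  [tuple tnth t i + v i | i < N].

Lemma measurable_tuple_shift N (v : 'I_N -> R) :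
  measurable_fun setT (tuple_shift v).
Proof.
apply/measurable_fun_tnthP => i.
rewrite (_ : _ \o _ = fun t => tnth t i + v i); last first.
  by apply/funext => t /=; rewrite tnth_mktuple.
by apply: measurable_funD => //; exact: measurable_tnth.
Qed.

Lemma tuple_shift_cons N (v : 'I_N.+1 -> R) z (t : N.-tuple Rm) :
  tuple_shift v (cons_pair (z, t)) =
  cons_pair (z + v ord0, tuple_shift (fun i => v (lift ord0 i)) t).
Proof.
apply: eq_from_tnth => i; rewrite tnth_mktuple.
have [->|[j ->]] : i = ord0 \/ exists j, i = lift ord0 j.
  by case: (unliftP ord0 i) => [j ->|->]; [right; exists j|left].
- by rewrite /cons_pair /= !(tnth_nth 0).
- by rewrite /cons_pair /= !tnthS tnth_mktuple.
Qed.

(** Tonelli's theorem reduces the translation to one coordinate at a time. *)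
Lemma ge0_integral_tuple_shift N (v : 'I_N -> R) (g : N.-tuple Rm -> \bar R) :
  measurable_fun setT g -> (forall t, (0 <= g t)%E) ->
  (\int[lebesgue_tuple R N]_t g (tuple_shift v t) =
   \int[lebesgue_tuple R N]_t g t)%E.
Proof.
elim: N => [|N ih] in v g *.
  by move=> mg g0; apply: eq_integral => t _;
    rewrite [t]tuple0 [tuple_shift _ _]tuple0.
move=> mg g0; rewrite !integral_tuple_cons//; last first.
  by apply: measurableT_comp => //; exact: measurable_tuple_shift.
have mG : measurable_fun setT (g \o @cons_pair R N).
  by apply: measurableT_comp => //; exact: measurable_cons_pair.
under eq_integral.
  move=> z _.
  under eq_integral do rewrite tuple_shift_cons.
  rewrite (ih _ (fun t => g (cons_pair (z + v ord0, t)))) //; last first.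
    by apply: (measurableT_comp mG) => //; exact: pair1_measurable.
  over.
rewrite (ge0_integral_shift _ (f := fun z =>
  (\int[lebesgue_tuple R N]_t g (cons_pair (z, t)))%E)) //.
- apply: (measurable_fun_fubini_tonelli_F (g \o @cons_pair R N)) => // z /=.
  exact: g0.
- by move=> x; exact: integral_ge0.
Qed.

Lemma Rintegral_tuple_shift N (v : 'I_N -> R) (g : N.-tuple Rm -> R) :
  measurable_fun setT g ->
  \int[lebesgue_tuple R N]_t g (tuple_shift v t) = \int[lebesgue_tuple R N]_t g t.
Proof.
move=> mg; rewrite /Rintegral; congr fine.
have mEg : measurable_fun setT (EFin \o g) by exact/measurable_EFinP.
rewrite [LHS]integralE [RHS]integralE; congr (_ - _)%E.
- rewrite -(ge0_integral_tuple_shift v (g := (EFin \o g)^\+%E)).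
  + by apply: eq_integral => t _; rewrite !funeposE.
  + exact: measurable_funepos.
  + by move=> t; exact: funepos_ge0.
- rewrite -(ge0_integral_tuple_shift v (g := (EFin \o g)^\-%E)).
  + by apply: eq_integral => t _; rewrite !funenegE.
  + exact: measurable_funeneg.
  + by move=> t; exact: funeneg_ge0.
Qed.

(** Measurability is proved together with the value: the induction step for the
    integral uses that the product over the tail is measurable. *)
Lemma integral_tuple_prod N (u : Rm -> \bar R) (c : R) :
  measurable_fun setT u ->
  (forall x, (0 <= u x)%E) -> (\int[leb]_x u x = c%:E)%E ->
  measurable_fun setT
    (fun t : N.-tuple Rm => \big[mule/1%E]_(i < N) u (tnth t i)) /\
  (\int[lebesgue_tuple R N]_t (\big[mule/1%E]_(i < N) u (tnth t i)) =
   (c ^+ N)%:E)%E.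
Proof.
move=> mu u0 uc; elim: N => [|N [mI ih]].
  split; first by under eq_fun do rewrite big_ord0; exact: measurable_cst.
  under eq_integral do rewrite big_ord0.
  by rewrite integral_cst//= mul1e diracT.
have mN : measurable_fun setT
    (fun t : N.+1.-tuple Rm => \big[mule/1%E]_(i < N.+1) u (tnth t i)).
  under eq_fun do rewrite big_ord_recl.
  apply: emeasurable_funM.
    by apply: (measurableT_comp mu); exact: measurable_tnth.
  under eq_fun.
    move=> t; under eq_bigr.
      move=> i _; rewrite (_ : tnth t (lift ord0 i) = tnth [tuple of behead t] i); last first.
        by rewrite [in LHS](tuple_eta t) tnthS.
      over.
    over.
  by apply: (measurableT_comp mI); exact: measurable_behead.
split => //.
have pr0 k (t : k.-tuple Rm) : (0 <= \big[mule/1%E]_(i < k) u (tnth t i))%E.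
  by elim/big_ind : _ => // x y; exact: mule_ge0.
rewrite integral_tuple_cons//.
have inner z : (\int[lebesgue_tuple R N]_t
    (\big[mule/1%E]_(i < N.+1) u (tnth (cons_pair (z, t)) i)) =
    (c ^+ N)%:E * u z)%E.
  rewrite muleC -ih -ge0_integralZl//.
  apply: eq_integral => t _; rewrite big_ord_recl /cons_pair /=.
  by rewrite (tnth_nth 0) /=; under eq_bigr do rewrite tnthS.
under eq_integral do rewrite inner.
rewrite ge0_integralZl_EFin//; last first.
  by rewrite exprn_ge0// -lee_fin -uc integral_ge0.
by rewrite uc -EFinM exprSr.
Qed.

Section Discretization.
Variables (N : nat) (k : nat).
Implicit Type t : N.-tuple Rm.

Definition grid_index t : N.-tuple int :=
  [tuple Num.floor (tnth t i * k.+1%:R) | i < N].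

Definition grid_point (w : N.-tuple int) : 'rV[R]_N :=
  \row_i ((tnth w i)%:~R / k.+1%:R).

(** The discretized functions take countably many values, each on a union of
    boxes. *)
Lemma measurable_grid (F : N.-tuple int -> R) :
  measurable_fun setT (fun t => F (grid_index t)).
Proof.
move=> _ Y mY; rewrite setTI.
pose box (w : N.-tuple int) : set (N.-tuple Rm) :=
  \bigcap_(i in [set: 'I_N])
    ((fun t => tnth t i) @^-1`
     `[(tnth w i)%:~R / k.+1%:R, (tnth w i + 1)%:~R / k.+1%:R[).
have boxP w t : box w t <-> grid_index t = w.
  split=> [bt|<- i _].
    apply: eq_from_tnth => i; rewrite tnth_mktuple; apply: floor_def.
    have := bt i I; rewrite /= in_itv /=.
    by rewrite ler_pdivrMr// ltr_pdivlMr.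
  rewrite /= in_itv /= tnth_mktuple ler_pdivrMr// ltr_pdivlMr//.
  exact: floor_itv.
rewrite (_ : _ @^-1` _ = \bigcup_(w : N.-tuple int)
    (if F w \in Y then box w else set0)); last first.
  apply/seteqP; split => [t Yt|t [w _]].
    by exists (grid_index t) => //=; rewrite mem_set//; exact/boxP.
  by case: ifPn => // /set_mem Yw /boxP wt; rewrite /= wt.
apply: countable_bigcupT_measurable; first exact: countableP.
move=> w; case: ifP => // _.
apply: fin_bigcap_measurable; first exact: finite_finset.
move=> i _; rewrite -[X in measurable X]setTI.
by apply: (measurable_tnth i) => //; exact: measurable_itv.
Qed.

End Discretization.

(** A continuous function is the pointwise limit of its discretizations on grids
    of mesh 1 / (k + 1), which are measurable for the product sigma-algebra. *)
Lemma measurable_continuous_rV N (f : 'rV[R]_N -> R) : continuous f ->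
  measurable_fun setT (fun t => f (rV_of_tuple t)).
Proof.
move=> cf; apply: (@measurable_fun_cvg _ _ _ _
    (fun k t => f (grid_point k (grid_index k t)))) => [k|t _].
  exact: (@measurable_grid N k (fun w => f (grid_point k w))).
apply: (@cvg_comp _ _ _ (fun k => grid_point k (grid_index k t)) f _
  (nbhs (rV_of_tuple t))); last exact: cf.
apply/cvg_ballP => e e0; near=> k; split => // i j.
rewrite !mxE tnth_mktuple /ball /= /ball_ /=.
have k0 : 0 < k.+1%:R :> R by [].
have /andP[fl fu] := floor_itv (tnth t j * k.+1%:R).
have : k.+1%:R^-1 < e by near: k; exact: near_infty_natSinv_lt (PosNum e0).
set m := Num.floor _ in fl fu *; move=> ke.
rewrite ger0_norm; last by rewrite subr_ge0 ler_pdivrMr.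
apply: le_lt_trans ke; rewrite lerBlDr -(ler_pM2r k0) mulrDl mulVf ?gt_eqF//.
by rewrite divfK ?gt_eqF// addrC; move: fu; rewrite intrD; exact: ltW.
Unshelve. all: by end_near. Qed.

End TupleMeasure.

(** * The Gamma integral in exponential coordinates *)

Section GammaIntegral.
Variable R : realType.
Local Notation Rm := (measurableTypeR R).
Local Notation leb := (@lebesgue_measure R).

Lemma measurable_oppr : measurable_fun setT (-%R : Rm -> Rm).
Proof. exact: oppr_measurable. Qed.

HB.instance Definition _ :=
  isMeasurableFun.Build _ _ _ _ (-%R : Rm -> Rm) measurable_oppr.

Lemma ge0_integral_opp (f : Rm -> \bar R) : measurable_fun setT f ->
  (forall x, (0 <= f x)%E) ->
  (\int[leb]_x f (- x)%R = \int[leb]_x f x)%E.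
Proof.
move=> mf f0.
transitivity (\int[pushforward leb (-%R : Rm -> Rm)]_x f x)%E.
  by rewrite ge0_integral_pushforward//= preimage_setT.
by apply: eq_measure_integral => A mA _; exact: lebesgue_measureN.
Qed.

Lemma integral_oneDsqrV :
  (\int[leb]_(x in setT) ((1 + x ^+ 2)^-1)%:E < +oo)%E.
Proof.
rewrite ge0_symfun_integralT.
- rewrite (_ : [set x : R | (0 <= x)%R] = `[0, +oo[%classic).
    by rewrite integral0y_oneDsqr -EFinM ltry.
  by apply/seteqP; split => x /=; rewrite in_itv/= andbT.
- by move=> x; rewrite invr_ge0 addr_ge0// sqr_ge0.
- exact: continuous_oneDsqrV.
- by move=> x /=; rewrite sqrrN.
Qed.

(** The integrand t^a exp (- k t) dt / t of the Gamma integral after the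
    substitution t = exp v. It is continuous on the whole line, and scaling k
    becomes a translation of v. *)
Definition gexp (a k v : R) : R := expR (a * v - k * expR v).

Lemma measurable_gexp (a k : R) : measurable_fun setT (gexp a k).
Proof.
apply: measurableT_comp => //; apply: measurable_funB => //.
by apply: measurable_funM => //; exact: measurable_expR.
Qed.

(** For v <= 0 the factor exp (a v) beats 1 + v^2; for v >= 0,
    exp v >= 1 + v^2 / 2 and completing the square absorbs (a + 1) v. *)
Lemma gexp_le (a : R) : 0 < a -> exists M : R, forall v,
  gexp a 1 v <= M * (1 + v ^+ 2)^-1.
Proof.
move=> a0; exists (1 + 2 / a ^+ 2 + 2 * expR ((a + 1) ^+ 2 / 2)) => v.
have q0 : 0 < 1 + v ^+ 2 by rewrite ltr_pwDl// sqr_ge0.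
rewrite ler_pdivlMr// /gexp mul1r.
have a2 : 0 < a ^+ 2 by rewrite exprn_gt0.
have [v0|v0] := leP v 0.
  apply: (@le_trans _ _ (1 + 2 / a ^+ 2)); last first.
    by rewrite lerDl mulr_ge0// expR_ge0.
  have h := @expR_ge1Dxn _ (- (a * v)) 1.
  have {}h : 1 + (a * v) ^+ 2 / 2 <= expR (- (a * v)).
    by rewrite -(sqrrN (a * v)); apply: h; rewrite oppr_ge0 mulr_ge0_le0// ltW.
  apply: (@le_trans _ _ (expR (a * v) * (1 + v ^+ 2))).
    rewrite ler_pM2r// ler_expR lerBlDr lerDl; exact: expR_ge0.
  have e0 := expR_gt0 (- (a * v)).
  rewrite -(ler_pM2l e0) mulrA -expRD addNr expR0 mul1r mulrC.
  apply: (@le_trans _ _ ((1 + 2 / a ^+ 2) * (1 + (a * v) ^+ 2 / 2)));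
    last first.
    by rewrite ler_pM2l// ltr_pwDl// divr_ge0// ltW.
  rewrite mulrDl mul1r exprMn.
  have -> : 2 / a ^+ 2 * (1 + a ^+ 2 * v ^+ 2 / 2) = 2 / a ^+ 2 + v ^+ 2.
    by field; rewrite gt_eqF.
  have : 0 <= a ^+ 2 * v ^+ 2 by rewrite mulr_ge0 ?sqr_ge0.
  have : 0 <= 2 / a ^+ 2 by rewrite divr_ge0// ltW.
  by move=> *; lra.
have hv : 1 + v ^+ 2 / 2 <= expR v := expR_ge1Dxn 1 (ltW v0).
apply: (@le_trans _ _ (2 * expR ((a + 1) ^+ 2 / 2))); last first.
  by rewrite lerDr addr_ge0// divr_ge0// ltW.
apply: (@le_trans _ _ (expR ((a + 1) ^+ 2 / 2 - v) * (1 + v ^+ 2))).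
  rewrite ler_pM2r// ler_expR.
  have := sqr_ge0 (a + 1 - v); move: hv; rewrite !expr2 => *; lra.
rewrite expRB mulrAC ler_pdivrMr ?expR_gt0//;
  move: (expR_gt0 ((a + 1) ^+ 2 / 2)); set K := expR _ => K0.
rewrite [2 * K]mulrC -mulrA ler_pM2l//.
by lra.
Qed.

Lemma integral_gexp_lty (a : R) : 0 < a ->
  (\int[leb]_v (gexp a 1 v)%:E < +oo)%E.
Proof.
move=> a0; have [M hM] := gexp_le a0.
have M0 : 0 <= M.
  by have := hM 0; rewrite expr0n addr0 invr1 mulr1; apply: le_trans;
    exact: expR_ge0.
apply: (@le_lt_trans _ _ (\int[leb]_v (M * (1 + v ^+ 2)^-1)%:E)%E).
  apply: ge0_le_integral => //.
  - by move=> v _; rewrite lee_fin expR_ge0.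
  - by apply/measurable_EFinP; exact: measurable_gexp.
  - apply/measurable_EFinP/measurable_funM => //.
    by apply: continuous_measurable_fun; exact: continuous_oneDsqrV.
  - by move=> v _; rewrite lee_fin.
under eq_integral do rewrite EFinM.
rewrite ge0_integralZl_EFin//.
- by apply: lte_mul_pinfty => //; exact: integral_oneDsqrV.
- by move=> v _; rewrite lee_fin invr_ge0 addr_ge0// sqr_ge0.
- apply/measurable_EFinP.
  by apply: continuous_measurable_fun; exact: continuous_oneDsqrV.
Qed.

Lemma integral_gexp_scale (a k : R) : 0 < k ->
  (\int[leb]_v (gexp a k v)%:E =
   (k `^ (- a))%:E * \int[leb]_v (gexp a 1 v)%:E)%E.
Proof.
move=> k0.
have mG b c : measurable_fun setT (fun v => (gexp b c v)%:E).
  by apply/measurable_EFinP; exact: measurable_gexp.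
rewrite -(ge0_integral_shift (- ln k) (f := fun v => (gexp a k v)%:E));
  last 2 first.
- exact: mG.
- by move=> v; rewrite lee_fin expR_ge0.
rewrite -ge0_integralZl_EFin; first last.
- exact: powR_ge0.
- exact: mG.
- by move=> v _; rewrite lee_fin expR_ge0.
- by [].
apply: eq_integral => v _; rewrite -EFinM /powR gt_eqF// /gexp -expRD.
congr (expR _)%:E.
by rewrite expRD expRN lnK ?posrE//; field; rewrite gt_eqF.
Qed.

Lemma bigcup_expR_itv :
  \bigcup_k `[expR (- k%:R), expR k%:R]%classic = `]0, +oo[%classic :> set R.
Proof.
apply/seteqP; split => [t [k _] /=|t /=]; rewrite !in_itv/= ?andbT.
  by move=> /andP[+ _]; apply: lt_le_trans; exact: expR_gt0.
move=> t0; have := archi_boundP (normr_ge0 (ln t)).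
move=> /ltW; rewrite ler_norml => /andP[h1 h2].
exists (Num.bound `|ln t|) => //=; rewrite in_itv/=.
move: (Num.bound _) h1 h2 => k h1 h2.
by rewrite -[t]lnK ?posrE// !ler_expR h1 h2.
Qed.

Lemma bigcup_opp_itv :
  \bigcup_k `[(- k%:R), k%:R]%classic = setT :> set R.
Proof.
apply/seteqP; split => // t _.
have := archi_boundP (normr_ge0 t) => /ltW; rewrite ler_norml => h.
by exists (Num.bound `|t|) => //=; rewrite in_itv/=.
Qed.

(** The substitution t = exp v on the compact intervals [-k, k], and monotone
    convergence. *)
Lemma integral_Gamma_gexp (a : R) :
  (\int[leb]_(t in `]0%R, +oo[) (t `^ (a - 1) * expR (- t))%:E =
   \int[leb]_v (gexp a 1 v)%:E)%E.
Proof.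
pose g t := expR ((a - 1) * ln t - t).
transitivity (\int[leb]_(t in `]0%R, +oo[) (g t)%:E)%E.
  apply: eq_integral => t; rewrite inE/= in_itv/= andbT => t0.
  by rewrite /g expRD /powR gt_eqF.
have g0 t : 0 <= g t by exact: expR_ge0.
have mg : measurable_fun setT g.
  apply: measurableT_comp => //; apply: measurable_funB => //.
  by apply: measurable_funM => //; exact: measurable_ln.
have D1 : (@expR R)^`()%classic = expR by apply/funext => t;
  rewrite derive1E derive_val.
have sub k : (\int[leb]_(t in `[expR (- k%:R), expR k%:R]) (g t)%:E =
    \int[leb]_(v in `[(- k%:R)%R, k%:R]) (gexp a 1 v)%:E)%E.
  rewrite integration_by_substitution_increasing.
  - apply: eq_integral => v _; congr EFin.
    rewrite D1 !fctE /= /g expRK /gexp -expRD; congr expR; ring.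
  - by rewrite lerNl (le_trans _ (ler0n _ _))// oppr_le0.
  - by move=> x y _ _; rewrite ltr_expR.
  - by move=> x _; rewrite D1; exact: continuous_expR.
  - rewrite D1; apply/cvg_ex; exists (expR (- k%:R)).
    by apply: cvg_at_right_filter; exact: continuous_expR.
  - rewrite D1; apply/cvg_ex; exists (expR k%:R).
    by apply: cvg_at_left_filter; exact: continuous_expR.
  - split.
    + by move=> x _; exact: derivable_expR.
    + by apply: cvg_at_right_filter; exact: continuous_expR.
    + by apply: cvg_at_left_filter; exact: continuous_expR.
  - apply: continuous_in_subspaceT => t; rewrite inE/= in_itv/= => /andP[t0 _].
    have {}t0 : 0 < t by apply: lt_le_trans t0; exact: expR_gt0.
    apply: (@continuous_comp _ _ _ (fun t => (a - 1) * ln t - t) expR);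
      last exact: continuous_expR.
    apply: cvgB => //; apply: cvgM; first exact: cvg_cst.
    exact: continuous_ln.
have mG b (A : set Rm) : measurable_fun A (fun v => (gexp b 1 v)%:E).
  by apply/measurable_funTS/measurable_EFinP; exact: measurable_gexp.
have mgE (A : set Rm) : measurable_fun A (fun v => (g v)%:E).
  exact/measurable_funTS/measurable_EFinP.
have le_itv (i j : nat) : (i <= j)%N -> (i%:R : R) <= j%:R by rewrite ler_nat.
have cv1 : (\int[leb]_(t in `[expR (- k%:R), expR k%:R]) (g t)%:E @[k --> \oo] -->
    \int[leb]_(t in `]0%R, +oo[) (g t)%:E)%E.
  rewrite -bigcup_expR_itv; apply: ge0_nondecreasing_set_cvg_integral => //.
  - move=> i j ij; apply/subsetPset => t /=; rewrite !in_itv/= => /andP[h1 h2].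
    apply/andP; split; [apply: le_trans h1|apply: (le_trans h2)];
      by rewrite ler_expR ?lerN2 ler_nat.
  - by move=> i x _; rewrite lee_fin.
have cv2 : (\int[leb]_(t in `[expR (- k%:R), expR k%:R]) (g t)%:E @[k --> \oo] -->
    \int[leb]_v (gexp a 1 v)%:E)%E.
  under eq_cvg do rewrite sub.
  rewrite -bigcup_opp_itv; apply: ge0_nondecreasing_set_cvg_integral => //.
  - move=> i j ij; apply/subsetPset => t /=; rewrite !in_itv/= => /andP[h1 h2].
    apply/andP; split; [apply: le_trans h1|apply: (le_trans h2)];
      by rewrite ?lerN2 ler_nat.
  - by move=> i x _; rewrite lee_fin expR_ge0.
exact: (cvg_unique _ cv1 cv2).
Qed.

Lemma Gamma_integral (a : R) : 0 < a ->
  (\int[leb]_v (gexp a 1 v)%:E = (Gamma a)%:E)%E.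
Proof.
move=> a0; rewrite /Gamma /Rintegral integral_Gamma_gexp fineK//.
rewrite ge0_fin_numE; first exact: integral_gexp_lty.
by apply: integral_ge0 => v _; rewrite lee_fin expR_ge0.
Qed.

(** ** A one-dimensional integrable majorant, infinite at the singularity *)

(** By convention a negative power of 0 is 0, which would spoil bounds on the
    coordinate hyperplanes of R^N. With the value +oo instead, products of
    [sing1] over the coordinates are majorants at every point, and no null set
    has to be removed. *)
Definition sing1 (b t : R) : \bar R := if t == 0 then +oo%E else
  (expR 1 * (`|t| `^ (- b) * expR (- `|t|)) + 2 * (1 + t ^+ 2)^-1)%:E.

Lemma sing1_ge0 b t : (0 <= sing1 b t)%E.
Proof.
rewrite /sing1; case: ifP => // _;
  rewrite lee_fin addr_ge0 ?mulr_ge0 ?expR_ge0 ?powR_ge0//.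
by rewrite invr_ge0 addr_ge0// sqr_ge0.
Qed.

(** For |t| <= 1 the constant e makes up for exp (- |t|); for |t| > 1 the power
    is at most 1. *)
Lemma le_sing1 b t : 0 <= b ->
  (((1 + `|t| `^ (- b)) * (1 + t ^+ 2)^-1)%:E <= sing1 b t)%E.
Proof.
move=> b0; rewrite /sing1; case: eqP => [_|/eqP t0]; first exact: leey.
rewrite lee_fin mulrDl mul1r.
have nt : 0 < `|t| by rewrite normr_gt0.
set q := (1 + t ^+ 2)^-1; set p := `|t| `^ (- b).
have q0 : 0 <= q by rewrite invr_ge0 addr_ge0// sqr_ge0.
have q1 : q <= 1 by rewrite invf_le1 ?lerDl ?sqr_ge0// ltr_pwDl// sqr_ge0.
have p0 : 0 <= p := powR_ge0 _ _.
have e0 := expR_ge0 (- `|t|).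
have [t1|t1] := leP `|t| 1.
  have : p <= expR 1 * (p * expR (- `|t|)).
    rewrite mulrCA ler_peMr// -expRD -[leLHS]expR0 ler_expR subr_ge0//.
  have : p * q <= p by rewrite ler_piMr.
  by move=> *; lra.
have p1 : p <= 1.
  by rewrite /p /powR gt_eqF// -[leRHS]expR0 ler_expR mulNr oppr_le0 mulr_ge0// ln_ge0// ltW.
have : p * q <= q by rewrite ler_piMl.
have : 0 <= expR 1 * (p * expR (- `|t|)) by rewrite !mulr_ge0 ?expR_ge0.
by move=> *; lra.
Qed.

Lemma measurable_sing1 b : measurable_fun setT (sing1 b).
Proof.
apply: measurable_fun_ifT; first exact: measurable_fun_eqr.
  exact: measurable_cst.
apply/measurable_EFinP; apply: measurable_funD; apply: measurable_funM => //.
  apply: measurable_funM.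
    by apply: (measurableT_comp (measurable_powR _)); exact: normr_measurable.
  apply: (measurableT_comp (@measurable_expR R)).
  by apply: measurable_funN; exact: normr_measurable.
by apply: continuous_measurable_fun; exact: continuous_oneDsqrV.
Qed.

Lemma sing1N b t : sing1 b (- t) = sing1 b t.
Proof. by rewrite /sing1 oppr_eq0 normrN sqrrN. Qed.

(** By symmetry the integral over the half-line suffices, where the singular
    term is a Gamma integral with exponent 1 - b > 0. *)
Lemma integral_sing1_lty b : b < 1 -> (\int[leb]_t sing1 b t < +oo)%E.
Proof.
move=> b1.
have half : (\int[leb]_(t in `[0%R, +oo[) sing1 b t < +oo)%E.
  rewrite -integral_itv_obnd_cbnd; last first.
    by apply: measurable_funTS; exact: measurable_sing1.
  under eq_integral => t.
    rewrite inE/= in_itv/= andbT => t0.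
    rewrite /sing1 gt_eqF// gtr0_norm// EFinD (EFinM (expR 1)) (EFinM 2).
    over.
  have mP : measurable_fun (`]0%R, +oo[%classic : set Rm)
      (fun t : R => (t `^ (- b) * expR (- t))%:E).
    apply/measurable_EFinP/measurable_funTS/measurable_funM.
      exact: measurable_powR.
    apply: (measurableT_comp (@measurable_expR R)).
    exact: measurable_oppr.
  have mQ : measurable_fun (`]0%R, +oo[%classic : set Rm)
      (fun t : R => ((1 + t ^+ 2)^-1)%:E).
    apply/measurable_EFinP/measurable_funTS.
    by apply: continuous_measurable_fun; exact: continuous_oneDsqrV.
  have P0 (t : R) : (0 <= (t `^ (- b) * expR (- t))%:E)%E.
    by rewrite lee_fin mulr_ge0 ?powR_ge0 ?expR_ge0.
  have Q0 (t : R) : (0 <= ((1 + t ^+ 2)^-1)%:E)%E.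
    by rewrite lee_fin invr_ge0 addr_ge0// sqr_ge0.
  rewrite ge0_integralD; last 5 first.
  - by [].
  - by move=> t _; rewrite mule_ge0 ?P0 ?lee_fin ?expR_ge0.
  - by apply: emeasurable_funM => //; exact: measurable_cst.
  - by move=> t _; apply: mule_ge0.
  - by apply: emeasurable_funM => //; exact: measurable_cst.
  rewrite ge0_integralZl_EFin; last 4 first.
  - by [].
  - by move=> t _; exact: P0.
  - exact: mP.
  - exact: expR_ge0.
  rewrite ge0_integralZl_EFin; last 4 first.
  - by [].
  - by move=> t _; exact: Q0.
  - exact: mQ.
  - by [].
  apply: lte_add_pinfty.
    apply: lte_mul_pinfty; [by rewrite lee_fin expR_ge0|by []|].
    have -> : - b = (1 - b) - 1 by ring.
    by rewrite integral_Gamma_gexp integral_gexp_lty// subr_gt0.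
  apply: lte_mul_pinfty => //; apply: le_lt_trans integral_oneDsqrV.
  apply: ge0_subset_integral => //.
  apply/measurable_EFinP.
  by apply: continuous_measurable_fun; exact: continuous_oneDsqrV.
have ms (A : set Rm) : measurable_fun A (sing1 b).
  by apply: measurable_funTS; exact: measurable_sing1.
rewrite -(setUv (`[0%R, +oo[%classic)) ge0_integral_setU//; last 2 first.
- by move=> t _; exact: sing1_ge0.
- exact/disj_setPCl.
apply: lte_add_pinfty => //; apply: le_lt_trans half.
rewrite (ge0_integration_by_substitution0 (f := sing1 b))//;
  last exact: sing1_ge0.
under [leRHS]eq_integral do rewrite sing1N.
apply: ge0_subset_integral => //.
- exact: measurableC.
- by move=> t _; exact: sing1_ge0.
- by rewrite setCitvr => t /=; rewrite !in_itv/=; exact: ltW.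
- exact: ms.
- exact: measurableC.
Qed.

(** The normal density of variance 1 / (2 a) has mass 1. *)
Lemma integral_gauss1 (a : R) : 0 < a ->
  (\int[leb]_x (expR (- (a * x ^+ 2)))%:E = (Num.sqrt (pi / a))%:E)%E.
Proof.
move=> a0; pose s : R := Num.sqrt (2 * a)^-1.
have a20 : 0 < (2 * a)^-1 by rewrite invr_gt0 mulr_gt0.
have s0 : s != 0 by rewrite gt_eqF// sqrtr_gt0.
have s2 : s ^+ 2 = (2 * a)^-1 by rewrite sqr_sqrtr// ltW.
have pk0 := normal_peak_gt0 s0.
have h := integral_normal_pdf 0 s.
have -> : Num.sqrt (pi / a) = (normal_peak s)^-1.
  rewrite /normal_peak invrK s2; congr Num.sqrt.
  by rewrite -mulr_natl; field; rewrite gt_eqF.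
rewrite -[RHS]mule1 -h -ge0_integralZl_EFin//.
- apply: eq_integral => x _; rewrite -EFinM normal_pdfE// mulKf ?gt_eqF//.
  rewrite /normal_fun subr0 s2; congr (expR _)%:E.
  by rewrite -mulr_natl; field; rewrite gt_eqF.
- by move=> x _; rewrite lee_fin normal_pdf_ge0.
- by apply/measurable_EFinP; exact: measurable_normal_pdf.
- by rewrite invr_ge0 ltW.
Qed.

End GammaIntegral.

(** * Values of the Gamma function at positive integers *)

Section GammaInteger.
Variable R : realType.
Local Notation leb := (@lebesgue_measure R).

(** The polynomial for which [expR (- t) * gpoly m t] is an antiderivative of
    [- t ^+ m * expR (- t)]. *)
Fixpoint gpoly (m : nat) (t : R) : R :=
  if m is k.+1 then t ^+ k.+1 + k.+1%:R * gpoly k t else 1.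

Lemma is_derive_gpoly m (t : R) :
  is_derive t 1 (gpoly m) (gpoly m t - t ^+ m).
Proof.
elim: m => [|m ih] /=.
  by rewrite expr0 subrr; apply: is_derive_eq.
have -> : (fun t => t ^+ m.+1 + m.+1%:R * gpoly m t) =
  (fun t => t ^+ m.+1) + (cst m.+1%:R * gpoly m) by [].
have d : is_derive t 1 ((@GRing.exp R)^~ m.+1) (m.+1%:R * t ^+ m).
  apply: DeriveDef; first exact: exprn_derivable.
  by rewrite exp_derive /GRing.scale /= mulr1.
by apply: is_derive_eq; rewrite /GRing.scale /=; ring.
Qed.

Lemma gpoly0 m : gpoly m 0 = m`!%:R.
Proof.
elim: m => [|m ih] /=; first by [].
by rewrite ih expr0n /= add0r factS natrM.
Qed.

Lemma cvg_expR_Xn k : (expR (- t) * t ^+ k) @[t --> +oo%R] --> (0 : R).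
Proof.
apply/cvgrPdist_le => e e0; near=> t.
have t0 : 0 < t by near: t; exact: nbhs_pinfty_gt.
have te : k.+1`!%:R / e <= t by near: t; apply: nbhs_pinfty_ge; exact: num_real.
rewrite sub0r normrN ger0_norm ?mulr_ge0 ?expR_ge0 ?exprn_ge0 ?(ltW t0)//.
rewrite expRN mulrC ler_pdivrMr ?expR_gt0//.
have h := expR_ge1Dxn k (ltW t0).
have f0 : 0 < k.+1`!%:R :> R by rewrite ltr0n fact_gt0.
have h2 : t ^+ k.+1 <= k.+1`!%:R * expR t.
  rewrite mulrC -ler_pdivrMr//; apply: le_trans h; by rewrite lerDr.
have tk : 0 <= t ^+ k by rewrite exprn_ge0// ltW.
have := ler_wpM2r tk te; rewrite -exprS => /le_trans /(_ h2).
rewrite mulrAC -mulrA ler_pM2l// ler_pdivrMr// mulrC => /le_trans; apply.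
by rewrite mulrC.
Unshelve. all: by end_near. Qed.

Lemma cvg_gpoly m : (- (expR (- t) * gpoly m t)) @[t --> +oo%R] --> (0 : R).
Proof.
rewrite -oppr0; apply: cvgN; elim: m => [|m ih] /=.
  have := cvg_expR_Xn 0; apply: cvg_trans; apply: near_eq_cvg.
  by near=> t; rewrite expr0.
have h2 : (m.+1%:R * (expR (- t) * gpoly m t)) @[t --> +oo%R] --> m.+1%:R * (0 : R).
  by apply: cvgM; [exact: cvg_cst|exact: ih].
have := cvgD (cvg_expR_Xn m.+1) h2; rewrite mulr0 addr0 => /(_ _) h3.
apply: (cvg_trans _ h3); apply: near_eq_cvg; near=> t.
by rewrite !fctE; ring.
Unshelve. all: by end_near. Qed.

Lemma Gamma_nat m : Gamma (m.+1%:R : R) = m`!%:R.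
Proof.
pose F (t : R) := - (expR (- t) * gpoly m t).
have dF (t : R) : is_derive t 1 F (t ^+ m * expR (- t)).
  have := is_derive_gpoly m t => d.
  rewrite (_ : F = - ((fun t => expR (- t)) * gpoly m))//.
  by apply: is_derive_eq; rewrite /GRing.scale /=; ring.
have cf : continuous (fun t : R => t ^+ m * expR (- t)).
  move=> t; apply: cvgM; first exact: exprn_continuous.
  apply: (@continuous_comp _ _ _ (fun t : R => - t) expR);
    first exact: oppr_continuous.
  exact: continuous_expR.
transitivity (\int[leb]_(t in `[0%R, +oo[) (t ^+ m * expR (- t))).
  rewrite /Gamma /Rintegral; congr fine.
  rewrite -[RHS]integral_itv_obnd_cbnd; last first.
    by apply: measurable_funTS; apply/measurable_EFinP;
      exact: continuous_measurable_fun.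
  apply: eq_integral => t; rewrite inE/= in_itv/= andbT => t0; congr (_ * _)%:E.
  by rewrite -natr1 addrK powR_mulrn// ltW.
rewrite (@Rintegral_ge0_continuous_FTC2y _ _ F 0 0).
- by rewrite /F oppr0 expR0 mul1r gpoly0 sub0r opprK.
- by move=> t t0; rewrite mulr_ge0 ?expR_ge0 ?exprn_ge0.
- by apply: continuous_subspaceT.
- exact: cvg_gpoly.
- by move=> t _; have [] := dF t.
- have [d _] := dF 0; apply: cvg_at_right_filter.
  by apply: differentiable_continuous; exact/derivable1_diffP.
- by move=> t _; rewrite derive1E; have [_ ->] := dF t.
Qed.

Lemma Gamma1 : Gamma 1 = 1 :> R.
Proof. exact: (Gamma_nat 0). Qed.

End GammaInteger.

(** * Weights on R^N *)

Section Weights.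
Variables (R : realType) (N : nat).
Local Notation Rm := (measurableTypeR R).
Local Notation V := 'rV[R]_N.
Local Notation mu := (lebesgue_tuple R N).
Local Notation rV := (@rV_of_tuple R N).
Implicit Types (x v : V) (t : N.-tuple Rm).

(** A product of functions of one variable, for Tonelli's theorem; for
    N >= 2 the function (1 + |x|^2)^(-1) would not be integrable. *)
Definition weight x : R := \prod_j (1 + x 0 j ^+ 2)^-1.

(** The function |x|^(-(N-1)) is the strongest singularity among the kernels
    x_j / |x|^k for k <= N. *)
Definition sing x : R := 1 + (enorm x ^+ N.-1)^-1.

Lemma sqr1D_gt0 (r : R) : 0 < 1 + r ^+ 2.
Proof. by rewrite ltr_pwDl// sqr_ge0. Qed.

Lemma weight_gt0 x : 0 < weight x.
Proof. by apply: prodr_gt0 => j _; rewrite invr_gt0 sqr1D_gt0. Qed.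

Lemma weight_ge0 x : 0 <= weight x. Proof. exact: ltW (weight_gt0 x). Qed.

Lemma weightV x : (weight x)^-1 = \prod_j (1 + x 0 j ^+ 2).
Proof. by rewrite /weight prodfV invrK. Qed.

Lemma enorm_ge0 x : 0 <= enorm x. Proof. exact: sqrtr_ge0. Qed.

Lemma sqr_enorm x : enorm x ^+ 2 = \sum_j x 0 j ^+ 2.
Proof. by rewrite sqr_sqrtr// sumr_ge0// => j _; exact: sqr_ge0. Qed.

Lemma normr_coord_le x j : `|x 0 j| <= enorm x.
Proof.
rewrite -sqrtr_sqr ler_wsqrtr// (bigD1 j)//= lerDl sumr_ge0// => i _.
exact: sqr_ge0.
Qed.

Lemma enorm_eq0 x : (enorm x == 0) = (x == 0).
Proof.
apply/eqP/eqP => [x0|->]; last first.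
  by rewrite /enorm big1 ?sqrtr0// => j _; rewrite mxE expr0n.
apply/rowP => j; rewrite mxE; apply/eqP; rewrite -normr_le0 -x0.
exact: normr_coord_le.
Qed.

Lemma sing_ge1 x : 1 <= sing x.
Proof. by rewrite lerDl invr_ge0 exprn_ge0// enorm_ge0. Qed.

Lemma sing_gt0 x : 0 < sing x.
Proof. exact: lt_le_trans (sing_ge1 x). Qed.

Lemma coord_over_pow_le (k : nat) x j : (0 < k <= N)%N ->
  `|x 0 j| / enorm x ^+ k <= sing x.
Proof.
move=> /andP[k0 kN]; have N0 : (0 < N)%N := leq_trans k0 kN.
have [->|x0] := eqVneq x 0.
  by rewrite mxE normr0 mul0r ltW// sing_gt0.
have e0 : 0 < enorm x by rewrite lt_neqAle enorm_ge0 andbT eq_sym enorm_eq0.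
apply: (@le_trans _ _ ((enorm x ^+ k.-1)^-1)).
  rewrite ler_pdivrMr ?exprn_gt0// -[k in X in _ <= _ * X](prednK k0) exprSr mulrA.
  by rewrite mulVf ?mul1r ?normr_coord_le// gt_eqF// exprn_gt0.
rewrite /sing; have [e1|e1] := leP 1 (enorm x).
  apply: (@le_trans _ _ 1); last by rewrite lerDl invr_ge0 exprn_ge0// ltW.
  by rewrite invf_le1 ?exprn_gt0// exprn_ege1.
apply: (@le_trans _ _ ((enorm x ^+ N.-1)^-1)); last by rewrite lerDr.
rewrite lef_pV2 ?posrE ?exprn_gt0//; apply: ler_wiXn2l; rewrite ?ltW//.
by rewrite -ltnS !prednK.
Qed.

Lemma measurable_coord j : measurable_fun setT (fun t => rV t 0 j).
Proof. by under eq_fun do rewrite mxE; exact: measurable_tnth. Qed.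

Lemma measurable_enorm : measurable_fun setT (fun t => enorm (rV t)).
Proof.
have ms : measurable_fun setT (Num.sqrt : Rm -> Rm).
  by apply: continuous_measurable_fun; exact: sqrt_continuous.
rewrite /enorm; apply: (measurableT_comp ms).
apply: measurable_sum => j.
exact: (measurable_funX 2 (measurable_coord j)).
Qed.

Lemma measurable_dotv (a : V) : measurable_fun setT (fun t => dotv (rV t) a).
Proof.
apply: measurable_sum => j; apply: measurable_funM; last exact: measurable_cst.
exact: measurable_coord.
Qed.

Lemma measurable_inv (f : N.-tuple Rm -> R) : measurable_fun setT f ->
  (forall t, 0 <= f t) -> measurable_fun setT (fun t => (f t)^-1).
Proof.
move=> mf f0; under eq_fun do rewrite -powR_inv1//.
exact: (measurableT_comp (measurable_powR _)).
Qed.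

Lemma measurable_weight : measurable_fun setT (fun t => weight (rV t)).
Proof.
apply: measurable_prod => j _.
apply: measurable_inv => [|t]; last exact: ltW (sqr1D_gt0 _).
apply: measurable_funD; first exact: measurable_cst.
exact: (measurable_funX 2 (measurable_coord j)).
Qed.

Lemma measurable_sing : measurable_fun setT (fun t => sing (rV t)).
Proof.
apply: measurable_funD; first exact: measurable_cst.
apply: measurable_inv => [|t]; last by rewrite exprn_ge0// enorm_ge0.
exact: (measurable_funX _ measurable_enorm).
Qed.

(** From 1 + (a + b)^2 <= 2 (1 + a^2) (1 + b^2) in every coordinate. *)
Lemma weight_shift v x :
  weight x <= (\prod_j (2 * (1 + v 0 j ^+ 2))) * weight (x + v).
Proof.
rewrite /weight -big_split /=; apply: ler_prod => j _.
rewrite invr_ge0 ltW ?sqr1D_gt0//= ler_pdivlMr ?sqr1D_gt0// mulrC.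
rewrite ler_pdivrMr ?sqr1D_gt0// mxE.
have := sqr_ge0 (x 0 j - v 0 j).
have : 0 <= x 0 j ^+ 2 * v 0 j ^+ 2 by rewrite mulr_ge0 ?sqr_ge0.
have := sqr_ge0 (x 0 j); have := sqr_ge0 (v 0 j).
move: (x 0 j) (v 0 j) => a b; rewrite !expr2 => *; nra.
Qed.

Lemma prod1D_ge n (p : 'I_n.+1 -> R) : (forall i, 0 <= p i) ->
  1 + \prod_i p i <= \prod_i (1 + p i).
Proof.
elim: n => [|n ih] in p * => p0; first by rewrite !big_ord1.
rewrite !(big_ord_recl n.+1) /=.
apply: le_trans (ler_wpM2l _ (ih (fun i => p (lift ord0 i)) (fun i => p0 _))).
  have : 0 <= \prod_(i < n.+1) p (lift ord0 i) by exact: prodr_ge0.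
  by move: (\prod_(i < n.+1) _) (p0 ord0) => a b a0; nra.
by rewrite addr_ge0.
Qed.

(** The exponent with which each of the N coordinates takes its share of
    |x|^(N-1); being less than 1, it gives an integrable singularity. *)
Definition wexp : R := N.-1%:R / N%:R.

(** |x|^(N-1) is the product over j of |x|^wexp, and |x| >= |x_j|. *)
Lemma sing_le_prod x : (0 < N)%N -> (forall j, x 0 j != 0) ->
  sing x <= \prod_j (1 + `|x 0 j| `^ (- wexp)).
Proof.
move=> N0 x0.
have lex : \prod_j `|x 0 j| `^ (- wexp) >= (enorm x ^+ N.-1)^-1.
  have xpos j : 0 < `|x 0 j| by rewrite normr_gt0.
  have e0 : 0 < enorm x.
    by apply: lt_le_trans (normr_coord_le x (Ordinal N0)).
  have -> : (enorm x ^+ N.-1)^-1 = \prod_(j < N) (enorm x `^ (- wexp)).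
    rewrite prodr_const card_ord /powR gt_eqF// -expRM_natl -[in LHS](lnK e0).
    rewrite -expRM_natl -expRN; congr expR; rewrite /wexp.
    by field; rewrite pnatr_eq0 -lt0n.
  apply: ler_prod => j _; rewrite powR_ge0 /=.
  rewrite /powR !gt_eqF// ler_expR ler_wnM2l//.
    by rewrite oppr_le0 divr_ge0.
  by rewrite ler_ln ?posrE// normr_coord_le.
rewrite /sing; apply: le_trans (lerD (lexx 1) lex) _.
move: x x0 lex; case: (N) N0 => // n _ x x0 _.
by apply: prod1D_ge => i; exact: powR_ge0.
Qed.

(** On a coordinate hyperplane the right-hand side is infinite; elsewhere both
    sides split into products over the coordinates. *)
Lemma weight_sing_le t : (0 < N)%N ->
  ((weight (rV t) * sing (rV t))%:E <=
   \big[mule/1%E]_(i < N) sing1 wexp (tnth t i))%E.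
Proof.
move=> N0.
have b0 : 0 <= wexp by rewrite divr_ge0.
have [/existsP[j /eqP tj]|] := boolP [exists j, tnth t j == 0].
  rewrite (bigD1 j)//= {1}/sing1 tj eqxx gt0_mulye ?leey//.
  elim/big_ind : _ => // [a b|i _]; first exact: mule_gt0.
  rewrite /sing1; case: ifP => // _; rewrite lte_fin; apply: ltr_wpDl.
    by rewrite !mulr_ge0 ?expR_ge0 ?powR_ge0.
  by rewrite mulr_gt0// invr_gt0 sqr1D_gt0.
rewrite negb_exists => /forallP t0.
apply: (@le_trans _ _ (\prod_(j < N)
    ((1 + `|tnth t j| `^ (- wexp)) * (1 + tnth t j ^+ 2)^-1))%:E).
  rewrite lee_fin big_split /= mulrC.
  have -> : \prod_(j < N) (1 + tnth t j ^+ 2)^-1 = weight (rV t).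
    by apply: eq_bigr => j _; rewrite mxE.
  rewrite ler_pM2r ?weight_gt0//.
  apply: le_trans (sing_le_prod N0 _) _ => [j|]; first by rewrite mxE.
  by apply: ler_prod => j _; rewrite mxE lexx andbT addr_ge0// powR_ge0.
rewrite (big_morph EFin EFinM (erefl _)).
suff : (0 <= \big[mule/1]_(i < N)
    ((1 + `|tnth t i| `^ (- wexp)) / (1 + tnth t i ^+ 2))%:E <=
    \big[mule/1]_(i < N) sing1 wexp (tnth t i))%E by case/andP.
elim/big_ind2 : _ => [|a b c d /andP[h1 h2] /andP[h3 h4]|i _].
- by rewrite lexx lee_fin ler01.
- by rewrite mule_ge0//= lee_pmul.
- rewrite le_sing1// andbT lee_fin divr_ge0 ?addr_ge0 ?powR_ge0//.
  exact: sqr_ge0.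
Qed.

Lemma integral_weight_sing : (0 < N)%N ->
  (\int[mu]_t (weight (rV t) * sing (rV t))%:E < +oo)%E.
Proof.
move=> N0.
have b1 : wexp < 1.
  by rewrite /wexp ltr_pdivrMr ?ltr0n// mul1r ltr_nat prednK.
have s0 (y : R) : (0 <= sing1 wexp y)%E := sing1_ge0 _ _.
have fin : (\int[@lebesgue_measure R]_x sing1 wexp x)%E \is a fin_num.
  by rewrite ge0_fin_numE ?integral_sing1_lty// integral_ge0.
have [mI eI] := integral_tuple_prod N (@measurable_sing1 R wexp) s0
  (esym (fineK fin)).
apply: (@le_lt_trans _ _
   (\int[mu]_t (\big[mule/1%E]_(i < N) sing1 wexp (tnth t i)))%E).
  apply: ge0_le_integral => //.
  - by move=> t _; rewrite lee_fin mulr_ge0// ltW ?weight_gt0 ?sing_gt0.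
  - apply/measurable_EFinP/measurable_funM; first exact: measurable_weight.
    exact: measurable_sing.
  - by move=> t _; exact: weight_sing_le.
by rewrite eI ltry.
Qed.

Lemma integral_weight : (0 < N)%N -> (\int[mu]_t (weight (rV t))%:E < +oo)%E.
Proof.
move=> N0; apply: le_lt_trans (integral_weight_sing N0).
apply: ge0_le_integral => //.
- by move=> t _; rewrite lee_fin ltW ?weight_gt0.
- by apply/measurable_EFinP; exact: measurable_weight.
- apply/measurable_EFinP/measurable_funM; first exact: measurable_weight.
  exact: measurable_sing.
- by move=> t _; rewrite lee_fin ler_peMr ?sing_ge1// ltW ?weight_gt0.
Qed.

End Weights.

(** * Integration by parts by translation *)

Section IntegrationByParts.
Variables (R : realType) (N : nat).
Local Notation Rm := (measurableTypeR R).
Local Notation V := 'rV[R]_N.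
Local Notation mu := (lebesgue_tuple R N).
Local Notation rV := (@rV_of_tuple R N).
Implicit Types (x v : V) (t : N.-tuple Rm).

Lemma rV_tuple_shift v t : rV (tuple_shift (fun i => v 0 i) t) = rV t + v.
Proof. by apply/rowP => j; rewrite !mxE tnth_mktuple. Qed.

Lemma measurable_rV_shift (g : V -> R) v :
  measurable_fun setT (fun t => g (rV t)) ->
  measurable_fun setT (fun t => g (rV t + v)).
Proof.
move=> mg; under eq_fun do rewrite -rV_tuple_shift.
by apply: (measurableT_comp mg); exact: measurable_tuple_shift.
Qed.

Lemma rV_integral_shift (g : V -> R) v :
  measurable_fun setT (fun t => g (rV t)) ->
  rV_integral (fun x => g (x + v)) = rV_integral g.
Proof.
move=> mg; rewrite /rV_integral.
under eq_Rintegral do rewrite -rV_tuple_shift.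
exact: (Rintegral_tuple_shift (fun i => v 0 i) mg).
Qed.

Lemma integrable_le_weight (g : V -> R) (C : R) : (0 < N)%N ->
  measurable_fun setT (fun t => g (rV t)) -> (forall x, `|g x| <= C * weight x) ->
  mu.-integrable setT (fun t => (g (rV t))%:E).
Proof.
move=> N0 mg gW.
have C0 : 0 <= C.
  by rewrite -(pmulr_lge0 C (weight_gt0 (0 : V))) (le_trans _ (gW 0)).
apply: (@integrable_dominated _ _ _ _ _ (fun t => (C%:E * (weight (rV t))%:E)%E)).
- by [].
- by apply/measurable_EFinP/measurable_funM => //; exact: measurable_weight.
- by move=> t; rewrite -EFinM lee_fin.
- rewrite ge0_integralZl_EFin//.
  + by apply: lte_mul_pinfty => //; exact: integral_weight.
  + by move=> t _; rewrite lee_fin ltW// weight_gt0.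
  + by apply/measurable_EFinP; exact: measurable_weight.
Qed.

Lemma bound_ge0 (phi : V -> R[i]) (B : R) :
  (forall x, cabs (phi x) <= B * weight x) -> 0 <= B.
Proof.
by move=> h; rewrite -(pmulr_lge0 B (weight_gt0 (0 : V))) (le_trans _ (h 0))// cabs_ge0.
Qed.

Lemma cintble_le_weight (phi : V -> R[i]) (B : R) :
  (0 < N)%N -> cmeas (fun t => phi (rV t)) ->
  (forall x, cabs (phi x) <= B * weight x) -> cintble mu (fun t => phi (rV t)).
Proof.
move=> N0 [m1 m2] phiB; split.
- apply: (@integrable_le_weight (fun x => complex.Re (phi x)) B) => // x.
  exact: le_trans (normr_Re_le _) (phiB x).
- apply: (@integrable_le_weight (fun x => complex.Im (phi x)) B) => // x.
  exact: le_trans (normr_Im_le _) (phiB x).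
Qed.

(** Directional derivatives of g are derivatives of [line] at 0; with these,
    the lemmas on functions of one real variable apply. *)
Definition line (g : V -> R) (j : 'I_N) x (h : R) := g (x + h *: delta_mx 0 j).

Lemma weight_line_le x j (h : R) : `|h| < 1 ->
  weight (x + h *: delta_mx 0 j) <= 4 ^+ N * weight x.
Proof.
move=> h1; have := weight_shift (- (h *: delta_mx 0 j)) (x + h *: delta_mx 0 j).
rewrite addrK => /le_trans; apply; rewrite ler_pM2r ?weight_gt0//.
rewrite -[X in _ <= _ ^+ X](card_ord N) -prodr_const; apply: ler_prod => i _.
rewrite mulr_ge0 ?(ltW (sqr1D_gt0 _))//= !mxE sqrrN.
have : (h * ((0 == 0 :> 'I_1) && (i == j))%:R) ^+ 2 <= 1.
  have h2 : h ^+ 2 <= 1 by rewrite -(real_normK (num_real h)) expr_le1// ltW.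
  rewrite exprMn eqxx /=; case: (i == j); rewrite ?expr1n ?mulr1//.
  by rewrite expr0n mulr0.
by move=> *; lra.
Qed.

Lemma is_derive_line (g g' : V -> R) j x (h : R) :
  (forall y, is_derive (0 : R) 1 (line g j y) (g' y)) ->
  is_derive h 1 (line g j x) (g' (x + h *: delta_mx 0 j)).
Proof.
move=> dg; have dh := dg (x + h *: delta_mx 0 j).
have e : line g j x = line g j (x + h *: delta_mx 0 j) \o (fun l => l - h).
  by apply/funext => l; rewrite /line /= -addrA -scalerDl subrKC.
have dl : is_derive h 1 (fun l : R => l - h) 1.
  by apply: is_derive_eq; rewrite subr0.
rewrite e; have dh' : is_derive (h - h) 1 (line g j (x + h *: delta_mx 0 j))
   (g' (x + h *: delta_mx 0 j)) by rewrite subrr.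
have := @is_derive1_comp R (line g j (x + h *: delta_mx 0 j)) (fun l => l - h) h _ _ dh' dl.
by rewrite mulr1.
Qed.

(** Translating the argument does not change the integral, and the derivative
    with respect to the translation is the integral of the derivative. *)
Lemma integral_partial0 (g g' : V -> R) j (C : R) :
  measurable_fun setT (fun t => g (rV t)) ->
  (forall x, is_derive (0 : R) 1 (line g j x) (g' x)) ->
  (forall x, `|g x| <= C * weight x) -> (forall x, `|g' x| <= C * weight x) ->
  rV_integral g' = 0.
Proof.
move=> mg dg gW g'weight.
have N0 : (0 < N)%N by exact: leq_ltn_trans (ltn_ord j).
have C0 : 0 <= C.
  by rewrite -(pmulr_lge0 C (weight_gt0 (0 : V))) (le_trans _ (gW 0)).
pose f (h : R) t := line g j (rV t) h.
have mf h : measurable_fun setT (f h) by exact: measurable_rV_shift.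
have d1f h t : 'D_1 (f^~ t) h = g' (rV t + h *: delta_mx 0 j).
  by have [_ ->] := is_derive_line (rV t) h dg.
have W4 x h : h \in `](-1), 1[ -> weight (x + h *: delta_mx 0 j) <= 4 ^+ N * weight x.
  by rewrite in_itv/= => h1; apply: weight_line_le; rewrite ltr_norml.
have bnd (k : V -> R) x h : (forall x, `|k x| <= C * weight x) ->
   h \in `](-1), 1[ -> `|k (x + h *: delta_mx 0 j)| <= C * 4 ^+ N * weight x.
  move=> kW h1; apply: le_trans (kW _) _; rewrite -mulrA ler_wpM2l//.
  exact: W4.
have := @differentiation_under_integral R _ _ mu f setT measurableT
  0 (-1) 1 _ _ _ (fun t => C * 4 ^+ N * weight (rV t)) _ _ _.
rewrite /=.
have cstF : (fun h => \int[mu]_t f h t) = fun=> rV_integral g.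
  apply/funext => h; rewrite /f /line.
  exact: (rV_integral_shift (h *: delta_mx 0 j) mg).
rewrite cstF /= derive1_cst => /(_ _ _ _ _ _ _)/esym.
have -> : \int[mu]_y partial1of2 f 0 y = rV_integral g'.
  by apply: eq_Rintegral => t _; rewrite partial1of2E d1f scale0r addr0.
apply.
- by rewrite /= in_itv/= oppr_lt0 ltr01.
- move=> h h1; apply: (@integrable_le_weight (fun x => g (x + h *: delta_mx 0 j))
    (C * 4 ^+ N)) => // [|x].
    exact: (measurable_rV_shift (h *: delta_mx 0 j) mg).
  exact: (bnd g x h gW h1).
- by move=> h t h1 _; have [] := is_derive_line (rV t) h dg.
- by move=> t; rewrite !mulr_ge0// ltW// weight_gt0.
- apply: (@integrable_le_weight (fun x => C * 4 ^+ N * weight x) (C * 4 ^+ N)) => //.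
    by apply: measurable_funM => //; exact: measurable_weight.
  by move=> x; rewrite ger0_norm// !mulr_ge0// ltW// weight_gt0.
- by move=> h t h1 _; rewrite partial1of2E d1f; exact: (bnd g').
Qed.

End IntegrationByParts.

(** * The Fourier transform of x_j exp (- a |x|^2) *)

Section Gaussian.
Variables (R : realType) (N : nat).
Local Notation Rm := (measurableTypeR R).
Local Notation V := 'rV[R]_N.
Local Notation mu := (lebesgue_tuple R N).
Local Notation rV := (@rV_of_tuple R N).
Implicit Types (x eta : V) (t : N.-tuple Rm).
Variable a : R.
Hypothesis a0 : 0 < a.

Definition gaussN (b : R) x : R := expR (- (b * enorm x ^+ 2)).

Lemma gaussN_gt0 b x : 0 < gaussN b x. Proof. exact: expR_gt0. Qed.

Lemma gaussN_prod b x : gaussN b x = \prod_j expR (- (b * x 0 j ^+ 2)).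
Proof. by rewrite -expR_sum /gaussN sqr_enorm mulr_sumr sumrN. Qed.

Lemma gauss1_le (b r : R) : 0 < b ->
  expR (- (b * r ^+ 2)) <= (1 + b^-1) * (1 + r ^+ 2)^-1.
Proof.
move=> b0; rewrite ler_pdivlMr ?sqr1D_gt0// mulrC expRN ler_pdivrMr ?expR_gt0//.
have b1 : 0 <= b^-1 by rewrite invr_ge0 ltW.
apply: le_trans (ler_wpM2l _ (expR_ge1Dx _)); last by rewrite addr_ge0.
have -> : (1 + b^-1) * (1 + b * r ^+ 2) = 1 + b^-1 + b * r ^+ 2 + r ^+ 2.
  by field; rewrite gt_eqF.
have : 0 <= b * r ^+ 2 by rewrite mulr_ge0 ?sqr_ge0// ltW.
by move=> *; lra.
Qed.

Lemma gaussN_le_weight b x : 0 < b -> gaussN b x <= (1 + b^-1) ^+ N * weight x.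
Proof.
move=> b0; rewrite gaussN_prod -[X in _ <= _ ^+ X * _](card_ord N) -prodr_const.
rewrite -big_split /=; apply: ler_prod => j _; rewrite expR_ge0 /=.
exact: gauss1_le.
Qed.

Lemma coord_gaussN_le_weight j x :
  `|x 0 j| * gaussN a x <= (1 + (a / 2)^-1) ^+ N.+1 * weight x.
Proof.
have b0 : 0 < a / 2 by rewrite divr_gt0.
rewrite exprS -mulrA.
apply: (@le_trans _ _ ((1 + (a / 2)^-1) * gaussN (a / 2) x)); last first.
  by rewrite ler_wpM2l ?gaussN_le_weight// addr_ge0// invr_ge0 ltW.
rewrite {1}/gaussN [X in a * X](splitr (enorm x ^+ 2)).
have -> : - (a * (enorm x ^+ 2 / 2 + enorm x ^+ 2 / 2)) =
  - (a / 2 * enorm x ^+ 2) + - (a / 2 * enorm x ^+ 2) by field.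
rewrite expRD mulrA ler_pM2r ?expR_gt0// expRN ler_pdivrMr ?expR_gt0//.
have h := gauss1_le (enorm x) b0.
have nx := normr_coord_le x j.
have e1 : 1 + enorm x ^+ 2 <= (1 + (a / 2)^-1) * expR (a / 2 * enorm x ^+ 2).
  move: h; rewrite ler_pdivlMr ?sqr1D_gt0// expRN mulrC ler_pdivrMr ?expR_gt0//.
have := sqr_ge0 (enorm x - 1); rewrite sqrrB mulr1 expr1n.
have := enorm_ge0 x.
by move: e1 nx; rewrite !expr2 => *; lra.
Qed.

Lemma measurable_gaussN b : measurable_fun setT (fun t => gaussN b (rV t)).
Proof.
apply: (measurableT_comp (@measurable_expR R)); apply: measurable_funN.
apply: measurable_funM; first exact: measurable_cst.
exact: (measurable_funX 2 (@measurable_enorm R N)).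
Qed.

Lemma measurable_cos_dotv eta :
  measurable_fun setT (fun t => cos (dotv (rV t) eta)).
Proof.
have mc : measurable_fun setT (cos : Rm -> Rm).
  by apply: continuous_measurable_fun; exact: continuous_cos.
by apply: (measurableT_comp mc); exact: measurable_dotv.
Qed.

Lemma measurable_sin_dotv eta :
  measurable_fun setT (fun t => sin (dotv (rV t) eta)).
Proof.
have mc : measurable_fun setT (sin : Rm -> Rm).
  by apply: continuous_measurable_fun; exact: continuous_sin.
by apply: (measurableT_comp mc); exact: measurable_dotv.
Qed.

Lemma sqr_enorm_line x j (h : R) :
  enorm (x + h *: delta_mx 0 j) ^+ 2 = enorm x ^+ 2 + 2 * h * x 0 j + h ^+ 2.
Proof.
rewrite !sqr_enorm (bigD1 j)//= [in RHS](bigD1 j)//= !mxE !eqxx mulr1.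
under eq_bigr => i ij do rewrite !mxE (negbTE ij) andbF mulr0 addr0.
by ring.
Qed.

Lemma dotv_line x eta j (h : R) :
  dotv (x + h *: delta_mx 0 j) eta = dotv x eta + h * eta 0 j.
Proof.
rewrite /dotv (bigD1 j)//= [in RHS](bigD1 j)//= !mxE !eqxx mulr1.
under eq_bigr => i ij do rewrite !mxE (negbTE ij) andbF mulr0 addr0.
by ring.
Qed.

Lemma is_derive_gaussN_line x j :
  is_derive (0 : R) 1 (line (gaussN a) j x) (- 2 * a * x 0 j * gaussN a x).
Proof.
rewrite /line /gaussN; under eq_fun do rewrite sqr_enorm_line.
apply: is_derive_eq; rewrite mulr0 mul0r expr0n !addr0 /GRing.scale /=.
by ring.
Qed.

Lemma is_derive_cos_line x eta j :
  is_derive (0 : R) 1 (line (fun y => cos (dotv y eta)) j x)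
    (- (eta 0 j * sin (dotv x eta))).
Proof.
rewrite /line; under eq_fun do rewrite dotv_line.
by apply: is_derive_eq; rewrite mul0r !addr0 /GRing.scale /=; ring.
Qed.

Lemma is_derive_sin_line x eta j :
  is_derive (0 : R) 1 (line (fun y => sin (dotv y eta)) j x)
    (eta 0 j * cos (dotv x eta)).
Proof.
rewrite /line; under eq_fun do rewrite dotv_line.
by apply: is_derive_eq; rewrite mul0r !addr0 /GRing.scale /=; ring.
Qed.

Definition gcos eta x := gaussN a x * cos (dotv x eta).
Definition gsin eta x := gaussN a x * sin (dotv x eta).

Lemma normr_cos_le (r : R) : `|cos r| <= 1.
Proof. by rewrite ler_norml cos_geN1 cos_le1. Qed.

Lemma normr_sin_le (r : R) : `|sin r| <= 1.
Proof. by rewrite ler_norml sin_geN1 sin_le1. Qed.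

(** The second bound is for the j-th partial derivative of gaussN times cos or
    sin of (x, eta), with c equal to eta_j up to sign. *)
Lemma gaussN_trig_bound (c : R) j :
  exists C, forall x (p q : R), `|p| <= 1 -> `|q| <= 1 ->
  `|gaussN a x * p| <= C * weight x /\
  `|- 2 * a * x 0 j * gaussN a x * p + c * (gaussN a x * q)| <= C * weight x.
Proof.
pose C1 := (1 + a^-1) ^+ N; pose C2 := (1 + (a / 2)^-1) ^+ N.+1.
have C10 : 0 <= C1 by rewrite exprn_ge0// addr_ge0// invr_ge0 ltW.
have C20 : 0 <= C2 by rewrite exprn_ge0// addr_ge0// invr_ge0 divr_ge0// ltW.
exists (C1 + (2 * a * C2 + `|c| * C1)) => x p q p1 q1.
have W0 := ltW (weight_gt0 x); have G0 := ltW (gaussN_gt0 a x).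
have h1 := gaussN_le_weight x a0; have h2 := coord_gaussN_le_weight j x.
have a2 : 0 <= 2 * a * C2 by rewrite !mulr_ge0// ltW.
have g1 (r : R) : `|r| <= 1 -> `|gaussN a x * r| <= C1 * weight x.
  move=> r1; rewrite normrM (ger0_norm G0); apply: le_trans h1.
  by rewrite ler_piMr.
split; first by apply: le_trans (g1 p p1) _;
  rewrite ler_wpM2r// lerDl addr_ge0// mulr_ge0.
apply: le_trans (ler_normD _ _) _; rewrite [leRHS]mulrDl -[leLHS]add0r.
apply: lerD; first by rewrite mulr_ge0.
rewrite mulrDl; apply: lerD; last first.
  by rewrite normrM -mulrA ler_wpM2l// g1.
have -> : - 2 * a * x 0 j * gaussN a x * p = - (2 * a) * (x 0 j * gaussN a x * p).
  by ring.
rewrite normrM normrN (ger0_norm (mulr_ge0 _ (ltW a0)))//.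
rewrite -(mulrA (2 * a) C2).
rewrite ler_wpM2l ?mulr_ge0 ?(ltW a0)//.
apply: le_trans h2; rewrite !normrM (ger0_norm G0).
by rewrite ler_piMr// mulr_ge0.
Qed.

Lemma measurable_gcos eta : measurable_fun setT (fun t => gcos eta (rV t)).
Proof.
apply: measurable_funM; first exact: measurable_gaussN.
exact: measurable_cos_dotv.
Qed.

Lemma measurable_gsin eta : measurable_fun setT (fun t => gsin eta (rV t)).
Proof.
apply: measurable_funM; first exact: measurable_gaussN.
exact: measurable_sin_dotv.
Qed.

Definition int_gcos eta := rV_integral (gcos eta).
Definition int_gsin eta := rV_integral (gsin eta).

Hypothesis N0 : (0 < N)%N.

Lemma integrable_gauss_trig (f : V -> R) :
  measurable_fun setT (fun t => f (rV t)) -> (forall x, `|f x| <= 1) ->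
  mu.-integrable setT (fun t => (gaussN a (rV t) * f (rV t))%:E) /\
  forall j, mu.-integrable setT
    (fun t => (rV t 0 j * (gaussN a (rV t) * f (rV t)))%:E).
Proof.
move=> mf f1; split.
  apply: (@integrable_le_weight _ _ (fun x => gaussN a x * f x) ((1 + a^-1) ^+ N)) => //.
    by apply: measurable_funM => //; exact: measurable_gaussN.
  move=> x; rewrite normrM ger0_norm ?(ltW (gaussN_gt0 _ _))//.
  apply: le_trans (gaussN_le_weight x a0);
    rewrite ler_piMr// ltW// gaussN_gt0//.
move=> j; apply: (@integrable_le_weight _ _ (fun x => x 0 j * (gaussN a x * f x))
  ((1 + (a / 2)^-1) ^+ N.+1)) => //.
  apply: measurable_funM; first exact: measurable_coord.
  by apply: measurable_funM => //; exact: measurable_gaussN.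
move=> x; rewrite !normrM (ger0_norm (ltW (gaussN_gt0 _ _))) mulrA.
apply: le_trans (coord_gaussN_le_weight j x); rewrite ler_piMr// mulr_ge0//.
by rewrite ltW// gaussN_gt0.
Qed.

Lemma integrable_gcos eta :
  mu.-integrable setT (fun t => (gcos eta (rV t))%:E) /\
  forall j, mu.-integrable setT (fun t => (rV t 0 j * gcos eta (rV t))%:E).
Proof.
apply: (integrable_gauss_trig (f := fun x => cos (dotv x eta))).
  exact: measurable_cos_dotv.
by move=> x; exact: normr_cos_le.
Qed.

Lemma integrable_gsin eta :
  mu.-integrable setT (fun t => (gsin eta (rV t))%:E) /\
  forall j, mu.-integrable setT (fun t => (rV t 0 j * gsin eta (rV t))%:E).
Proof.
apply: (integrable_gauss_trig (f := fun x => sin (dotv x eta))).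
  exact: measurable_sin_dotv.
by move=> x; exact: normr_sin_le.
Qed.

(** The integral of the j-th partial derivative of [gsin eta] vanishes, and
    this derivative is -2 a x_j gsin + eta_j gcos. *)
Lemma integral_coord_gsin eta j :
  rV_integral (fun x => x 0 j * gsin eta x) = eta 0 j / (2 * a) * int_gcos eta.
Proof.
have [C hC] := gaussN_trig_bound (eta 0 j) j.
pose g' x := - 2 * a * x 0 j * gaussN a x * sin (dotv x eta) +
  eta 0 j * (gaussN a x * cos (dotv x eta)).
have h : rV_integral g' = 0.
  apply: (@integral_partial0 _ _ (gsin eta) g' j C).
  - exact: measurable_gsin.
  - move=> x; have d1 := is_derive_gaussN_line x j.
    have d2 := is_derive_sin_line x eta j.
    rewrite (_ : line (gsin eta) j x = line (gaussN a) j x *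
       line (fun y => sin (dotv y eta)) j x) //.
    apply: is_derive_eq; rewrite /line scale0r addr0 /g' /GRing.scale /=; ring.
  - by move=> x; have [] := hC x _ _ (normr_sin_le (dotv x eta)) (normr_sin_le 0).
  - by move=> x; have [] := hC x _ _ (normr_sin_le (dotv x eta))
      (normr_cos_le (dotv x eta)).
have [ic _] := integrable_gcos eta; have [_ /(_ j) is_] := integrable_gsin eta.
have : rV_integral g' = - (2 * a) * rV_integral (fun x => x 0 j * gsin eta x) +
    eta 0 j * int_gcos eta.
  rewrite /int_gcos /rV_integral -!RintegralZl//= -RintegralD//=.
  - by apply: eq_Rintegral => t _; rewrite /g' /gsin /gcos; ring.
  - exact: integrable_EFinZl.
  - exact: integrable_EFinZl.
rewrite h; move: (rV_integral _) (int_gcos _) => X Y e.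
have an : a != 0 by rewrite gt_eqF.
have -> : X = (2 * a * X) / (2 * a) by field.
have -> : 2 * a * X = eta 0 j * Y by lra.
by field.
Qed.

Lemma integral_coord_gcos eta j :
  rV_integral (fun x => x 0 j * gcos eta x) = - (eta 0 j / (2 * a)) * int_gsin eta.
Proof.
have [C hC] := gaussN_trig_bound (- eta 0 j) j.
pose g' x := - 2 * a * x 0 j * gaussN a x * cos (dotv x eta) +
  - eta 0 j * (gaussN a x * sin (dotv x eta)).
have h : rV_integral g' = 0.
  apply: (@integral_partial0 _ _ (gcos eta) g' j C).
  - exact: measurable_gcos.
  - move=> x; have d1 := is_derive_gaussN_line x j.
    have d2 := is_derive_cos_line x eta j.
    rewrite (_ : line (gcos eta) j x = line (gaussN a) j x *
       line (fun y => cos (dotv y eta)) j x) //.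
    apply: is_derive_eq; rewrite /line scale0r addr0 /g' /GRing.scale /=; ring.
  - by move=> x; have [] := hC x _ _ (normr_cos_le (dotv x eta)) (normr_sin_le 0).
  - by move=> x; have [] := hC x _ _ (normr_cos_le (dotv x eta))
      (normr_sin_le (dotv x eta)).
have [is_ _] := integrable_gsin eta; have [_ /(_ j) ic] := integrable_gcos eta.
have : rV_integral g' = - (2 * a) * rV_integral (fun x => x 0 j * gcos eta x) +
    - eta 0 j * int_gsin eta.
  rewrite /int_gsin /rV_integral -!RintegralZl//= -RintegralD//=.
  - by apply: eq_Rintegral => t _; rewrite /g' /gsin /gcos; ring.
  - exact: integrable_EFinZl.
  - exact: integrable_EFinZl.
rewrite h; move: (rV_integral _) (int_gsin _) => X Y e.
have an : a != 0 by rewrite gt_eqF.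
have -> : X = (2 * a * X) / (2 * a) by field.
have -> : 2 * a * X = - eta 0 j * Y by lra.
by field.
Qed.

(** Differentiation under the integral sign: the derivative in u is at most
    |(x, eta)| exp (- a |x|^2), uniformly in u. Used with f = cos and f = sin. *)
Lemma is_derive_gauss_ray (f f' : R -> R) eta (r : R) :
  (forall u : R, is_derive u 1 f (f' u)) ->
  (forall u, `|f u| <= 1) -> (forall u, `|f' u| <= 1) ->
  continuous f ->
  is_derive r 1 (fun u => rV_integral (fun x => gaussN a x * f (u * dotv x eta)))
    (rV_integral (fun x => dotv x eta * (gaussN a x * f' (r * dotv x eta)))).
Proof.
move=> df f1 f'1 cf.
have mcf : measurable_fun setT (f : Rm -> Rm) by exact: continuous_measurable_fun.
have mf u : measurable_fun setT (fun t => f (u * dotv (rV t) eta)).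
  apply: (measurableT_comp mcf); apply: measurable_funM;
    first exact: measurable_cst.
  exact: measurable_dotv.
pose F u t := gaussN a (rV t) * f (u * dotv (rV t) eta).
have dF (u : R) t : is_derive u 1 (F ^~ t)
    (dotv (rV t) eta * (gaussN a (rV t) * f' (u * dotv (rV t) eta))).
  have d1 := df (u * dotv (rV t) eta).
  have d2 : is_derive u 1 (fun v => v * dotv (rV t) eta) (dotv (rV t) eta).
    by apply: is_derive_eq; rewrite /GRing.scale /=; ring.
  have d3 := @is_derive1_comp R f (fun v => v * dotv (rV t) eta) u _ _ d1 d2.
  rewrite (_ : F^~ t = cst (gaussN a (rV t)) * (f \o fun v => v * dotv (rV t) eta)) //.
  by apply: is_derive_eq; rewrite /GRing.scale /=; ring.
pose C := \sum_j (`|eta 0 j| * (1 + (a / 2)^-1) ^+ N.+1).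
have C0 : 0 <= C.
  apply: sumr_ge0 => j _; rewrite mulr_ge0// exprn_ge0// addr_ge0// invr_ge0.
  by rewrite divr_ge0// ltW.
have dom t : `|dotv (rV t) eta| * gaussN a (rV t) <= C * weight (rV t).
  apply: (@le_trans _ _ (\sum_j (`|rV t 0 j| * `|eta 0 j|) * gaussN a (rV t))).
    rewrite -mulr_suml ler_wpM2r ?(ltW (gaussN_gt0 _ _))//.
    by apply: le_trans (ler_norm_sum _ _ _) _; apply: ler_sum => j _;
      rewrite normrM.
  rewrite /C mulr_suml; apply: ler_sum => j _.
  rewrite mulrAC mulrC -mulrA ler_wpM2l//; exact: coord_gaussN_le_weight.
have iF u : mu.-integrable setT (EFin \o F u).
  exact: (integrable_gauss_trig (f := fun x => f (u * dotv x eta)) (mf u)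
    (fun x => f1 _)).1.
have ir : `](r - 1), (r + 1)[%classic r.
  by rewrite /= in_itv/= ltrBlDr ltrDl ltr01.
have p1 u t : partial1of2 F u t =
    dotv (rV t) eta * (gaussN a (rV t) * f' (u * dotv (rV t) eta)).
  by rewrite partial1of2E; have [_ ->] := dF u t.
have H0 t : 0 <= C * weight (rV t) by rewrite mulr_ge0// ltW// weight_gt0.
have iH : mu.-integrable setT (EFin \o (fun t => C * weight (rV t))).
  apply: (@integrable_le_weight _ _ (fun x => C * weight x) C) => //.
    by apply: measurable_funM => //; exact: measurable_weight.
  by move=> x; rewrite ger0_norm// mulr_ge0// ltW// weight_gt0.
have bH (u : R) t : `](r - 1), (r + 1)[%classic u -> setT t ->
    `|partial1of2 F u t| <= C * weight (rV t).
  move=> _ _; rewrite p1; apply: le_trans (dom t).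
  rewrite !normrM (ger0_norm (ltW (gaussN_gt0 _ _))) mulrA.
  by rewrite ler_piMr// mulr_ge0// ltW// gaussN_gt0.
have dF' (u : R) t : `](r - 1), (r + 1)[%classic u -> setT t -> derivable (F^~ t) u 1.
  by move=> _ _; have [] := dF u t.
apply: DeriveDef.
  exact: (derivable_under_integral measurableT ir (fun u _ => iF u) dF' H0 iH bH).
rewrite -derive1E.
rewrite (differentiation_under_integral measurableT ir (fun u _ => iF u) dF' H0 iH bH).
by apply: eq_Rintegral => t _; rewrite p1.
Qed.

Lemma dotvZr x eta (r : R) : dotv x (r *: eta) = r * dotv x eta.
Proof.
by rewrite /dotv mulr_sumr; apply: eq_bigr => j _; rewrite mxE; ring.
Qed.

Lemma integral_dotv_gauss (g : V -> R) (zeta : V) :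
  (forall j, mu.-integrable setT (fun t => (rV t 0 j * g (rV t))%:E)) ->
  rV_integral (fun x => dotv x zeta * g x) =
  \sum_j zeta 0 j * rV_integral (fun x => x 0 j * g x).
Proof.
move=> ig; transitivity (\sum_j rV_integral (fun x => zeta 0 j * (x 0 j * g x))).
  rewrite /rV_integral -Rintegral_sum.
    apply: eq_Rintegral => t _; rewrite /dotv mulr_suml; apply: eq_bigr => j _.
    by ring.
  by move=> j; apply: integrable_EFinZl; exact: ig.
by apply: eq_bigr => j _; rewrite /rV_integral RintegralZl//; exact: ig.
Qed.

(** The derivative brings down a factor (x, eta), which integration by parts
    turns into |eta|^2 / (2 a) times the integral itself. *)
Lemma is_derive_int_gcos_ray eta (r : R) :
  is_derive r 1 (fun u => int_gcos (u *: eta))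
    (- (enorm eta ^+ 2 / (2 * a)) * r * int_gcos (r *: eta)).
Proof.
rewrite /int_gcos /gcos; under eq_fun do under eq_fun do rewrite dotvZr.
have d := @is_derive_gauss_ray cos (fun u => - sin u) eta r
  (fun u => is_derive_cos u) normr_cos_le _ (@continuous_cos R).
apply: is_derive_eq (d _) _ => [u|]; first by rewrite normrN normr_sin_le.
transitivity (rV_integral (fun x => dotv x (- eta) * gsin (r *: eta) x)).
  congr rV_integral; apply/funext => x; rewrite /gsin dotvZr.
  by rewrite -(scaleN1r eta) dotvZr; ring.
rewrite integral_dotv_gauss; last exact: (integrable_gsin _).2.
under eq_bigr do rewrite integral_coord_gsin !mxE.
rewrite -[rV_integral _]/(int_gcos (r *: eta)) sqr_enorm;
  move: (int_gcos _) => J.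
have an : a != 0 by rewrite gt_eqF.
have -> : - ((\sum_j eta 0 j ^+ 2) / (2 * a)) * r * J =
  (\sum_j eta 0 j ^+ 2) * (- (r * J) / (2 * a)) by field.
by rewrite mulr_suml; apply: eq_bigr => j _; field.
Qed.

Lemma is_derive_int_gsin_ray eta (r : R) :
  is_derive r 1 (fun u => int_gsin (u *: eta))
    (- (enorm eta ^+ 2 / (2 * a)) * r * int_gsin (r *: eta)).
Proof.
rewrite /int_gsin /gsin; under eq_fun do under eq_fun do rewrite dotvZr.
have d := @is_derive_gauss_ray sin cos eta r
  (fun u => is_derive_sin u) normr_sin_le normr_cos_le (@continuous_sin R).
apply: is_derive_eq d _.
transitivity (rV_integral (fun x => dotv x eta * gcos (r *: eta) x)).
  by congr rV_integral; apply/funext => x; rewrite /gcos dotvZr.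
rewrite integral_dotv_gauss; last exact: (integrable_gcos _).2.
under eq_bigr do rewrite integral_coord_gcos !mxE.
rewrite -[rV_integral _]/(int_gsin (r *: eta)) sqr_enorm;
  move: (int_gsin _) => J.
have an : a != 0 by rewrite gt_eqF.
have -> : - ((\sum_j eta 0 j ^+ 2) / (2 * a)) * r * J =
  (\sum_j eta 0 j ^+ 2) * (- (r * J) / (2 * a)) by field.
by rewrite mulr_suml; apply: eq_bigr => j _; field.
Qed.

(** y(r) exp (k r^2 / 2) has derivative zero. *)
Lemma gauss_ode (y : R -> R) (k : R) :
  (forall r : R, is_derive r 1 y (- k * r * y r)) -> y 1 = y 0 * expR (- (k / 2)).
Proof.
move=> dy; pose z (r : R) := y r * expR (k / 2 * r ^+ 2).
have dz (r : R) : is_derive r 1 z 0.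
  have d := dy r; rewrite (_ : z = y * (fun r => expR (k / 2 * r ^+ 2)))//.
  by apply: is_derive_eq; rewrite /GRing.scale /=; field.
have := is_derive_0_is_cst 1 0 dz.
rewrite /z expr1n expr0n mulr1 mulr0 expR0 mulr1 => <-.
by rewrite -mulrA -expRD addrN expR0 mulr1.
Qed.

Lemma int_gcos0 : int_gcos 0 = Num.sqrt (pi / a) ^+ N.
Proof.
have mg : measurable_fun setT (fun x : Rm => (expR (- (a * x ^+ 2)))%:E).
  apply/measurable_EFinP; apply: (measurableT_comp (@measurable_expR R)).
  apply: measurable_funN; apply: measurable_funM; first exact: measurable_cst.
  exact: exprn_measurable.
have g0 (x : R) : (0 <= (expR (- (a * x ^+ 2)))%:E)%E by rewrite lee_fin expR_ge0.
have [_ h] := integral_tuple_prod N mg g0 (integral_gauss1 a0).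
rewrite /int_gcos /rV_integral /Rintegral -[RHS]/(fine (_ %:E)) -h; congr fine.
apply: eq_integral => t _;
  rewrite /gcos -(scale0r (0 : V)) dotvZr mul0r cos0 mulr1.
rewrite gaussN_prod (big_morph EFin EFinM (erefl _)).
by apply: eq_bigr => j _; rewrite mxE.
Qed.

Lemma int_gcosE eta :
  int_gcos eta = Num.sqrt (pi / a) ^+ N * expR (- (enorm eta ^+ 2 / (4 * a))).
Proof.
have := gauss_ode (is_derive_int_gcos_ray eta).
rewrite scale1r scale0r int_gcos0 => ->; congr (_ * expR _).
by field; rewrite gt_eqF.
Qed.

Lemma int_gsinE eta : int_gsin eta = 0.
Proof.
have := gauss_ode (is_derive_int_gsin_ray eta).
rewrite scale1r scale0r => ->; rewrite [X in X * _](_ : _ = 0) ?mul0r//.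
rewrite /int_gsin /rV_integral (_ : (fun t => _) = fun=> 0).
  by rewrite Rintegral_cst// mul0r.
apply/funext => t.
by rewrite /gsin -(scale0r (0 : V)) dotvZr mul0r sin0 mulr0.
Qed.

Lemma cintegral_coord_gauss eta j :
  cintegral (fun x => (x 0 j * gaussN a x)%:C%C * expi (dotv x eta)) =
  'i%C * (eta 0 j / (2 * a) *
    (Num.sqrt (pi / a) ^+ N * expR (- (enorm eta ^+ 2 / (4 * a)))))%:C%C.
Proof.
have hc := integral_coord_gcos eta j; have hs := integral_coord_gsin eta j.
rewrite int_gsinE mulr0 in hc; rewrite int_gcosE in hs.
apply: complexE_ReIm;
  rewrite /= ?mul0r ?mul1r ?subr0 ?addr0 ?add0r ?sub0r ?mulr0 ?oppr0.
  rewrite -[RHS]hc; congr rV_integral; apply/funext => x.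
  by rewrite /gcos; ring.
rewrite -[RHS]hs; congr rV_integral; apply/funext => x.
by rewrite /gsin; ring.
Qed.

End Gaussian.

(** * The Fourier transform exchanges x_j / |x|^2 and x_j / |x|^N *)

Section MainIdentity.
Variables (R : realType) (N : nat).
Local Notation Rm := (measurableTypeR R).
Local Notation V := 'rV[R]_N.
Local Notation C := R[i].
Local Notation T := (N.-tuple Rm).
Local Notation mu := (lebesgue_tuple R N).
Local Notation leb := (@lebesgue_measure R).
Local Notation rV := (@rV_of_tuple R N).
Implicit Types (x eta : V) (t : T).

Hypothesis N0 : (0 < N)%N.

(** With the sign of the exponent positive, as in the inverse transform; the
    other sign is obtained at - eta. *)
Definition cfourier (phi : V -> C) eta : C :=
  cintegral (fun x => phi x * expi (dotv x eta)).

Definition fourier_cst : R := 2^-1 * (2 * Num.sqrt pi) ^+ N * Gamma (N%:R / 2).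

Lemma fourier_cst_ge0 : 0 <= fourier_cst.
Proof.
rewrite /fourier_cst !mulr_ge0 ?exprn_ge0 ?mulr_ge0 ?sqrtr_ge0//.
by apply: Rintegral_ge0 => x _; rewrite mulr_ge0 ?powR_ge0 ?expR_ge0.
Qed.

(** The v-integral of exp (v - e^v r^2), which produces 1 / |x|^2. *)
Lemma integral_gexp_sqr (r : R) : 0 < r ->
  (\int[leb]_v (gexp 1 (r ^+ 2) v)%:E = ((r ^+ 2)^-1)%:E)%E.
Proof.
move=> r0; rewrite integral_gexp_scale ?exprn_gt0// Gamma_integral// Gamma1 mule1.
by rewrite powR_inv1// exprn_ge0// ltW.
Qed.

(** The v-integral of the transformed Gaussians, which produces 1 / |x|^N; the
    Gaussian of parameter e^v has a transform of parameter e^(-v) / 4, hence the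
    sign of v. *)
Lemma integral_gexp_dual (r : R) : 0 < r ->
  (\int[leb]_v (gexp (N%:R / 2) (r ^+ 2 / 4) (- v))%:E =
   ((2 / r) ^+ N * Gamma (N%:R / 2))%:E)%E.
Proof.
move=> r0.
rewrite (ge0_integral_opp (f := fun v => (gexp (N%:R / 2) (r ^+ 2 / 4) v)%:E)).
- rewrite integral_gexp_scale ?divr_gt0 ?exprn_gt0//.
  rewrite Gamma_integral ?divr_gt0 ?ltr0n// -EFinM; congr (_ * _)%:E.
  have -> : r ^+ 2 / 4 = (r / 2) ^+ 2 by field.
  have r2 : 0 < r / 2 by rewrite divr_gt0.
  rewrite /powR gt_eqF ?exprn_gt0// lnXn// -[in RHS](invf_div r 2).
  rewrite -[in RHS](lnK r2) -expRN -expRM_natl; congr expR.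
  by rewrite -mulr_natl; field.
- by apply/measurable_EFinP; exact: measurable_gexp.
- by move=> v; rewrite lee_fin expR_ge0.
Qed.

Lemma measurable_gexp_joint (a b : R) (f : V -> R) :
  measurable_fun setT (fun t => f (rV t)) ->
  measurable_fun setT (fun z : T * Rm => gexp a (b * f (rV z.1)) z.2).
Proof.
move=> mf; apply: (measurableT_comp (@measurable_expR R)).
apply: measurable_funB; apply: measurable_funM.
- exact: measurable_cst.
- exact: measurable_snd.
- apply: measurable_funM; first exact: measurable_cst.
  by apply: (measurableT_comp mf); exact: measurable_fst.
- by apply: (measurableT_comp (@measurable_expR R)); exact: measurable_snd.
Qed.

(** Fubini's theorem for a superposition I(x) of the kernels w(x, v). The bound
    by [sing] makes the double integral converge absolutely. *)
Lemma cintegral_subordination (w : V -> R -> R) (I : V -> R) (K B : R)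
    (phi : V -> C) :
  measurable_fun setT (fun z : T * Rm => w (rV z.1) z.2) ->
  (forall x, leb.-integrable setT (fun v => (w x v)%:E)) ->
  (forall x, \int[leb]_v w x v = I x) ->
  (forall x, (\int[leb]_v (`|w x v|)%:E <= (K * sing x)%:E)%E) ->
  cmeas (fun t => phi (rV t)) -> (forall x, cabs (phi x) <= B * weight x) ->
  cintegral (fun x => phi x * (I x)%:C%C) =
  cint leb (fun v => cintegral (fun x => phi x * (w x v)%:C%C)).
Proof.
move=> mw iw wI wK mphi phiB.
have B0 := bound_ge0 phiB.
have K0 : 0 <= K.
  rewrite -(pmulr_lge0 K (sing_gt0 (0 : V))) -lee_fin (le_trans _ (wK 0))//.
  exact: integral_ge0.
transitivity (cint mu (fun t => cint leb (fun v => phi (rV t) * (w (rV t) v)%:C%C))).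
  apply: eq_cint => t; rewrite cintZ; last exact: cintble_real.
  by rewrite cint_real wI.
rewrite (@cint_Fubini _ _ _ _ _ mu leb
  (fun z => phi (rV z.1) * (w (rV z.1) z.2)%:C%C)
  (fun z => (B * weight (rV z.1) * `|w (rV z.1) z.2|)%:E)) //.
- apply: cmeasM; last exact: cmeas_real.
  by case: mphi => m1 m2; split;
    [apply: (measurableT_comp m1)|apply: (measurableT_comp m2)];
    exact: measurable_fst.
- apply/measurable_EFinP; apply: measurable_funM.
    apply: measurable_funM; first exact: measurable_cst.
    by apply: (measurableT_comp (@measurable_weight R N));
      exact: measurable_fst.
  by apply: (measurableT_comp _ mw); exact: normr_measurable.
- by move=> z; rewrite lee_fin cabsM cabs_real ler_wpM2r.
- apply: (@le_lt_trans _ _ (\int[mu]_t ((B * K)%:E * (weight (rV t) * sing (rV t))%:E))%E).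
    apply: ge0_le_integral => //.
    + by move=> t _; apply: integral_ge0 => v _;
        rewrite lee_fin !mulr_ge0// weight_ge0.
    + apply: (measurable_fun_fubini_tonelli_F
        (fun z : T * Rm => (B * weight (rV z.1) * `|w (rV z.1) z.2|)%:E)) => [|z].
        apply/measurable_EFinP; apply: measurable_funM.
          apply: measurable_funM; first exact: measurable_cst.
          by apply: (measurableT_comp (@measurable_weight R N));
            exact: measurable_fst.
        by apply: (measurableT_comp _ mw); exact: normr_measurable.
      by rewrite lee_fin !mulr_ge0// weight_ge0.
    + apply/measurable_EFinP; apply: measurable_funM;
        first exact: measurable_cst.
      by apply: measurable_funM;
        [exact: measurable_weight|exact: measurable_sing].
    + move=> t _.
      under eq_integral do rewrite EFinM /=.
      rewrite ge0_integralZl_EFin//.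
      * apply: (@le_trans _ _ ((B * weight (rV t))%:E * (K * sing (rV t))%:E)%E).
          by apply: lee_wpmul2l; rewrite ?lee_fin ?mulr_ge0 ?weight_ge0.
        by rewrite -!EFinM lee_fin le_eqVlt; apply/orP; left; apply/eqP; ring.
      * apply/measurable_EFinP;
          apply: (measurableT_comp (@normr_measurable R setT)).
        by have := measurable_int _ (iw (rV t)) => /measurable_EFinP.
      * by rewrite mulr_ge0// weight_ge0.
  rewrite ge0_integralZl_EFin//.
  + apply: lte_mul_pinfty => //; first by rewrite lee_fin mulr_ge0.
    exact: integral_weight_sing.
  + by move=> t _; rewrite lee_fin mulr_ge0 ?weight_ge0// ltW// sing_gt0.
  + apply/measurable_EFinP; apply: measurable_funM;
      first exact: measurable_weight.
    exact: measurable_sing.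
  + exact: mulr_ge0.
Qed.

(** A kernel x_j h(|x|, v) with nonnegative h satisfies the hypotheses of
    [cintegral_subordination] as soon as the integral of h over v is known off
    the origin: at the origin the factor x_j vanishes. *)
Lemma coord_kernel (h : R -> R -> R) (J : R -> R) (K : R) j :
  (forall x v, 0 <= h (enorm x) v) ->
  (forall r, measurable_fun setT (h r)) ->
  (forall r, 0 < r -> (\int[leb]_v (h r v)%:E = (J r)%:E)%E) ->
  (forall x, `|x 0 j| * J (enorm x) <= K * sing x) ->
  let w x v := x 0 j * h (enorm x) v in
  [/\ forall x, leb.-integrable setT (fun v => (w x v)%:E),
      forall x, \int[leb]_v w x v = x 0 j * J (enorm x) &
      forall x, (\int[leb]_v (`|w x v|)%:E <= (K * sing x)%:E)%E].
Proof.
move=> h0 mh hJ JK w.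
have pos x : x != 0 -> 0 < enorm x.
  by move=> x0; rewrite lt_neqAle enorm_ge0 andbT eq_sym enorm_eq0.
have ih x : x != 0 -> leb.-integrable setT (fun v => (h (enorm x) v)%:E).
  move=> x0; apply/integrableP; split.
    by apply/measurable_EFinP; exact: mh.
  under eq_integral do rewrite gee0_abs ?lee_fin//.
  by rewrite hJ ?ltry// pos.
split=> x; rewrite /w; have [->|x0] := eqVneq x 0.
- under eq_fun do rewrite mxE mul0r.
  exact: integrable0.
- by apply: integrable_EFinZl; exact: ih.
- under eq_Rintegral do rewrite mxE mul0r.
  by rewrite Rintegral_cst// mxE !mul0r.
- by rewrite RintegralZl ?ih// /Rintegral hJ// pos.
- under eq_integral do rewrite mxE mul0r normr0.
  by rewrite integral0 lee_fin (le_trans _ (JK 0))// mxE normr0 mul0r.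
- under eq_integral do rewrite normrM (ger0_norm (h0 _ _)) EFinM.
  rewrite ge0_integralZl_EFin//.
  + by rewrite hJ ?pos// -EFinM lee_fin.
  + by move=> v _; rewrite lee_fin.
  + by apply/measurable_EFinP; exact: mh.
Qed.

Lemma cmeas_snd (f : T -> C) : cmeas f -> cmeas (fun z : T * T => f z.2).
Proof.
by move=> [m1 m2]; split;
  [apply: (measurableT_comp m1)|apply: (measurableT_comp m2)];
  exact: measurable_snd.
Qed.

Lemma cmeas_expi_joint (eps : R) :
  cmeas (fun z : T * T => expi (dotv (rV z.2) (eps *: rV z.1))).
Proof.
apply: cmeas_expi; apply: measurable_sum => j.
apply: measurable_funM.
  by apply: (measurableT_comp (@measurable_coord R N j)); exact: measurable_snd.
under eq_fun do rewrite mxE.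
apply: measurable_funM; first exact: measurable_cst.
by apply: (measurableT_comp (@measurable_coord R N j)); exact: measurable_fst.
Qed.

Lemma cmeas_cfourier (phi : V -> C) (eps : R) : cmeas (fun t => phi (rV t)) ->
  cmeas (fun t => cfourier phi (eps *: rV t)).
Proof.
move=> mphi; apply: (@cmeas_parametric _ _ _ _ _ mu
  (fun z => phi (rV z.2) * expi (dotv (rV z.2) (eps *: rV z.1)))).
by apply: cmeasM; [exact: (cmeas_snd mphi)|exact: cmeas_expi_joint].
Qed.

Lemma gexp_gaussN x v : gexp 1 (enorm x ^+ 2) v = expR v * gaussN (expR v) x.
Proof. by rewrite /gexp /gaussN -expRD mul1r [expR v * _]mulrC. Qed.

(** The Fourier transform of x_j exp (v - e^v |x|^2) at eta is i eta_j times
    [dual_kernel |eta| v]. *)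
Definition dual_kernel (r v : R) : R :=
  2^-1 * Num.sqrt pi ^+ N * gexp (N%:R / 2) (r ^+ 2 / 4) (- v).

Lemma sqrt_pi_expR v : Num.sqrt (pi / expR v) ^+ N =
  Num.sqrt pi ^+ N * expR (- (N%:R / 2 * v)) :> R.
Proof.
rewrite sqrtrM ?pi_ge0// exprMn; congr (_ * _).
have -> : (expR v)^-1 = expR (- (v / 2)) ^+ 2.
  by rewrite -expRM_natl -expRN; congr expR; field.
rewrite sqrtr_sqr ger0_norm ?expR_ge0// -expRM_natl; congr expR.
by field.
Qed.

(** The multiplication formula, int F(phi) g = int phi F(g), for the Gaussian
    g(x) = x_j exp (v - e^v |x|^2), whose transform is known. *)
Lemma multiplication_gauss (phi : V -> C) (B eps : R) j v : eps ^+ 2 = 1 ->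
  cmeas (fun t => phi (rV t)) -> (forall x, cabs (phi x) <= B * weight x) ->
  cintegral (fun x => cfourier phi (eps *: x) *
    (x 0 j * gexp 1 (enorm x ^+ 2) v)%:C%C) =
  cintegral (fun x => 'i%C * eps%:C%C * phi x *
    (x 0 j * dual_kernel (enorm x) v)%:C%C).
Proof.
move=> eps2 mphi phiB; set a := expR v.
have a0 : 0 < a := expR_gt0 v.
have B0 := bound_ge0 phiB.
pose C2 : R := a * (1 + (a / 2)^-1) ^+ N.+1.
have C20 : 0 <= C2.
  by rewrite mulr_ge0 ?ltW// exprn_gt0// ltr_pwDl// invr_ge0 divr_ge0// ltW.
have iphi := cintble_le_weight N0 mphi phiB.
have mexpi eta : cmeas (fun t => expi (dotv (rV t) eta)).
  by apply: cmeas_expi; exact: measurable_dotv.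
pose k x := x 0 j * gexp 1 (enorm x ^+ 2) v.
have mk : measurable_fun setT (fun t => k (rV t)).
  apply: measurable_funM; first exact: measurable_coord.
  under eq_fun do rewrite gexp_gaussN.
  by apply: measurable_funM; [exact: measurable_cst|exact: measurable_gaussN].
have kW x : `|k x| <= C2 * weight x.
  rewrite /k gexp_gaussN mulrCA normrM (ger0_norm (ltW a0)) /C2 -mulrA (ler_wpM2l (ltW a0))//.
  rewrite normrM (ger0_norm (ltW (gaussN_gt0 _ _))).
  exact: coord_gaussN_le_weight.
transitivity (cint mu (fun t => cint mu (fun u =>
    phi (rV u) * expi (dotv (rV u) (eps *: rV t)) * (k (rV t))%:C%C))).
  apply: eq_cint => t; rewrite mulrC -cintZ.
    by apply: eq_cint => u; rewrite mulrC.
  apply: (@cintble_le_weight _ _ (fun x => phi x * expi (dotv x (eps *: rV t))) B N0).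
    by apply: cmeasM => //; exact: mexpi.
  by move=> x; rewrite cabsM cabs_expi mulr1.
rewrite (@cint_Fubini _ _ _ _ _ mu mu
  (fun z => phi (rV z.2) * expi (dotv (rV z.2) (eps *: rV z.1)) * (k (rV z.1))%:C%C)
  (fun z => (B * weight (rV z.2) * (C2 * weight (rV z.1)))%:E)) /=; first last.
- apply: (@le_lt_trans _ _ (\int[mu]_t ((C2 * weight (rV t))%:E *
     \int[mu]_u (B * weight (rV u))%:E))%E).
    rewrite le_eqVlt; apply/orP; left; apply/eqP; apply: eq_integral => t _.
    rewrite -ge0_integralZl_EFin//.
    + by apply: eq_integral => u _; rewrite -EFinM mulrC.
    + by move=> u _; rewrite lee_fin mulr_ge0 ?weight_ge0.
    + apply/measurable_EFinP; apply: measurable_funM;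
        first exact: measurable_cst.
      exact: measurable_weight.
    + by rewrite mulr_ge0 ?weight_ge0.
  have finW (D : R) : 0 <= D -> (\int[mu]_u (D * weight (rV u))%:E < +oo)%E.
    move=> D0; under eq_integral do rewrite EFinM.
    rewrite ge0_integralZl_EFin//.
    + by apply: lte_mul_pinfty => //; exact: integral_weight.
    + by move=> t _; rewrite lee_fin weight_ge0.
    + by apply/measurable_EFinP; exact: measurable_weight.
  have W0 (D : R) : 0 <= D -> (0 <= \int[mu]_u (D * weight (rV u))%:E)%E.
    by move=> D0; apply: integral_ge0 => t _;
      rewrite lee_fin mulr_ge0// weight_ge0.
  have fB : (\int[mu]_u (B * weight (rV u))%:E)%E \is a fin_num.
    by rewrite ge0_fin_numE ?finW// W0.
  under eq_integral do rewrite muleC.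
  rewrite ge0_integralZl//.
  + by apply: lte_mul_pinfty; [exact: W0|exact: fB|exact: finW].
  + apply/measurable_EFinP; apply: measurable_funM; first exact: measurable_cst.
    exact: measurable_weight.
  + by move=> t _; rewrite lee_fin mulr_ge0 ?weight_ge0.
  + exact: W0.
- move=> z; rewrite lee_fin !cabsM cabs_expi mulr1 cabs_real.
  by rewrite ler_pM ?cabs_ge0.
- apply/measurable_EFinP; apply: measurable_funM; apply: measurable_funM.
  + exact: measurable_cst.
  + by apply: (measurableT_comp (@measurable_weight R N));
      exact: measurable_snd.
  + exact: measurable_cst.
  + by apply: (measurableT_comp (@measurable_weight R N));
      exact: measurable_fst.
- apply: cmeasM; first (apply: cmeasM; first exact: (cmeas_snd mphi)).
    exact: cmeas_expi_joint.
  apply: cmeas_real; apply: (measurableT_comp mk); exact: measurable_fst.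
apply: eq_cint => u.
transitivity (cint mu (fun t => phi (rV u) * a%:C%C *
    ((rV t 0 j * gaussN a (rV t))%:C%C * expi (dotv (rV t) (eps *: rV u))))).
  apply: eq_cint => t; rewrite /k gexp_gaussN.
  rewrite [dotv (rV u) _](_ : _ = dotv (rV t) (eps *: rV u)); last first.
    by apply: eq_bigr => i _; rewrite !mxE; ring.
  by rewrite !rmorphM /=; ring.
rewrite cintZ; last first.
  apply: (@cintble_le_weight _ _ (fun x => (x 0 j * gaussN a x)%:C%C *
    expi (dotv x (eps *: rV u))) ((1 + (a / 2)^-1) ^+ N.+1) N0).
    apply: cmeasM; last exact: mexpi.
    apply: cmeas_real; apply: measurable_funM; first exact: measurable_coord.
    exact: measurable_gaussN.
  move=> x; rewrite cabsM cabs_expi mulr1 cabs_real normrM.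
  rewrite (ger0_norm (ltW (gaussN_gt0 _ _))).
  exact: coord_gaussN_le_weight.
have := cintegral_coord_gauss a0 N0 (eps *: rV u) j.
rewrite /cintegral /rV_integral -/(cint _ _) => ->.
rewrite /a sqrt_pi_expR.
have -> : enorm (eps *: rV u) ^+ 2 = enorm (rV u) ^+ 2.
  rewrite !sqr_enorm; apply: eq_bigr => i _.
  by rewrite mxE exprMn eps2 mul1r.
have -> : (eps *: rV u) 0 j = eps * rV u 0 j by rewrite mxE.
have -> : eps * rV u 0 j / (2 * expR v) * (Num.sqrt pi ^+ N *
    expR (- (N%:R / 2 * v)) * expR (- (enorm (rV u) ^+ 2 / (4 * expR v)))) =
   (expR v)^-1 * eps * (rV u 0 j * dual_kernel (enorm (rV u)) v).
  have -> : dual_kernel (enorm (rV u)) v = 2^-1 * Num.sqrt pi ^+ N *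
      (expR (- (N%:R / 2 * v)) * expR (- (enorm (rV u) ^+ 2 / (4 * expR v)))).
    rewrite /dual_kernel /gexp -expRD; congr (_ * expR _); rewrite expRN.
    by field; rewrite gt_eqF// expR_gt0.
  by field; rewrite gt_eqF// expR_gt0.
move: (rV u 0 j * dual_kernel _ _) => K.
have e : (expR v)%:C%C * ((expR v)^-1)%:C%C = 1 :> C.
  by rewrite -rmorphM mulfV// gt_eqF// expR_gt0.
by rewrite (rmorphM _ (_ * _) K) (rmorphM _ _ eps) /=; ring: e.
Qed.

Lemma weight_sign (eps : R) x : eps ^+ 2 = 1 -> weight (eps *: x) = weight x.
Proof. by move=> e; apply: eq_bigr => j _; rewrite mxE exprMn e mul1r. Qed.

End MainIdentity.

Section RieszPair.
Variables (R : realType) (N : nat).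
Local Notation Rm := (measurableTypeR R).
Local Notation V := 'rV[R]_N.
Local Notation C := R[i].
Local Notation T := (N.-tuple Rm).
Local Notation mu := (lebesgue_tuple R N).
Local Notation rV := (@rV_of_tuple R N).
Implicit Types (x eta : V) (t : T).

(** The multiplication formula [multiplication_gauss], integrated over v: both
    x_j / |x|^2 and x_j / |x|^N are superpositions of its Gaussians. The decay of
    the transform of phi is a hypothesis because 1 / |x| is not integrable at
    infinity. *)
Lemma fourier_riesz (phi : V -> C) (B B' eps : R) j :
  (1 < N)%N -> eps ^+ 2 = 1 ->
  cmeas (fun t => phi (rV t)) -> (forall x, cabs (phi x) <= B * weight x) ->
  (forall eta, cabs (cfourier phi eta) <= B' * weight eta) ->
  cintegral (fun x => cfourier phi (eps *: x) * (x 0 j / enorm x ^+ 2)%:C%C) =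
  cintegral (fun x => 'i%C * eps%:C%C * phi x *
    (fourier_cst R N * (x 0 j / enorm x ^+ N))%:C%C).
Proof.
move=> N1 eps2 mphi phiB PhiB; have N0 : (0 < N)%N := ltnW N1.
have [i1 e1 b1] := @coord_kernel R N (fun r v => gexp 1 (r ^+ 2) v)
  (fun r => (r ^+ 2)^-1) 1 j (fun _ _ => expR_ge0 _)
  (fun r => @measurable_gexp R _ _) (@integral_gexp_sqr R)
  (fun x => ltac:(by rewrite mul1r; apply: coord_over_pow_le)).
have [] := @coord_kernel R N (dual_kernel N) (fun r => fourier_cst R N / r ^+ N)
  (fourier_cst R N) j.
- by move=> x v; rewrite /dual_kernel !mulr_ge0 ?expR_ge0 ?exprn_ge0 ?sqrtr_ge0.
- move=> r; apply: measurable_funM; first exact: measurable_cst.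
  apply: (measurableT_comp (@measurable_gexp R _ _)); exact: measurable_oppr.
- move=> r r0; under eq_integral do rewrite EFinM.
  rewrite ge0_integralZl_EFin; last 4 first.
  + by [].
  + by move=> v _; rewrite lee_fin expR_ge0.
  + apply/measurable_EFinP.
    apply: (measurableT_comp (@measurable_gexp R _ _)); exact: measurable_oppr.
  + by rewrite mulr_ge0// exprn_ge0// sqrtr_ge0.
  rewrite (integral_gexp_dual N0)// -EFinM; congr EFin.
  rewrite /fourier_cst expr_div_n exprMn; ring.
- move=> x; rewrite mulrCA ler_wpM2l ?fourier_cst_ge0//.
  by apply: coord_over_pow_le; rewrite N0 leqnn.
move=> i2 e2 b2.
rewrite (cintegral_subordination N0 _ i1 e1 b1 (B := B')); last 3 first.
- apply: measurable_funM.
    by apply: (measurableT_comp (@measurable_coord R N j));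
      exact: measurable_fst.
  have h := @measurable_gexp_joint R N 1 1 (fun x => enorm x ^+ 2)
    (measurable_funX 2 (@measurable_enorm R N)).
  by under eq_fun do rewrite -[enorm _ ^+ 2]mul1r.
- exact: cmeas_cfourier.
- by move=> x; rewrite -(weight_sign x eps2).
transitivity (cintegral (fun x => 'i%C * eps%:C%C * phi x *
   (x 0 j * (fourier_cst R N / enorm x ^+ N))%:C%C)); last first.
  by congr cintegral; apply/funext => x; rewrite mulrCA.
rewrite (cintegral_subordination N0 _ i2 e2 b2 (B := B)); last 3 first.
- apply: measurable_funM.
    by apply: (measurableT_comp (@measurable_coord R N j));
      exact: measurable_fst.
  apply: measurable_funM; first exact: measurable_cst.
  apply: (measurableT_comp (@measurable_expR R)); apply: measurable_funB.
    apply: measurable_funM; first exact: measurable_cst.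
    by apply: measurable_funN; exact: measurable_snd.
  apply: measurable_funM.
    apply: measurable_funM; last exact: measurable_cst.
    apply: (measurable_funX 2).
    by apply: (measurableT_comp (@measurable_enorm R N)); exact: measurable_fst.
  apply: (measurableT_comp (@measurable_expR R)).
  by apply: measurable_funN; exact: measurable_snd.
- apply: cmeasM => //; exact: cmeas_cst.
- move=> x; rewrite !cabsM cabs_real; have -> : `|eps| = 1.
    by apply/eqP; rewrite -sqrp_eq1// real_normK ?num_real// eps2.
  by rewrite /= expr0n expr1n add0r sqrtr1 !mul1r.
by apply: eq_cint => v; exact: (multiplication_gauss N0 j v eps2 mphi phiB).
Qed.

End RieszPair.

(** * Schwartz functions: bounds, and decay of the Fourier transform *)

Section SchwartzDecay.
Variables (R : realType) (N : nat).
Local Notation Rm := (measurableTypeR R).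
Local Notation V := 'rV[R]_N.
Local Notation C := R[i].
Local Notation mu := (lebesgue_tuple R N).
Local Notation rV := (@rV_of_tuple R N).
Implicit Types (x eta : V) (phi : V -> C).

Lemma cpartials_rcons js j phi :
  cpartials js (cpartial j phi) = cpartials (rcons js j) phi.
Proof. by rewrite /cpartials foldr_rcons. Qed.

Lemma schwartz_cpartial j phi : schwartz phi -> schwartz (cpartial j phi).
Proof.
move=> [sm bd]; split; first by move=> js x; rewrite cpartials_rcons.
move=> k; have [M hM] := bd k.+1; exists M => _ [js [x [jsk ->]]].
apply: le_trans (hM ((1 + enorm x) ^+ k.+1 *
    Normc.normc (cpartials (rcons js j) phi x)) _).
  rewrite cpartials_rcons ler_wpM2r ?cabs_ge0// exprS ler_peMl//.
    by rewrite exprn_ge0// addr_ge0// enorm_ge0.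
  by rewrite lerDl enorm_ge0.
by exists (rcons js j), x; rewrite size_rcons.
Qed.

Lemma schwartz_cmeas phi : schwartz phi -> cmeas (fun t => phi (rV t)).
Proof.
move=> [sm _]; split.
  apply: (@measurable_continuous_rV R N (fun x => complex.Re (phi x))) => x.
  by apply: differentiable_continuous; exact: (sm [::] x).1.
apply: (@measurable_continuous_rV R N (fun x => complex.Im (phi x))) => x.
by apply: differentiable_continuous; exact: (sm [::] x).2.
Qed.

Lemma schwartz_norm_ge k phi x : schwartz phi ->
  (1 + enorm x) ^+ k * cabs (phi x) <= schwartz_norm k phi.
Proof.
move=> [_ bd]; apply: ub_le_sup; first exact: bd.
by exists [::], x.
Qed.

Lemma schwartz_norm_ge0 k phi : schwartz phi -> 0 <= schwartz_norm k phi.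
Proof.
move=> sp; rewrite (le_trans _ (schwartz_norm_ge k 0 sp))//.
by rewrite mulr_ge0 ?cabs_ge0// exprn_ge0// addr_ge0// enorm_ge0.
Qed.

Lemma weightV_le x : (weight x)^-1 <= (1 + enorm x) ^+ (2 * N).
Proof.
rewrite weightV exprM -[X in _ <= _ ^+ X](card_ord N) -prodr_const.
apply: ler_prod => j _; rewrite (ltW (sqr1D_gt0 _))/=.
have := normr_coord_le x j; rewrite -(real_normK (num_real (x 0 j))).
have := normr_ge0 (x 0 j); move: (`|_|) (enorm x) => a b; rewrite !expr2 => *.
by nra.
Qed.

(** The bound is linear in a Schwartz seminorm, as temperedness requires. *)
Lemma schwartz_le_weight phi x : schwartz phi ->
  cabs (phi x) <= schwartz_norm (2 * N) phi * weight x.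
Proof.
move=> sp; have := schwartz_norm_ge (2 * N) x sp => /(le_trans _) h.
rewrite -ler_pdivrMr ?weight_gt0//; apply: h; rewrite mulrC.
by rewrite ler_wpM2r ?cabs_ge0// weightV_le.
Qed.

Lemma is_derive_line_derive (g : V -> R) j x :
  differentiable g x -> is_derive (0 : R) 1 (line g j x) ('D_(delta_mx 0 j) g x).
Proof.
move=> dg; have dv : derivable g x (delta_mx 0 j) by exact: diff_derivable.
have e : (fun h : R => h^-1 *: ((line g j x \o shift 0) (h *: 1) - line g j x 0)) =
    (fun h : R => h^-1 *: ((g \o shift x) (h *: delta_mx 0 j) - g x)).
  apply/funext => h; rewrite /line /= scale0r addr0 addr0.
  by rewrite [h *: 1]mulr1 (addrC x).
by apply: DeriveDef; rewrite /derivable /derive e.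
Qed.

(** The integral of the j-th partial derivative of phi(x) exp (i (x, eta))
    vanishes. *)
Lemma cfourier_cpartial phi j eta : schwartz phi ->
  cfourier (cpartial j phi) eta = - ('i%C * (eta 0 j)%:C%C) * cfourier phi eta.
Proof.
move=> sp; have sp' := schwartz_cpartial j sp.
have N0 : (0 < N)%N by exact: leq_ltn_trans (ltn_ord j).
have mp := schwartz_cmeas sp; have mp' := schwartz_cmeas sp'.
have me : cmeas (fun t => expi (dotv (rV t) eta)).
  by apply: cmeas_expi; exact: measurable_dotv.
pose f x := phi x * expi (dotv x eta).
pose f' x := cpartial j phi x * expi (dotv x eta).
have mf : cmeas (fun t => f (rV t)) by exact: cmeasM.
have mf' : cmeas (fun t => f' (rV t)) by exact: cmeasM.
pose B := schwartz_norm (2 * N) phi;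
  pose B' := schwartz_norm (2 * N) (cpartial j phi).
have B0 : 0 <= B by exact: schwartz_norm_ge0.
have B'0 : 0 <= B' by exact: schwartz_norm_ge0.
have fB x : cabs (f x) <= B * weight x.
  by rewrite cabsM cabs_expi mulr1; exact: schwartz_le_weight.
have f'B x : cabs (f' x) <= B' * weight x.
  by rewrite cabsM cabs_expi mulr1; exact: schwartz_le_weight.
have iF := cintble_le_weight N0 mf fB; have iF' := cintble_le_weight N0 mf' f'B.
have dRe x := is_derive_line_derive j (sp.1 [::] x).1.
have dIm x := is_derive_line_derive j (sp.1 [::] x).2.
pose D := B' + `|eta 0 j| * B.
have W0 x : 0 <= weight x := ltW (weight_gt0 x).
have bnd (z z' : R) x : `|z| <= B' * weight x -> `|z'| <= B * weight x ->
    `|z + eta 0 j * z'| <= D * weight x.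
  move=> h1 h2; apply: le_trans (ler_normD _ _) _; rewrite mulrDl lerD//.
  by rewrite normrM -mulrA ler_wpM2l.
have BD x : B * weight x <= (B + D) * weight x.
  by rewrite ler_wpM2r// lerDl addr_ge0// mulr_ge0.
have DD x : D * weight x <= (B + D) * weight x by rewrite ler_wpM2r// lerDr.
have hRe : rV_integral (fun x => complex.Re (f' x) + - eta 0 j * complex.Im (f x)) = 0.
  apply: (@integral_partial0 _ _ (fun x => complex.Re (f x)) _ j (B + D)).
  - exact: mf.1.
  - move=> x; have dc := is_derive_cos_line x eta j;
      have ds := is_derive_sin_line x eta j.
    have d1 := dRe x; have d2 := dIm x.
    rewrite (_ : line _ j x = line (fun y => complex.Re (phi y)) j x *
         line (fun y => cos (dotv y eta)) j x
       - line (fun y => complex.Im (phi y)) j x *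
         line (fun y => sin (dotv y eta)) j x); last first.
      by apply/funext => h; rewrite /line /f ReM.
    apply: is_derive_eq;
      rewrite /line scale0r !addr0 /f /f' ReM ImM /= /GRing.scale /=.
    by ring.
  - by move=> x; apply: le_trans (normr_Re_le _) _; apply: le_trans (fB x) _.
  - move=> x; rewrite mulNr -mulrN; apply: le_trans (DD x); apply: bnd.
      exact: le_trans (normr_Re_le _) (f'B x).
    by rewrite normrN; exact: le_trans (normr_Im_le _) (fB x).
have hIm : rV_integral (fun x => complex.Im (f' x) + eta 0 j * complex.Re (f x)) = 0.
  apply: (@integral_partial0 _ _ (fun x => complex.Im (f x)) _ j (B + D)).
  - exact: mf.2.
  - move=> x; have dc := is_derive_cos_line x eta j;
      have ds := is_derive_sin_line x eta j.
    have d1 := dRe x; have d2 := dIm x.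
    rewrite (_ : line _ j x = line (fun y => complex.Re (phi y)) j x *
         line (fun y => sin (dotv y eta)) j x
       + line (fun y => complex.Im (phi y)) j x *
         line (fun y => cos (dotv y eta)) j x); last first.
      by apply/funext => h; rewrite /line /f ImM.
    apply: is_derive_eq;
      rewrite /line scale0r !addr0 /f /f' ReM ImM /= /GRing.scale /=.
    by ring.
  - by move=> x; apply: le_trans (normr_Im_le _) _; apply: le_trans (fB x) _.
  - move=> x; apply: le_trans (DD x); apply: bnd.
      exact: le_trans (normr_Im_le _) (f'B x).
    exact: le_trans (normr_Re_le _) (fB x).
have split_int (g1 g2 : V -> R) (c : R) :
    mu.-integrable setT (fun t => (g1 (rV t))%:E) ->
    mu.-integrable setT (fun t => (g2 (rV t))%:E) ->
    rV_integral (fun x => g1 x + c * g2 x) = rV_integral g1 + c * rV_integral g2.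
  move=> i1 i2; rewrite /rV_integral RintegralD//;
    last exact: integrable_EFinZl.
  by rewrite RintegralZl.
rewrite split_int in hRe; [|exact: iF'.1|exact: iF.2].
rewrite split_int in hIm; [|exact: iF'.2|exact: iF.1].
rewrite /cfourier -/f -/f'; apply: complexE_ReIm; rewrite ?ReM ?ImM /=.
  by move: hRe; move: (rV_integral _) (rV_integral _) => X Y hXY; lra.
by move: hIm; move: (rV_integral _) (rV_integral _) => X Y hXY; lra.
Qed.

Lemma cabs_cfourier_cpartial phi j eta : schwartz phi ->
  cabs (cfourier (cpartial j phi) eta) = `|eta 0 j| * cabs (cfourier phi eta).
Proof.
move=> sp; rewrite cfourier_cpartial// cabsM; congr (_ * _).
by rewrite -mulNr cabsM cabs_real /= oppr0 expr0n sqrrN expr1n add0r sqrtr1 mul1r.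
Qed.

(** Each factor 1 + eta_j^2 is absorbed by two more derivatives of phi. *)
Lemma cfourier_bounded_prod phi (js : seq 'I_N) : (0 < N)%N -> schwartz phi ->
  exists M, forall eta,
    \prod_(j <- js) (1 + eta 0 j ^+ 2) * cabs (cfourier phi eta) <= M.
Proof.
move=> N0; elim: js phi => [|j js ih] phi sp.
  exists (2 * fine (\int[mu]_t (schwartz_norm (2 * N) phi * weight (rV t))%:E)%E) => eta.
  rewrite big_nil mul1r.
  have s0 := schwartz_norm_ge0 (2 * N) sp.
  apply: (@cabs_cint_le _ _ _ mu (fun t => phi (rV t) * expi (dotv (rV t) eta))
    (fun t => (schwartz_norm (2 * N) phi * weight (rV t))%:E)).
  - apply: cmeasM; first exact: schwartz_cmeas.
    by apply: cmeas_expi; exact: measurable_dotv.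
  - apply/measurable_EFinP; apply: measurable_funM; first exact: measurable_cst.
    exact: measurable_weight.
  - by move=> t; rewrite lee_fin cabsM cabs_expi mulr1 schwartz_le_weight.
  - under eq_integral do rewrite EFinM.
    rewrite ge0_integralZl_EFin//.
    + by apply: lte_mul_pinfty => //; exact: integral_weight.
    + by move=> t _; rewrite lee_fin ltW// weight_gt0.
    + by apply/measurable_EFinP; exact: measurable_weight.
have [M1 h1] := ih _ sp.
have [M2 h2] := ih _ (schwartz_cpartial j (schwartz_cpartial j sp)).
exists (M1 + M2) => eta; rewrite big_cons.
have := h1 eta; have := h2 eta.
rewrite !cabs_cfourier_cpartial//; last exact: schwartz_cpartial.
rewrite mulrA -expr2 real_normK ?num_real// => h4 h3.
apply: le_trans (lerD h3 h4); rewrite le_eqVlt; apply/orP; left; apply/eqP.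
by ring.
Qed.

Lemma cfourier_le_weight phi : (0 < N)%N -> schwartz phi ->
  exists M, forall eta, cabs (cfourier phi eta) <= M * weight eta.
Proof.
move=> N0 sp; have [M hM] := cfourier_bounded_prod (index_enum 'I_N) N0 sp.
exists M => eta; rewrite -ler_pdivrMr ?weight_gt0// mulrC weightV.
exact: hM.
Qed.

End SchwartzDecay.

(** * Functions with an integrable singularity are tempered *)

Section TemperedFunctions.
Variables (R : realType) (N n : nat).
Local Notation Rm := (measurableTypeR R).
Local Notation V := 'rV[R]_N.
Local Notation C := R[i].
Local Notation Cl := (clifford C n).
Local Notation mu := (lebesgue_tuple R N).
Local Notation rV := (@rV_of_tuple R N).
Implicit Types (x v : V) (phi psi : V -> C) (f : V -> Cl).

Hypothesis N0 : (0 < N)%N.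

Lemma measurable_sing_shift v : measurable_fun setT (fun t => sing (rV t - v)).
Proof. exact: (measurable_rV_shift (- v) (@measurable_sing R N)). Qed.

Lemma measurable_weight_sing_shift v :
  measurable_fun setT (fun t => weight (rV t) * sing (rV t - v)).
Proof.
by apply: measurable_funM;
  [exact: measurable_weight|exact: measurable_sing_shift].
Qed.

(** Translating by v moves the shift from [sing] to [weight], where it costs a
    constant by [weight_shift]. *)
Lemma integral_weight_sing_shift v :
  (\int[mu]_t (weight (rV t) * sing (rV t - v))%:E < +oo)%E.
Proof.
pose c : R := \prod_j (2 * (1 + (- v) 0 j ^+ 2)).
have c0 : 0 <= c by apply: prodr_ge0 => j _; rewrite mulr_ge0// ltW// sqr1D_gt0.
have mWs : measurable_fun setT (fun t => (weight (rV t) * sing (rV t))%:E).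
  apply/measurable_EFinP; apply: measurable_funM;
    first exact: measurable_weight.
  exact: measurable_sing.
have Ws0 t : (0 <= (weight (rV t) * sing (rV t))%:E)%E.
  by rewrite lee_fin mulr_ge0 ?weight_ge0// ltW// sing_gt0.
pose g t := (weight (rV t) * sing (rV t))%:E.
pose sh (t : N.-tuple Rm) := tuple_shift (fun j => (- v) 0 j) t.
have msh : measurable_fun setT (g \o sh).
  by apply: (measurableT_comp mWs); exact: measurable_tuple_shift.
have le : (\int[mu]_t (weight (rV t) * sing (rV t - v))%:E <=
    c%:E * \int[mu]_t (g \o sh) t)%E.
  rewrite -ge0_integralZl_EFin//.
  apply: ge0_le_integral => //.
  - by move=> t _; rewrite lee_fin mulr_ge0 ?weight_ge0// ltW// sing_gt0.
  - by apply/measurable_EFinP; exact: measurable_weight_sing_shift.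
  - by apply: emeasurable_funM => //; exact: measurable_cst.
  - move=> t _; rewrite /g /sh /= rV_tuple_shift lee_fin mulrA.
    by rewrite ler_wpM2r ?(ltW (sing_gt0 _))//; exact: weight_shift.
  by move=> t _; exact: Ws0.
apply: le_lt_trans le _; rewrite /= (ge0_integral_tuple_shift _ (g := g))//.
by apply: lte_mul_pinfty => //; exact: integral_weight_sing.
Qed.

(** The test function is only assumed to be bounded by [weight], so that the
    lemma also applies to Fourier transforms of Schwartz functions. *)
Lemma cintble_weight_sing phi (g : V -> C) (B K : R) v :
  cmeas (fun t => phi (rV t)) -> (forall x, cabs (phi x) <= B * weight x) ->
  cmeas (fun t => g (rV t)) -> (forall x, cabs (g x) <= K * sing (x - v)) ->
  cintble mu (fun t => phi (rV t) * g (rV t)) /\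
  cabs (cintegral (fun x => phi x * g x)) <=
    2 * K * fine (\int[mu]_t (weight (rV t) * sing (rV t - v))%:E) * B.
Proof.
move=> mphi phiB mg gK.
have s0 := bound_ge0 phiB.
have K0 : 0 <= K.
  rewrite -(pmulr_lge0 K (sing_gt0 (0 - v))) (le_trans _ (gK 0))//.
  exact: cabs_ge0.
pose G t := (B * K * (weight (rV t) * sing (rV t - v)))%:E.
have mG : measurable_fun setT G.
  apply/measurable_EFinP; apply: measurable_funM; first exact: measurable_cst.
  exact: measurable_weight_sing_shift.
have fG t : ((cabs (phi (rV t) * g (rV t)))%:E <= G t)%E.
  rewrite lee_fin cabsM mulrACA; apply: ler_pM; rewrite ?cabs_ge0//.
have eG : (\int[mu]_t G t = (B * K)%:E *
   \int[mu]_t (weight (rV t) * sing (rV t - v))%:E)%E.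
  rewrite -ge0_integralZl_EFin//.
  - by move=> t _; rewrite lee_fin mulr_ge0 ?weight_ge0// ltW// sing_gt0.
  - by apply/measurable_EFinP; exact: measurable_weight_sing_shift.
  - by rewrite mulr_ge0.
have i0 : (0 <= \int[mu]_t (weight (rV t) * sing (rV t - v))%:E)%E.
  by apply: integral_ge0 => t _;
    rewrite lee_fin mulr_ge0 ?weight_ge0// ltW// sing_gt0.
have finG : (\int[mu]_t G t < +oo)%E.
  rewrite eG; apply: lte_mul_pinfty; rewrite ?lee_fin ?mulr_ge0//.
  exact: integral_weight_sing_shift.
split.
  apply: cintble_dominated mG fG finG; exact: cmeasM.
apply: le_trans (cabs_cint_le (cmeasM mphi mg) mG fG finG) _.
rewrite eG fineM//; last by rewrite ge0_fin_numE ?integral_weight_sing_shift.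
by rewrite /= le_eqVlt; apply/orP; left; apply/eqP; ring.
Qed.

Lemma cintble_schwartz_sing phi (g : V -> C) (K : R) v : schwartz phi ->
  cmeas (fun t => g (rV t)) -> (forall x, cabs (g x) <= K * sing (x - v)) ->
  cintble mu (fun t => phi (rV t) * g (rV t)) /\
  cabs (cintegral (fun x => phi x * g x)) <=
    2 * K * fine (\int[mu]_t (weight (rV t) * sing (rV t - v))%:E) *
    schwartz_norm (2 * N) phi.
Proof.
move=> sp; apply: cintble_weight_sing; first exact: schwartz_cmeas.
by move=> x; exact: schwartz_le_weight.
Qed.

Lemma clZE (c : C) (a : Cl) A : (c *: a) A = c * a A.
Proof. by rewrite ffunE. Qed.

Lemma clDE (a b : Cl) A : (a + b) A = a A + b A.
Proof. by rewrite ffunE. Qed.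

Lemma cl_sumE (I : Type) (r : seq I) (F : I -> Cl) A :
  (\sum_(i <- r) F i) A = \sum_(i <- r) F i A.
Proof.
elim: r => [|i r ih]; first by rewrite !big_nil ffunE.
by rewrite !big_cons clDE ih.
Qed.

Lemma regular_distE f phi A :
  regular_dist f phi A = cintegral (fun x => phi x * f x A).
Proof. by rewrite ffunE; congr cintegral; apply/funext => x; rewrite clZE. Qed.

(** On the ball of radius r the factor [weight] is bounded below, which gives
    local integrability; the rest is [cintble_schwartz_sing]. *)
Lemma tempered_fun_sing f (K : R) v :
  (forall A, cmeas (fun t => f (rV t) A)) ->
  (forall x A, cabs (f x A) <= K * sing (x - v)) -> tempered_fun f.
Proof.
move=> mf fK; split.
- move=> r A.
  have [r0|r0] := ltP r 0.
    rewrite /cintegrable /rV_integrable (_ : _ @^-1` _ = set0).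
      by split; exact: integrable_set0.
    apply/seteqP; split => // t /= h.
    by have := le_lt_trans h r0; rewrite ltNge enorm_ge0.
  have mD : measurable ((@rV_of_tuple R N) @^-1` [set x | enorm x <= r]).
    rewrite [X in measurable X](_ : _ = setT `&` (fun t => enorm (rV t)) @^-1` `]-oo, r]).
      exact: (@measurable_enorm R N).
    by apply/seteqP; split=> [t /= h|t [_ /=]]; rewrite ?in_itv/=.
  pose G t := (K * (1 + r) ^+ (2 * N) * (weight (rV t) * sing (rV t - v)))%:E.
  have K0 : 0 <= K.
    rewrite -(pmulr_lge0 K (sing_gt0 (0 - v))) (le_trans _ (fK 0 A))//.
    exact: cabs_ge0.
  have Kr0 : 0 <= K * (1 + r) ^+ (2 * N) by rewrite mulr_ge0// exprn_ge0// addr_ge0.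
  have Ws0 t : 0 <= weight (rV t) * sing (rV t - v).
    by rewrite mulr_ge0 ?weight_ge0// ltW// sing_gt0.
  have iG : mu.-integrable setT G.
    apply: integrable_EFinZl; apply/integrableP; split.
      by apply/measurable_EFinP; exact: measurable_weight_sing_shift.
    under eq_integral do rewrite gee0_abs ?lee_fin//.
    exact: integral_weight_sing_shift.
  have bound t : enorm (rV t) <= r -> cabs (f (rV t) A) <=
      K * (1 + r) ^+ (2 * N) * (weight (rV t) * sing (rV t - v)).
    move=> h; apply: le_trans (fK _ _) _;
      rewrite mulrA ler_wpM2r ?(ltW (sing_gt0 _))//.
    rewrite -mulrA ler_peMr// -ler_pdivrMr ?weight_gt0// mul1r.
    apply: le_trans (weightV_le _) _; apply: lerXn2r;
      rewrite ?nnegrE ?addr_ge0 ?enorm_ge0//.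
    by rewrite lerD2l.
  split; apply: (@le_integrable _ _ _ _ _ mD _ G) => //.
  + by apply/measurable_EFinP/measurable_funTS; exact: (mf A).1.
  + move=> t /= h; rewrite lee_fin (ger0_norm (mulr_ge0 Kr0 (Ws0 t))).
    exact: le_trans (normr_Re_le _) (bound t h).
  + exact: integrableS iG.
  + by apply/measurable_EFinP/measurable_funTS; exact: (mf A).2.
  + move=> t /= h; rewrite lee_fin (ger0_norm (mulr_ge0 Kr0 (Ws0 t))).
    exact: le_trans (normr_Im_le _) (bound t h).
  + exact: integrableS iG.
- move=> phi sp A.
  have [[i1 i2] _] := cintble_schwartz_sing sp (mf A) (fun x => fK x A).
  rewrite /cintegrable /rV_integrable preimage_setT.
  by split; under eq_fun do rewrite clZE.
- split.
    move=> c phi psi sp sq; apply/ffunP => A; rewrite clDE clZE !regular_distE.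
    have [i1 _] := cintble_schwartz_sing sp (mf A) (fun x => fK x A).
    have [i2 _] := cintble_schwartz_sing sq (mf A) (fun x => fK x A).
    transitivity (cint mu (fun t => c * (phi (rV t) * f (rV t) A) + psi (rV t) * f (rV t) A)).
      by apply: eq_cint => t; rewrite mulrDl mulrA.
    by rewrite cintD//; [rewrite cintZ|exact: cintbleZ].
  exists (2 * N)%N, (2 * K * fine (\int[mu]_t (weight (rV t) * sing (rV t - v))%:E)).
  move=> phi sp A; rewrite regular_distE.
  exact: (cintble_schwartz_sing sp (mf A) (fun x => fK x A)).2.
Qed.

(** ** Combinations of scalar functions with Clifford coefficients *)

Section Combination.
Variables (I : finType) (h : I -> V -> C) (b : I -> Cl) (K : R) (v : V).
Hypothesis mh : forall i, cmeas (fun t => h i (rV t)).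
Hypothesis hK : forall i x, cabs (h i x) <= K * sing (x - v).

Definition cl_comb x : Cl := \sum_i h i x *: b i.

Lemma cl_combE x A : cl_comb x A = \sum_i h i x * b i A.
Proof. by rewrite cl_sumE; apply: eq_bigr => i _; rewrite clZE. Qed.

Lemma cabs_sum (r : seq I) (F : I -> C) :
  cabs (\sum_(i <- r) F i) <= \sum_(i <- r) cabs (F i).
Proof.
elim: r => [|i r ih]; first by rewrite !big_nil /= expr0n addr0 sqrtr0.
by rewrite !big_cons; apply: le_trans (cabsD _ _) _; rewrite lerD2l.
Qed.

Lemma tempered_cl_comb : tempered_fun cl_comb.
Proof.
pose K' := K * \sum_i \sum_A cabs (b i A).
apply: (@tempered_fun_sing cl_comb K' v) => [A|x A].
  under eq_fun do rewrite cl_combE.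
  by apply: cmeas_sum => i; apply: cmeasM => //; exact: cmeas_cst.
rewrite cl_combE; apply: le_trans (cabs_sum _ _) _.
rewrite /K' mulrAC mulr_sumr; apply: ler_sum => i _; rewrite cabsM.
apply: ler_pM; rewrite ?cabs_ge0//.
by rewrite (bigD1 A)//= lerDl sumr_ge0// => A' _; exact: cabs_ge0.
Qed.

Lemma regular_dist_cl_comb phi (B : R) : cmeas (fun t => phi (rV t)) ->
  (forall x, cabs (phi x) <= B * weight x) ->
  regular_dist cl_comb phi = \sum_i cintegral (fun x => phi x * h i x) *: b i.
Proof.
move=> mphi phiB; apply/ffunP => A; rewrite regular_distE cl_sumE.
have ih i := (cintble_weight_sing mphi phiB (mh i) (hK i)).1.
transitivity (cint mu (fun t => \sum_i b i A * (phi (rV t) * h i (rV t)))).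
  apply: eq_cint => t; rewrite cl_combE mulr_sumr; apply: eq_bigr => i _; ring.
rewrite cint_sum; last by move=> i; apply: cintbleZ.
by apply: eq_bigr => i _; rewrite clZE mulrC cintZ.
Qed.

End Combination.

End TemperedFunctions.

(** * The Cauchy kernel in coordinates *)

Section KernelCoordinates.
Variables (R : realType) (n : nat).
Local Notation V := 'rV[R]_n.+1.
Local Notation C := R[i].
Local Notation Cl := (clifford C n).
Implicit Types (s : R) (x v : V).

Definition center s : V := s *: delta_mx 0 0.

(** Since s - conj x = - (x_0 - s) + vector part of x, the coordinate of index 0
    has coefficient -1. *)
Definition cl_coef (j : 'I_n.+1) : Cl :=
  if unlift ord0 j is Some l then cl_e C l else -1.

Lemma center0 s : center s 0 0 = s.
Proof. by rewrite !mxE !eqxx mulr1. Qed.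

Lemma centerS s (l : 'I_n) : center s 0 (lift ord0 l) = 0.
Proof. by rewrite !mxE /= mulr0. Qed.

Lemma rowB x v j : (x - v) 0 j = x 0 j - v 0 j.
Proof. by rewrite !mxE. Qed.

Lemma cl_realB (a b : R) : cl_real n (a - b) = cl_real n a - cl_real n b.
Proof. by rewrite /cl_real rmorphB scalerBl. Qed.

Lemma paravector_coord s x :
  cl_real n s - paravector_conj x =
  \sum_j ((x - center s) 0 j)%:C%C *: cl_coef j.
Proof.
rewrite big_ord_recl /cl_coef unlift_none.
under eq_bigr => l _ do rewrite liftK rowB centerS subr0.
rewrite /paravector_conj opprB addrCA addrC; congr (_ + _).
by rewrite -cl_realB rowB center0 scalerN -scaleNr -rmorphN opprB.
Qed.

Lemma quadE s x : quad s x = enorm (x - center s) ^+ 2.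
Proof.
rewrite /quad !sqr_enorm !big_ord_recl /= rowB center0.
under [in RHS]eq_bigr do rewrite rowB centerS subr0.
by rewrite /=; ring.
Qed.

Definition kern (k : nat) (j : 'I_n.+1) x : C := (x 0 j / enorm x ^+ k)%:C%C.

Lemma mul_cl_real (a : Cl) (r : R) : a * cl_real n r = r%:C%C *: a.
Proof. by rewrite /cl_real -scalerAr mulr1. Qed.

Lemma S_invE s : S_inv s = cl_comb (fun j x => kern 2 j (x - center s)) cl_coef.
Proof.
apply/funext => x; rewrite /S_inv mul_cl_real paravector_coord scaler_sumr.
apply: eq_bigr => j _; rewrite scalerA -rmorphM quadE /kern; congr (_ *: _).
by rewrite mulrC.
Qed.

(** True also for r = 0, where both sides are 0 by convention. *)
Lemma sqr_powR_half (r : R) (m : nat) : 0 <= r -> (0 < m)%N ->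
  (r ^+ 2) `^ (- (m%:R / 2)) = (r ^+ m)^-1.
Proof.
rewrite le_eqVlt => /orP[/eqP <- m0|r0 m0].
  rewrite [0 ^+ 2]expr0n powR0; first by rewrite expr0n gtn_eqF// invr0.
  by rewrite oppr_eq0 mulf_neq0 ?invr_eq0 ?pnatr_eq0// -lt0n.
rewrite /powR gt_eqF ?exprn_gt0// lnXn// -[in RHS](lnK r0) -expRM_natl -expRN.
by congr expR; rewrite -mulr_natl; field.
Qed.

Lemma F_kernelE s : F_kernel s =
  cl_comb (fun j x => gamma_const R n * kern n.+1 j (x - center s)) cl_coef.
Proof.
apply/funext => x; rewrite /F_kernel mul_cl_real paravector_coord 2!scaler_sumr.
apply: eq_bigr => j _; rewrite 2!scalerA -mulrA -rmorphM quadE /kern.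
by rewrite sqr_powR_half ?enorm_ge0// [_^-1 * _]mulrC.
Qed.

End KernelCoordinates.

(** * The even case *)

Section EvenDimension.
Variables (R : realType) (n : nat) (s : R).
Local Notation N := n.+1.
Local Notation V := 'rV[R]_N.
Local Notation C := R[i].
Local Notation mu := (lebesgue_tuple R N).
Local Notation rV := (@rV_of_tuple R N).
Implicit Types (x xi eta : V) (phi psi : V -> C).

Hypothesis n0 : (0 < n)%N.

Let N0 : (0 < N)%N. Proof. by []. Qed.
Let N1 : (1 < N)%N. Proof. by []. Qed.
Let v : V := center n s.

Lemma cmeas_shift (f : V -> C) w : cmeas (fun t => f (rV t)) ->
  cmeas (fun t => f (rV t + w)).
Proof.
move=> [m1 m2]; split.
  exact: (@measurable_rV_shift _ _ (fun x => complex.Re (f x)) w m1).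
exact: (@measurable_rV_shift _ _ (fun x => complex.Im (f x)) w m2).
Qed.

Lemma cintegral_shift (f : V -> C) w : cmeas (fun t => f (rV t)) ->
  cintegral (fun x => f (x + w)) = cintegral f.
Proof.
move=> [m1 m2]; rewrite /cintegral.
rewrite (@rV_integral_shift _ _ (fun x => complex.Re (f x)) w m1).
by rewrite (@rV_integral_shift _ _ (fun x => complex.Im (f x)) w m2).
Qed.

Lemma cmeas_kern k (j : 'I_N) : cmeas (fun t => kern k j (rV t)).
Proof.
apply: cmeas_real; apply: measurable_funM; first exact: measurable_coord.
apply: measurable_inv => [|t]; last by rewrite exprn_ge0// enorm_ge0.
exact: (measurable_funX k (@measurable_enorm R N)).
Qed.

Lemma cabs_kern k (j : 'I_N) x : (0 < k <= N)%N -> cabs (kern k j x) <= sing x.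
Proof.
move=> kN; rewrite cabs_real normf_div (ger0_norm (exprn_ge0 _ (enorm_ge0 _))).
exact: coord_over_pow_le.
Qed.

Definition modulation eta (phi : V -> C) : V -> C :=
  fun x => phi x * expi (- dotv x eta).

Lemma dotvDl x xi eta : dotv (x + xi) eta = dotv x eta + dotv xi eta.
Proof.
by rewrite /dotv -big_split; apply: eq_bigr => j _ /=; rewrite mxE mulrDl.
Qed.

Lemma dotvC x eta : dotv x eta = dotv eta x.
Proof. by apply: eq_bigr => j _; rewrite mulrC. Qed.

Lemma dotvNl x eta : dotv (- x) eta = - dotv x eta.
Proof. by rewrite /dotv -sumrN; apply: eq_bigr => j _; rewrite mxE mulNr. Qed.

Lemma dotvDr x xi eta : dotv x (xi + eta) = dotv x xi + dotv x eta.
Proof. by rewrite dotvC dotvDl !(dotvC x). Qed.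

Lemma dotvNr x eta : dotv x (- eta) = - dotv x eta.
Proof. by rewrite dotvC dotvNl dotvC. Qed.

Lemma fourierE phi xi : fourier phi xi = cfourier phi (- xi).
Proof.
by congr cintegral; apply/funext => x; rewrite dotvNr.
Qed.

(** Modulating a test function translates its Fourier transform: this is how the
    shift by s in the kernel is removed. *)
Lemma cfourier_modulation phi eta xi :
  cfourier (modulation eta phi) xi = cfourier phi (xi - eta).
Proof.
congr cintegral; apply/funext => x; rewrite /modulation -mulrA -expiD.
by rewrite dotvDr dotvNr addrC.
Qed.

Lemma cmeas_modulation phi eta : cmeas (fun t => phi (rV t)) ->
  cmeas (fun t => modulation eta phi (rV t)).
Proof.
move=> mphi; apply: cmeasM => //; apply: cmeas_expi; apply: measurable_funN.
exact: measurable_dotv.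
Qed.

Lemma cabs_modulation phi eta x : cabs (modulation eta phi x) = cabs (phi x).
Proof. by rewrite cabsM cabs_expi mulr1. Qed.

Lemma weight_shift_bound (f : V -> C) (B : R) w :
  (forall x, cabs (f x) <= B * weight x) ->
  exists B', forall x, cabs (f (x + w)) <= B' * weight x.
Proof.
move=> fB; have B0 := bound_ge0 fB.
exists (B * \prod_j (2 * (1 + (- w) 0 j ^+ 2))) => x.
apply: le_trans (fB _) _; rewrite -mulrA ler_wpM2l//.
by have := weight_shift (- w) (x + w); rewrite addrK.
Qed.

Lemma cfourier_shift phi xi : cmeas (fun t => phi (rV t)) ->
  cintble mu (fun t => phi (rV t) * expi (dotv (rV t) xi)) ->
  cfourier (fun x => phi (x + v)) xi = expi (- dotv v xi) * cfourier phi xi.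
Proof.
move=> mphi iphi; rewrite /cfourier -cintZ//.
pose G x := expi (- dotv v xi) * (phi x * expi (dotv x xi)).
transitivity (cintegral (fun x => G (x + v))).
  congr cintegral; apply/funext => x; rewrite /G mulrCA -expiD.
  by rewrite dotvDl addrCA addNr addr0.
apply: cintegral_shift; apply: cmeasM; first exact: cmeas_cst.
by apply: cmeasM => //; apply: cmeas_expi; exact: measurable_dotv.
Qed.

Definition fourier_cst_n := fourier_cst R N.

(** The Fourier transform of (x - s)_j / |x - s|^2, by [fourier_S_coord]. *)
Definition S_inv_hat (j : 'I_N) xi : C :=
  - 'i%C * (fourier_cst_n)%:C%C * expi (- dotv xi v) * kern N j xi.

(** [fourier_riesz] with eps = -1, for phi modulated so that its transform is
    translated by s. *)
Lemma fourier_S_coord phi j : schwartz phi ->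
  cintegral (fun x => fourier phi x * kern 2 j (x - v)) =
  cintegral (fun xi => phi xi * S_inv_hat j xi).
Proof.
move=> sp.
have mphi := schwartz_cmeas sp.
have phiB := fun x => schwartz_le_weight x sp.
have [M hM] := cfourier_le_weight N0 sp.
pose psi := modulation v phi.
have mpsi : cmeas (fun t => psi (rV t)) by exact: cmeas_modulation.
have psiB x : cabs (psi x) <= schwartz_norm (2 * N) phi * weight x.
  by rewrite cabs_modulation; exact: schwartz_le_weight.
have [M' hM'] : exists M', forall xi, cabs (cfourier psi xi) <= M' * weight xi.
  have [M' hM'] := weight_shift_bound (- v) hM; exists M' => xi.
  by rewrite cfourier_modulation.
pose G x := fourier phi x * kern 2 j (x - v).
have mG : cmeas (fun t => G (rV t)).
  apply: cmeasM; last first.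
    exact: (cmeas_shift (f := kern 2 j) (- v) (cmeas_kern 2 j)).
  have := cmeas_cfourier (-1) mphi.
  by under [X in cmeas X -> _]eq_fun do rewrite scaleN1r -fourierE.
rewrite -(cintegral_shift v mG).
transitivity (cintegral (fun x => cfourier psi (-1 *: x) * (x 0 j / enorm x ^+ 2)%:C%C)).
  congr cintegral; apply/funext => x;
    rewrite /G addrK fourierE cfourier_modulation.
  by rewrite scaleN1r opprD.
rewrite (fourier_riesz j N1 _ mpsi psiB hM'); last by rewrite sqrrN expr1n.
congr cintegral; apply/funext => xi; rewrite /S_inv_hat /psi /modulation /kern.
rewrite -/fourier_cst_n (rmorphM _ fourier_cst_n) rmorphN rmorph1.
by ring.
Qed.

Definition symbol xi : C := ('i%C * (enorm xi)%:C%C) ^+ n.-1.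

Definition symbol_S_inv_hat (j : 'I_N) xi : C := symbol xi * S_inv_hat j xi.

(** At xi = 0 both kernels vanish, whatever value the powers of 0 take. *)
Lemma symbol_S_inv_hatE j xi : symbol_S_inv_hat j xi =
  'i%C ^+ n.-1 * - 'i%C * (fourier_cst_n)%:C%C * expi (- dotv xi v) * kern 2 j xi.
Proof.
rewrite /symbol_S_inv_hat /symbol /S_inv_hat exprMn.
have -> : kern 2 j xi = (enorm xi)%:C%C ^+ n.-1 * kern N j xi.
  rewrite /kern -rmorphXn -rmorphM; congr (_%:C)%C.
  have [->|x0] := eqVneq xi 0; first by rewrite mxE !mul0r mulr0.
  have e0 : enorm xi != 0 by rewrite enorm_eq0.
  have -> : enorm xi ^+ n.+1 = enorm xi ^+ n.-1 * enorm xi ^+ 2.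
    by rewrite -exprD addn2 prednK.
  by field; rewrite e0 expf_neq0.
by ring.
Qed.

Lemma cabs_i : cabs ('i%C : C) = 1.
Proof. by rewrite /= expr0n expr1n add0r sqrtr1. Qed.

Lemma cabsX (z : C) k : cabs (z ^+ k) = cabs z ^+ k.
Proof.
elim: k => [|k ih]; first by rewrite !expr0 /= expr1n expr0n addr0 sqrtr1.
by rewrite !exprS cabsM ih.
Qed.

Lemma cabsN (z : C) : cabs (- z) = cabs z.
Proof. exact: normcN. Qed.

Lemma cabs_S_inv_hat j xi : cabs (S_inv_hat j xi) <= fourier_cst_n * sing (xi - 0).
Proof.
rewrite subr0 /S_inv_hat !cabsM cabs_expi cabsN cabs_i mulr1 mul1r cabs_real.
have c0 : 0 <= fourier_cst_n := fourier_cst_ge0 R N.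
by rewrite ger0_norm// ler_wpM2l// cabs_kern// ltnS leqnn.
Qed.

Lemma cabs_symbol_S_inv_hat j xi :
  cabs (symbol_S_inv_hat j xi) <= fourier_cst_n * sing (xi - 0).
Proof.
rewrite subr0 symbol_S_inv_hatE !cabsM cabs_expi cabsN cabsX cabs_i
  expr1n mulr1 !mul1r cabs_real.
have c0 : 0 <= fourier_cst_n := fourier_cst_ge0 R N.
by rewrite ger0_norm// ler_wpM2l// cabs_kern.
Qed.

Lemma cmeas_phase : cmeas (fun t => expi (- dotv (rV t) v)).
Proof. by apply: cmeas_expi; apply: measurable_funN;
  exact: measurable_dotv. Qed.

Lemma cmeas_S_inv_hat j : cmeas (fun t => S_inv_hat j (rV t)).
Proof.
apply: cmeasM; last exact: cmeas_kern.
by apply: cmeasM; [exact: cmeas_cst|exact: cmeas_phase].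
Qed.

Lemma cmeas_symbol_S_inv_hat j : cmeas (fun t => symbol_S_inv_hat j (rV t)).
Proof.
under eq_fun do rewrite symbol_S_inv_hatE.
apply: cmeasM; last exact: cmeas_kern.
by apply: cmeasM; [exact: cmeas_cst|exact: cmeas_phase].
Qed.

Lemma inv_fourierE phi x :
  inv_fourier phi x = (((2 * pi) ^+ N)^-1)%:C%C * cfourier phi x.
Proof. by congr (_ * cintegral _); apply/funext => xi; rewrite dotvC. Qed.

Lemma cmeas_inv_fourier phi : schwartz phi ->
  cmeas (fun t => inv_fourier phi (rV t)).
Proof.
move=> sp; under eq_fun do rewrite inv_fourierE.
apply: cmeasM; first exact: cmeas_cst.
have := cmeas_cfourier 1 (schwartz_cmeas sp).
by under [X in cmeas X -> _]eq_fun do rewrite scale1r.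
Qed.

(** Each application of [fourier_riesz] contributes a factor [fourier_cst], and
    the inverse transform the power of 2 pi. *)
Lemma gamma_fourier_cst : gamma_const R n =
  'i%C ^+ n.-1 * (((2 * pi) ^+ N)^-1 * fourier_cst_n ^+ 2)%:C%C.
Proof.
rewrite /gamma_const; congr (_ * (_)%:C)%C.
have pi0 : (pi : R) != 0 by rewrite gt_eqF// pi_gt0.
rewrite /fourier_cst_n /fourier_cst !exprMn -!exprM [(N * 2)%N]mulnC !exprM.
rewrite sqr_sqrtr ?pi_ge0// -[in N%:R / 2]/(n.+1%:R / 2).
have -> : (2 : R) ^+ 2 ^+ N = 2 ^+ N * 2 ^+ N by rewrite -exprM mulnC exprM expr2.
have -> : (2 : R) ^+ N = 4 * 2 ^+ n.-1.
  by rewrite -{1}(prednK n0) !exprS mulrA -natrM.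
by field; rewrite !expf_neq0.
Qed.

(** [fourier_riesz] with eps = 1, for phi translated by s, which cancels the
    phase in [S_inv_hat]. *)
Lemma inv_fourier_S_coord phi j : schwartz phi ->
  cintegral (fun x => phi x * (gamma_const R n * kern N j (x - v))) =
  cintegral (fun xi => inv_fourier phi xi * symbol_S_inv_hat j xi).
Proof.
move=> sp.
have mphi := schwartz_cmeas sp.
have phiB := fun x => schwartz_le_weight x sp.
have [M hM] := cfourier_le_weight N0 sp.
pose psi x := phi (x + v).
have mpsi : cmeas (fun t => psi (rV t)) by exact: cmeas_shift.
have [B psiB] : exists B, forall x, cabs (psi x) <= B * weight x.
  exact: weight_shift_bound phiB.
have psiE xi : cfourier psi xi = expi (- dotv v xi) * cfourier phi xi.
  apply: cfourier_shift => //.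
  apply: (cintble_le_weight N0 (phi := fun x => phi x * expi (dotv x xi))).
    apply: cmeasM => //; apply: cmeas_expi; exact: measurable_dotv.
  by move=> x; rewrite cabsM cabs_expi mulr1; exact: phiB.
have psiF xi : cabs (cfourier psi xi) <= M * weight xi.
  by rewrite psiE cabsM cabs_expi mul1r.
pose G x := phi x * kern N j (x - v).
have mG : cmeas (fun t => G (rV t)).
  by apply: cmeasM => //;
    exact: (cmeas_shift (f := kern N j) (- v) (cmeas_kern N j)).
have iG : cintble mu (fun t => G (rV t)).
  apply: (cintble_weight_sing N0 (g := fun x => kern N j (x - v)) (K := 1) (v := v)
     mphi phiB _ _).1.
    exact: (cmeas_shift (f := kern N j) (- v) (cmeas_kern N j)).
  by move=> x; rewrite mul1r cabs_kern// ltnS leqnn.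
pose k : C := (((2 * pi) ^+ N)^-1)%:C%C * ('i%C ^+ n.-1 * - 'i%C * (fourier_cst_n)%:C%C).
have kern2_sing x : cabs (kern 2 j x) <= 1 * sing (x - 0).
  by rewrite mul1r subr0 cabs_kern.
have i2 : cintble mu (fun t => cfourier psi (1 *: rV t) * kern 2 j (rV t)).
  apply: (cintble_weight_sing N0 (phi := fun x => cfourier psi (1 *: x)) (B := M) (v := 0)
    _ _ (cmeas_kern 2 j) kern2_sing).1; first exact: cmeas_cfourier.
  by move=> x; rewrite scale1r.
transitivity (cint mu (fun t => k * (cfourier psi (1 *: rV t) * kern 2 j (rV t)))); last first.
  apply: eq_cint => t;
    rewrite scale1r psiE inv_fourierE symbol_S_inv_hatE /k dotvC.
  by ring.
rewrite cintZ// -/(cintegral _).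
have -> : cint mu (fun t => cfourier psi (1 *: rV t) * kern 2 j (rV t)) =
  cintegral (fun x => 'i%C * 1%:C%C * psi x * (fourier_cst R N * (x 0 j / enorm x ^+ N))%:C%C).
  by rewrite -(fourier_riesz j N1 (expr1n _ _) mpsi psiB psiF).
transitivity (cint mu (fun t => gamma_const R n * G (rV t))).
  by apply: eq_cint => t; rewrite /G; ring.
rewrite cintZ// -[cint _ _]/(cintegral G) -(cintegral_shift v mG).
have kernN_sing x : cabs (kern N j x) <= 1 * sing (x - 0).
  by rewrite mul1r subr0 cabs_kern// ltnS leqnn.
have ipsi : cintble mu (fun t => psi (rV t) * kern N j (rV t)).
  exact: (cintble_weight_sing N0 mpsi psiB (cmeas_kern N j) kernN_sing).1.
transitivity (k * ('i%C * (fourier_cst_n)%:C%C * cintegral (fun x => G (x + v)))).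
  rewrite gamma_fourier_cst /k rmorphM rmorphXn /=.
  have ii : 'i%C * 'i%C = -1 :> C by rewrite -expr2 sqr_i.
  by ring: ii.
congr (k * _).
have -> : (fun x => G (x + v)) = (fun x => psi x * kern N j x).
  by apply/funext => x; rewrite /G addrK.
rewrite -cintZ//; apply: eq_cint => t; rewrite /kern -/fourier_cst_n.
by rewrite (rmorphM _ fourier_cst_n) mulr1; ring.
Qed.

(** The Fourier transform of the kernel is the combination of the [S_inv_hat j]
    with the same Clifford coefficients. *)
Lemma frac_laplacian_S_inv :
  [/\ tempered_fun (@S_inv R n s), tempered_fun (@F_kernel R n s) &
      frac_laplacian n.-1 (regular_dist (@S_inv R n s))
                          (regular_dist (@F_kernel R n s))].
Proof.
pose c : C := gamma_const R n.
have mS j : cmeas (fun t => kern 2 j (rV t - v)).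
  exact: (cmeas_shift (f := kern 2 j) (- v) (cmeas_kern 2 j)).
have kS j x : cabs (kern 2 j (x - v)) <= 1 * sing (x - v).
  by rewrite mul1r cabs_kern.
have mF j : cmeas (fun t => c * kern N j (rV t - v)).
  apply: cmeasM; first exact: cmeas_cst.
  exact: (cmeas_shift (f := kern N j) (- v) (cmeas_kern N j)).
have kF j x : cabs (c * kern N j (x - v)) <= cabs c * sing (x - v).
  by rewrite cabsM ler_wpM2l ?cabs_ge0// cabs_kern// ltnS leqnn.
pose b := @cl_coef R n.
have tS : tempered_fun (@S_inv R n s) by rewrite S_invE;
  exact: (tempered_cl_comb N0 b mS kS).
have tF : tempered_fun (@F_kernel R n s) by rewrite F_kernelE;
  exact: (tempered_cl_comb N0 b mF kF).
have sgE : (fun xi => symbol xi *: cl_comb S_inv_hat b xi) = cl_comb symbol_S_inv_hat b.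
  apply/funext => xi; rewrite /cl_comb scaler_sumr; apply: eq_bigr => j _.
  by rewrite scalerA.
split=> //; exists (cl_comb S_inv_hat b); split.
- by split; [case: tS|case: tF].
- exact: (tempered_cl_comb N0 b cmeas_S_inv_hat cabs_S_inv_hat).
- move=> phi sp; rewrite /fourier_dist.
  have [M hM] := cfourier_le_weight N0 sp.
  have mfour : cmeas (fun t => fourier phi (rV t)).
    have := cmeas_cfourier (-1) (schwartz_cmeas sp).
    by under [X in cmeas X -> _]eq_fun do rewrite scaleN1r -fourierE.
  have fourB x : cabs (fourier phi x) <= M * weight x.
    rewrite fourierE; apply: le_trans (hM _) _.
    by rewrite -scaleN1r weight_sign// sqrrN expr1n.
  rewrite S_invE (regular_dist_cl_comb N0 b mS kS mfour fourB).
  rewrite (regular_dist_cl_comb N0 b cmeas_S_inv_hat cabs_S_inv_hat (schwartz_cmeas sp)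
    (fun x => schwartz_le_weight x sp)).
  by apply: eq_bigr => j _; rewrite fourier_S_coord.
- by rewrite sgE; exact: (tempered_cl_comb N0 b cmeas_symbol_S_inv_hat cabs_symbol_S_inv_hat).
- move=> phi sp; rewrite sgE /inv_fourier_dist.
  have [M hM] := cfourier_le_weight N0 sp.
  have B' x : cabs (inv_fourier phi x) <=
      cabs ((((2 * pi) ^+ N)^-1)%:C%C : C) * M * weight x.
    by rewrite inv_fourierE cabsM -mulrA ler_wpM2l ?cabs_ge0.
  rewrite F_kernelE (regular_dist_cl_comb N0 b mF kF (schwartz_cmeas sp)
    (fun x => schwartz_le_weight x sp)).
  rewrite (regular_dist_cl_comb N0 b cmeas_symbol_S_inv_hat
    cabs_symbol_S_inv_hat (cmeas_inv_fourier sp) B').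
  by apply: eq_bigr => j _; rewrite inv_fourier_S_coord.
Qed.

End EvenDimension.

(** * The odd case: iterated Laplacian away from the singularity *)

Section OddDimension.
Variables (R : realType) (n : nat) (s : R).
Local Notation N := n.+1.
Local Notation V := 'rV[R]_N.
Local Notation C := R[i].
Local Notation Cl := (clifford C n).
Local Notation c := (center n s).
Local Notation e_ i := (delta_mx 0 i : V).
Implicit Types (x : V) (i j : 'I_N) (p : nat).

(** The description is only made off the singularity, on an open set, and
    therefore passes to derivatives. *)
Definition represents (f : V -> Cl) (u : 'I_N -> V -> R) :=
  forall x, x != c -> f x = \sum_j (u j x)%:C%C *: cl_coef R j.

Lemma near_neq x : x != c -> \forall y \near x, y != c.
Proof.
move=> xc; have oc : open (~` [set c]).
  apply: closed_openC; apply: accessible_closed_set1.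
  by apply: hausdorff_accessible; exact: norm_hausdorff.
have : nbhs x (~` [set c]) by apply: open_nbhs_nbhs; split => //=; exact/eqP.
by apply: filterS => y /= yc; exact/eqP.
Qed.

(** A partial derivative at x depends only on the values near x, and the
    coefficients are constant. *)
Lemma represents_partial (f : V -> Cl) (u u' : 'I_N -> V -> R) i :
  represents f u ->
  (forall j x, x != c -> is_derive x (e_ i) (u j) (u' j x)) ->
  represents (cl_partial i f) u'.
Proof.
move=> fu du x xc; apply/ffunP => A; rewrite ffunE cl_sumE.
have part (part : C -> R) (k : 'I_N -> R) :
    (forall y, y != c -> part (f y A) = \sum_j u j y * k j) ->
    'D_(e_ i) (fun y => part (f y A)) x = \sum_j u' j x * k j.
  move=> fk; rewrite (@near_eq_derive _ _ _ _ (\sum_j (u j * cst (k j)))).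
    have h j : is_derive x (e_ i) (u j * cst (k j)) (u' j x * k j).
      have d := du j x xc; apply: is_derive_eq.
      by rewrite scaler0 add0r /GRing.scale /= mulrC.
    by have [_ ->] := is_derive_sum h.
  near=> y; rewrite fk; last by near: y; exact: near_neq.
  by apply/esym; elim/big_rec2 : _ => //= j a b _ <-.
rewrite /cpartial (part _ (fun j => complex.Re (cl_coef R j A))) => [|y yc];
  last first.
  rewrite fu// cl_sumE.
  rewrite (big_morph (@complex.Re R) (@ReD R) (erefl _)).
  by apply: eq_bigr => j _; rewrite clZE ReM /= mul0r subr0.
rewrite (part _ (fun j => complex.Im (cl_coef R j A))) => [|y yc]; last first.
  rewrite fu// cl_sumE.
  rewrite (big_morph (@complex.Im R) (@ImD R) (erefl _)).
  by apply: eq_bigr => j _; rewrite clZE ImM /= mul0r addr0.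
apply: complexE_ReIm => /=.
  rewrite (big_morph (@complex.Re R) (@ReD R) (erefl _)).
  by apply: eq_bigr => j _; rewrite clZE ReM /= mul0r subr0.
rewrite (big_morph (@complex.Im R) (@ImD R) (erefl _)).
by apply: eq_bigr => j _; rewrite clZE ImM /= mul0r addr0.
Unshelve. all: by end_near. Qed.

Lemma is_derive_of_line (g : V -> R) i x (d : R) :
  is_derive (0 : R) 1 (line g i x) d -> is_derive x (e_ i) g d.
Proof.
have e : (fun h : R => h^-1 *: ((line g i x \o shift 0) (h *: 1) - line g i x 0)) =
    (fun h : R => h^-1 *: ((g \o shift x) (h *: e_ i) - g x)).
  apply/funext => h; rewrite /line /= scale0r addr0 addr0.
  by rewrite [h *: 1]mulr1 (addrC x).
move=> [d1 d2]; move: d1 d2; rewrite /derivable /derive e => d1 d2.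
by apply: DeriveDef.
Qed.

Definition ycoord j x : R := (x - c) 0 j.
Definition qform x : R := enorm (x - c) ^+ 2.
Definition qinv x : R := (qform x)^-1.

Lemma qform_neq0 x : x != c -> qform x != 0.
Proof. by move=> xc; rewrite expf_neq0// enorm_eq0 subr_eq0. Qed.

Lemma sum_ycoord x : \sum_i ycoord i x ^+ 2 = qform x.
Proof. by rewrite /qform sqr_enorm. Qed.

Lemma is_derive_ycoord i j x : is_derive x (e_ i) (ycoord j) (j == i)%:R.
Proof.
apply: is_derive_of_line.
rewrite (_ : line _ _ _ = fun h : R => ycoord j x + h * (j == i)%:R);
  last first.
  by apply/funext => h; rewrite /line /ycoord !mxE eqxx /=; ring.
by apply: is_derive_eq; rewrite /GRing.scale /=; ring.
Qed.

Lemma is_derive_qform i x : is_derive x (e_ i) qform (2 * ycoord i x).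
Proof.
apply: is_derive_of_line.
rewrite (_ : line _ _ _ = fun h : R => qform x + 2 * h * ycoord i x + h ^+ 2);
  last first.
  apply/funext => h; rewrite /line /qform /ycoord.
  by rewrite -sqr_enorm_line; congr (enorm _ ^+ 2); rewrite addrAC.
by apply: is_derive_eq; rewrite /GRing.scale /=; ring.
Qed.

Lemma is_derive_qinvX i x p : x != c ->
  is_derive x (e_ i) (qinv ^+ p) (- 2 * p%:R * ycoord i x * qinv x ^+ p.+1).
Proof.
move=> xc; have q0 := qform_neq0 xc; have [d1 d2] := is_derive_qform i x.
have d : is_derive x (e_ i) qinv (- (qform x) ^- 2 *: (2 * ycoord i x)).
  by apply: DeriveDef; [exact: derivableV|rewrite deriveV// d2].
apply: is_derive_eq; rewrite /GRing.scale /=.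
case: p => [|p] /=; first by rewrite !mulr0 !mul0r.
rewrite -exprVn -/(qinv x) !exprS; ring.
Qed.

Definition power p j x : R := ycoord j x * qinv x ^+ p.

Definition dpower p i j x : R :=
  (j == i)%:R * qinv x ^+ p - 2 * p%:R * (ycoord i x * power p.+1 j x).

Lemma is_derive_power p i j x : x != c ->
  is_derive x (e_ i) (power p j) (dpower p i j x).
Proof.
move=> xc; have d1 := is_derive_ycoord i j x; have d2 := is_derive_qinvX i p xc.
rewrite (_ : power p j = ycoord j * qinv ^+ p); last first.
  by apply/funext => y; rewrite fctE exprfctE.
apply: is_derive_eq; rewrite exprfctE /dpower /power /GRing.scale /=; ring.
Qed.

Definition ddpower p i j x : R :=
  (j == i)%:R * (- 2 * p%:R * ycoord i x * qinv x ^+ p.+1)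
  - 2 * p%:R * (power p.+1 j x + ycoord i x * dpower p.+1 i j x).

Lemma is_derive_dpower p i j x : x != c ->
  is_derive x (e_ i) (dpower p i j) (ddpower p i j x).
Proof.
move=> xc; have d1 := is_derive_ycoord i i x; have d2 := is_derive_qinvX i p xc.
have d3 := is_derive_power p.+1 i j xc; rewrite eqxx in d1.
rewrite (_ : dpower p i j = cst ((j == i)%:R) * qinv ^+ p -
   cst (2 * p%:R) * (ycoord i * power p.+1 j)); last first.
  by apply/funext => y; rewrite !fctE.
by apply: is_derive_eq; rewrite /ddpower /GRing.scale /=; ring.
Qed.

(** Laplacian of y_j |y|^(-2p): the cross term contributes -4p, the Laplacian of
    |y|^(-2p) contributes 2p (2p + 2 - N), both times y_j |y|^(-2p-2). *)
Lemma sum_ddpower p j x : x != c ->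
  \sum_i ddpower p i j x = 2 * p%:R * (2 * p%:R - N%:R) * power p.+1 j x.
Proof.
move=> xc; have q0 := qform_neq0 xc.
transitivity (\sum_i ((j == i)%:R * (- 4 * p%:R * power p.+1 j x +
   (- 2) * p%:R * power p.+1 j x * 0)
   - 2 * p%:R * power p.+1 j x
   + 4 * p%:R * p.+1%:R * power p.+2 j x * ycoord i x ^+ 2)).
  apply: eq_bigr => i _; rewrite /ddpower /dpower.
  have [->|ji] := eqVneq j i; rewrite ?eqxx /power; first by rewrite /=; ring.
  by rewrite /=; ring.
rewrite !big_split /= -mulr_sumr sum_ycoord sumrN sumr_const card_ord.
rewrite (bigD1 j)//= eqxx big1 => [|i /negPf ij];
  last by rewrite eq_sym ij mul0r.
have e : power p.+2 j x * qform x = power p.+1 j x.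
  by rewrite /power exprSr mulrA /qinv mulfVK.
rewrite -(natr1 p); move: (power p.+2 j x) (power p.+1 j x) e => a b e.
rewrite -[_ *+ N]mulr_natr /= mulr1n; move: (N%:R : R) => d.
by rewrite -e; ring.
Qed.

Definition lap_cst (k : nat) : R :=
  \prod_(1 <= p < k.+1) (2 * p%:R * (2 * p%:R - N%:R)).

Lemma iter_laplacian_S_inv k : represents
  (iter k (@laplacian R N n) (@S_inv R n s))
  (fun j x => lap_cst k * power k.+1 j x).
Proof.
elim: k => [|k ih].
  move=> x xc; rewrite S_invE /lap_cst big_nil /=; apply: eq_bigr => j _.
  by rewrite mul1r /kern /power expr1.
have h1 i : represents (cl_partial i (iter k (@laplacian R N n) (@S_inv R n s)))
    (fun j x => lap_cst k * dpower k.+1 i j x).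
  apply: represents_partial ih _ => j x xc.
  have d := is_derive_power k.+1 i j xc.
  by apply: (is_deriveZ (lap_cst k) d).
have h2 i : represents (cl_partial i (cl_partial i
    (iter k (@laplacian R N n) (@S_inv R n s))))
    (fun j x => lap_cst k * ddpower k.+1 i j x).
  apply: represents_partial (h1 i) _ => j x xc.
  have d := is_derive_dpower k.+1 i j xc.
  by apply: (is_deriveZ (lap_cst k) d).
move=> x xc; rewrite iterS {1}/laplacian.
under eq_bigr => i _ do rewrite (h2 i x xc).
rewrite exchange_big; apply: eq_bigr => j _ /=.
rewrite -scaler_suml -rmorph_sum -mulr_sumr sum_ddpower//.
have -> : lap_cst k.+1 = lap_cst k * (2 * k.+1%:R * (2 * k.+1%:R - N%:R)).
  by rewrite /lap_cst big_nat_recr.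
by rewrite -[in RHS](mulrA (lap_cst k)).
Qed.

(** For N = 2 m + 2 the factor of index p is -4 p (m + 1 - p), and reversing the
    product gives a second m!. *)
Lemma lap_cst_odd m : n = (2 * m).+1 ->
  lap_cst m = (- 1) ^+ m * 4 ^+ m * m`!%:R ^+ 2.
Proof.
move=> nm; rewrite /lap_cst.
have -> : \prod_(1 <= p < m.+1) (2 * p%:R * (2 * p%:R - N%:R)) =
    \prod_(1 <= p < m.+1) ((- 1 * 4) * (p%:R * (m.+1 - p)%:R)) :> R.
  apply: eq_big_nat => p /andP[p1 pm];
    have -> :
      (m.+1 - p)%:R = m.+1%:R - p%:R :> R by rewrite natrB // ltnW.
  by rewrite [in LHS]nm -!natr1 natrM; ring.
rewrite big_split /= prodr_const_nat subSS subn0 exprMn; congr (_ * _).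
rewrite big_split /= -natr_prod -fact_prod expr2; congr (_ * _).
rewrite big_nat_rev /= fact_prod natr_prod; apply: eq_big_nat => p /andP[p1 pm].
by rewrite add1n subSS subKn// ltnW.
Qed.

Lemma iter_laplacian_S_inv_odd : odd n -> forall x, paravector x <> cl_real n s ->
  iter (n.-1)./2 (@laplacian R N n) (@S_inv R n s) x = F_kernel s x.
Proof.
move=> on x xs.
have xc : x != c.
  apply/eqP => xE; apply: xs; rewrite xE /paravector /vector_part center0.
  by rewrite big1 ?addr0// => l _; rewrite centerS scale0r.
have nm : n = (2 * (n.-1)./2).+1.
  rewrite -[LHS](odd_double_half n) on add1n mul2n; congr _.+1.
  by rewrite -[in RHS](odd_double_half n) on add1n /= doubleK.
set m := (n.-1)./2 in nm *.
rewrite iter_laplacian_S_inv// F_kernelE /cl_comb; apply: eq_bigr => j _.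
congr (_ *: _); rewrite (lap_cst_odd nm) /kern /gamma_const.
have -> : Gamma (N%:R / 2) = m`!%:R :> R.
  by rewrite -Gamma_nat; congr Gamma; rewrite nm -!natr1 natrM; field.
have -> : n.-1 = (2 * m)%N by rewrite {1}nm.
have -> : 'i%C ^+ (2 * m) = ((- 1) ^+ m)%:C%C :> C.
  by rewrite exprM sqr_i rmorphXn rmorphN rmorph1.
rewrite -!rmorphM; congr (_%:C)%C; rewrite exprM.
have -> : (2 ^+ 2 : R) = 4 by rewrite -natrX.
rewrite /power /qinv /qform -/c exprVn -exprM.
have -> : (2 * m.+1)%N = N by rewrite nm mulnS.
by rewrite /ycoord; ring.
Qed.

End OddDimension.

Theorem theorem5p1 (R : realType) (n : nat) (n_ge1 : (1 <= n)%N) (s : R) :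
  (odd n -> forall x : 'rV[R]_n.+1, paravector x <> cl_real n s ->
     iter (n.-1)./2 (@laplacian R n.+1 n) (@S_inv R n s) x = F_kernel s x) /\
  (~~ odd n ->
     [/\ tempered_fun (@S_inv R n s), tempered_fun (@F_kernel R n s) &
         frac_laplacian n.-1 (regular_dist (@S_inv R n s))
                             (regular_dist (@F_kernel R n s))]).
Proof.
split=> [on x xs|_]; first exact: iter_laplacian_S_inv_odd.
exact: frac_laplacian_S_inv n_ge1.
Qed.
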